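(* Let $(\mathcal A,H,D)$ be an even regular spectral triple with an action $\sigma$ of $\mathbb T^2$ implemented by $U$ and satisfying $\mathcal A=\mathcal A^\infty$ (standing setting in the context), and let $\theta\in\mathbb R$. Then the triple $(\mathcal A_\theta,H,D)$ is an even regular spectral triple. The action $\mathrm{Ad}_{U_t}$ of $\mathbb T^2$ on $\mathcal A_\theta$ is smooth, and $\mathcal A_\theta$ is complete with respect to the seminorms $\nu_{k,\alpha}$ for $k\in\mathbb N$ and $\alpha\in\mathbb N^2$.
   Context: Standing setting. $\mathbb T^2=(\mathbb R/\mathbb Z)^2$, $\mathbb N=\{0,1,2,\dots\}$. $(\mathcal A,H,D)$ is an even spectral triple: $H=H^0\oplus H^1$ is a graded Hilbert space, $\mathcal A$ is a $*$-algebra of even bounded operators on $H$, $D$ is an odd unbounded selfadjoint operator, $[D,a]$ is bounded and $a(1+D^2)^{-1/2}$ is compact for all $a\in\mathcal A$. With $\delta(T)=[|D|,T]$ (densely defined closed derivation on $B(H)$), regularity means $\mathcal A+[D,\mathcal A]\subset\bigcap_{k\ge1}\mathrm{dom}\,\delta^k$. $\mathcal A_\delta$ is the completion of $\mathcal A$ for the seminorms $\|\delta^k(\cdot)\|$, $\|\delta^k([D,\cdot])\|$, $k\in\mathbb N$. $\sigma$ is an action of $\mathbb T^2$ on $\mathcal A$ by $*$-automorphisms, strongly continuous for these seminorms, and $U$ is a strongly continuous unitary representation of $\mathbb T^2$ on $H$ by even unitaries with $\sigma_t(a)=\mathrm{Ad}_{U_t}(a)=U_taU_t^*$ and $U_tDU_t^*=D$.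 $\mathcal A^\infty$ is the algebra of $a\in\mathcal A_\delta$ for which $t\mapsto\sigma_t(a)$ has derivatives of all orders in $\mathcal A_\delta$; it is assumed that $\mathcal A=\mathcal A^\infty$. Seminorms. $h_1,h_2$ are the generators $h_i\xi=\lim_{t\to0}(U^{(i)}_t\xi-\xi)/t$ with $U^{(1)}_t=U_{(t,0)}$, $U^{(2)}_t=U_{(0,t)}$; $[h,a]^{(\alpha)}$ is the iterated commutator with $h_2$ taken $\alpha_2$ times followed by that with $h_1$ taken $\alpha_1$ times; $\nu_{k,\alpha}(a)=\|\delta^k([h,a]^{(\alpha)})\|+\|\delta^k([D,[h,a]^{(\alpha)}])\|$. ($\mathcal A^\infty$ is the joint domain of these seminorms in the norm closure of $\mathcal A$.) Deformation. $H_{(m,n)}=\{\xi: U_t\xi=e^{2\pi i(mt_1+nt_2)}\xi\}$. For $T\in B(H)$, $T_{(m,n)}=\int_{\mathbb T^2}e^{-2\pi i(mt_1+nt_2)}U_tTU_t^*\,dt$. If $T=T_{(m,n)}$, $T^{(\theta)}$ is defined by $T^{(\theta)}\xi=e^{\pi i\theta(mn'-m'n)}T\xi$ for $\xi\in H_{(m',n')}$; for $a\in\mathcal A$, $a^{(\theta)}=\sum_{(m,n)}(a_{(m,n)})^{(\theta)}$ (norm-convergent). $\mathcal A_\theta=\{a^{(\theta)}:a\in\mathcal A\}\subset B(H)$. *)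

(* Defs.v *)
(* Stdlib reals with Coquelicot: vector-valued Riemann integrals and complete
   normed modules come from there.  *)
From Stdlib Require Import Reals ZArith List ClassicalEpsilon.
From Coquelicot Require Import Coquelicot.

Set Implicit Arguments.
Unset Strict Implicit.
Open Scope R_scope.

(* A complex Hilbert space: a real Banach space whose real scalar
   multiplication extends to C and whose norm comes from a Hermitian inner
   product, linear in the first argument.  Keeping the real Banach structure as
   the carrier gives direct access to RInt for H-valued functions. *)
Record Hilbert := {
  hcar :> CompleteNormedModule R_AbsRing;
  cscal : C -> hcar -> hcar;
  inner : hcar -> hcar -> C;
  cscal_assoc : forall (a b : C) (x : hcar),
      cscal a (cscal b x) = cscal (Cmult a b) x;
  cscal_plus_r : forall (a : C) (x y : hcar),
      cscal a (plus x y) = plus (cscal a x) (cscal a y);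
  cscal_plus_l : forall (a b : C) (x : hcar),
      cscal (Cplus a b) x = plus (cscal a x) (cscal b x);
  cscal_real : forall (r : R) (x : hcar), cscal (RtoC r) x = scal r x;
  inner_plus_l : forall x y z : hcar,
      inner (plus x y) z = Cplus (inner x z) (inner y z);
  inner_cscal_l : forall (a : C) (x y : hcar),
      inner (cscal a x) y = Cmult a (inner x y);
  inner_conj : forall x y : hcar, inner y x = Cconj (inner x y);
  inner_norm : forall x : hcar, inner x x = RtoC (norm x * norm x)
}.

Definition op (H : Hilbert) := hcar H -> hcar H.

Section Operators.
Variable H : Hilbert.
Implicit Types (T S B : op H) (x y z : hcar H).

Definition op_plus T S : op H := fun x => plus (T x) (S x).
Definition op_minus T S : op H := fun x => minus (T x) (S x).
Definition op_scal (c : C) T : op H := fun x => cscal c (T x).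
Definition op_comp T S : op H := fun x => T (S x).
Definition op_zero : op H := fun _ => zero.

Definition bounded_op T : Prop :=
  (forall x y, T (plus x y) = plus (T x) (T y)) /\
  (forall c x, T (cscal c x) = cscal c (T x)) /\
  (exists M : R, forall x, norm (T x) <= M * norm x).

(* Only meaningful on bounded operators. *)
Definition opnorm T : R :=
  real (Lub_Rbar (fun r => exists x, norm x <= 1 /\ r = norm (T x))).

Definition is_adjoint T S : Prop := forall x y, inner (T x) y = inner x (S y).

Definition positive_op T : Prop :=
  forall x, 0 <= Re (inner (T x) x) /\ Im (inner (T x) x) = 0.

Definition compact_op T : Prop :=
  forall u : nat -> hcar H,
    (exists M : R, forall n, norm (u n) <= M) ->
    exists (phi : nat -> nat) (l : hcar H),
      (forall n, (phi n < phi (S n))%nat) /\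
      filterlim (fun n => T (u (phi n))) eventually (locally l).

(* Partially defined operators; the values of [pfun] outside [dom] are
   irrelevant. *)
Record pop := { dom : hcar H -> Prop; pfun :> hcar H -> hcar H }.
Implicit Types P Q : pop.

Definition pop_eq P Q : Prop :=
  (forall x, dom P x <-> dom Q x) /\ (forall x, dom P x -> P x = Q x).

Definition pop_comp P Q : pop :=
  {| dom := fun x => dom Q x /\ dom P (Q x); pfun := fun x => P (Q x) |}.

Definition pop_linear P : Prop :=
  dom P zero /\
  (forall x y, dom P x -> dom P y ->
     dom P (plus x y) /\ P (plus x y) = plus (P x) (P y)) /\
  (forall c x, dom P x -> dom P (cscal c x) /\ P (cscal c x) = cscal c (P x)).

Definition densely_defined P : Prop :=
  forall x (eps : R), 0 < eps -> exists y, dom P y /\ norm (minus x y) < eps.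

(* The left-hand side of the equivalence is the graph of the adjoint of P. *)
Definition selfadjoint P : Prop :=
  pop_linear P /\ densely_defined P /\
  forall y z,
    (forall x, dom P x -> inner (P x) y = inner x z) <-> (dom P y /\ P y = z).

Definition positive_pop P : Prop :=
  forall x, dom P x -> 0 <= Re (inner (P x) x) /\ Im (inner (P x) x) = 0.

(* |D|: the positive selfadjoint square root of D^2. *)
Definition is_abs (D absD : pop) : Prop :=
  selfadjoint absD /\ positive_pop absD /\
  pop_eq (pop_comp absD absD) (pop_comp D D).

(* (1 + D^2)^{-1/2}: the positive square root of the bounded inverse of
   1 + D^2. *)
Definition is_inv_sqrt (D : pop) (J : op H) : Prop :=
  bounded_op J /\ positive_op J /\
  (forall x, dom (pop_comp D D) (J (J x)) /\
             plus (J (J x)) (D (D (J (J x)))) = x) /\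
  (forall x, dom (pop_comp D D) x -> J (J (plus x (D (D x)))) = x).

(* B is the bounded extension of P T - T P; as usual, T must preserve the
   domain of P. *)
Definition is_comm P T B : Prop :=
  bounded_op B /\
  forall x, dom P x -> dom P (T x) /\ B x = minus (P (T x)) (T (P x)).

Definition has_comm P T : Prop := exists B, is_comm P T B.

Definition comm P T : op H := epsilon (inhabits op_zero) (is_comm P T).

(* T is in the domain of the k-th power of the derivation [P, .]. *)
Definition dom_iter_comm P (k : nat) T : Prop :=
  bounded_op T /\
  forall j, (j < k)%nat -> has_comm P (Nat.iter j (comm P) T).

Definition iter_comm P (k : nat) T : op H := Nat.iter k (comm P) T.

(* [G false] and [G true] are the subspaces H^0 and H^1. *)
Definition is_grading (G : bool -> hcar H -> Prop) : Prop :=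
  (forall i, G i zero /\
     (forall x y, G i x -> G i y -> G i (plus x y)) /\
     (forall c x, G i x -> G i (cscal c x)) /\
     closed (G i)) /\
  (forall x y, G false x -> G true y -> inner x y = RtoC 0) /\
  (forall x, exists x0 x1, G false x0 /\ G true x1 /\ x = plus x0 x1).

Definition even_op (G : bool -> hcar H -> Prop) T : Prop :=
  forall i x, G i x -> G i (T x).

Definition odd_pop (G : bool -> hcar H -> Prop) P : Prop :=
  (forall x, dom P x -> exists x0 x1,
     G false x0 /\ G true x1 /\ dom P x0 /\ dom P x1 /\ x = plus x0 x1) /\
  (forall i x, dom P x -> G i x -> G (negb i) (P x)).

Definition star_algebra (A : op H -> Prop) : Prop :=
  A op_zero /\
  (forall T, A T -> bounded_op T) /\
  (forall T S, A T -> A S -> A (op_plus T S)) /\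
  (forall c T, A T -> A (op_scal c T)) /\
  (forall T S, A T -> A S -> A (op_comp T S)) /\
  (forall T, A T -> exists S, A S /\ is_adjoint T S).

(* J stands for (1 + D^2)^{-1/2}; see [is_inv_sqrt]. *)
Definition even_spectral_triple (G : bool -> hcar H -> Prop)
    (A : op H -> Prop) (D : pop) (J : op H) : Prop :=
  is_grading G /\
  star_algebra A /\
  (forall a, A a -> even_op G a) /\
  selfadjoint D /\ odd_pop G D /\
  (forall a, A a -> has_comm D a) /\
  (forall a, A a -> compact_op (op_comp a J)).

Definition regular (A : op H -> Prop) (D absD : pop) : Prop :=
  forall a b, A a -> A b ->
    forall k, dom_iter_comm absD k (op_plus a (comm D b)).

(* The operators on which the seminorms ||delta^k(.)|| and
   ||delta^k([D,.])|| are all defined. *)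
Definition delta_dom (D absD : pop) T : Prop :=
  (forall k, dom_iter_comm absD k T) /\
  has_comm D T /\
  (forall k, dom_iter_comm absD k (comm D T)).

(* ||delta^k(T)|| for j = false and ||delta^k([D,T])|| for j = true. *)
Definition delta_seminorm (D absD : pop) (j : bool) (k : nat) T : R :=
  opnorm (iter_comm absD k (if j then comm D T else T)).

(* The completion of A for these seminorms.  Since delta and [D, .] are closed
   and the operator norm is among the seminorms, delta_dom is complete and the
   completion is the closure of A in it. *)
Definition delta_completion (A : op H -> Prop) (D absD : pop) T : Prop :=
  delta_dom D absD T /\
  exists a : nat -> op H,
    (forall n, A (a n)) /\
    forall j k,
      is_lim_seq (fun n => delta_seminorm D absD j k (op_minus (a n) T)) 0.

Definition delta_continuous (D absD : pop) (f : R -> R -> op H) : Prop :=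
  forall j k s t,
    filterlim (fun p : R * R =>
        delta_seminorm D absD j k (op_minus (f (fst p) (snd p)) (f s t)))
      (locally (s, t)) (locally 0).

Definition delta_partial1 (D absD : pop) (f g : R -> R -> op H) : Prop :=
  forall j k s t,
    is_lim (fun h => delta_seminorm D absD j k
      (op_minus (op_scal (RtoC (/ h)) (op_minus (f (s + h) t) (f s t)))
                (g s t))) 0 0.

Definition delta_partial2 (D absD : pop) (f g : R -> R -> op H) : Prop :=
  forall j k s t,
    is_lim (fun h => delta_seminorm D absD j k
      (op_minus (op_scal (RtoC (/ h)) (op_minus (f s (t + h)) (f s t)))
                (g s t))) 0 0.

(* f is C^oo as a map into the space X topologised by the seminorms
   ||delta^k(.)||, ||delta^k([D,.])||; F i j is the partial derivative of
   order (i, j). *)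
Definition delta_smooth (X : op H -> Prop) (D absD : pop)
    (f : R -> R -> op H) : Prop :=
  exists F : nat -> nat -> R -> R -> op H,
    (forall s t, F 0%nat 0%nat s t = f s t) /\
    forall i j,
      (forall s t, X (F i j s t)) /\
      delta_continuous D absD (F i j) /\
      delta_partial1 D absD (F i j) (F (S i) j) /\
      delta_partial2 D absD (F i j) (F i (S j)).

(* Maps on the torus (R/Z)^2 are Z^2-periodic maps on R^2. *)
Definition torus_unitary_rep (U : R -> R -> op H) : Prop :=
  (forall s t, bounded_op (U s t)) /\
  (forall s t x y, inner (U s t x) (U s t y) = inner x y) /\
  (forall x, U 0 0 x = x) /\
  (forall s t s' t' x, U (s + s') (t + t') x = U s t (U s' t' x)) /\
  (forall x, U 1 0 x = x) /\
  (forall x, U 0 1 x = x) /\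
  (forall x (p : R * R), continuous (fun q : R * R => U (fst q) (snd q) x) p).

(* U_t T U_t^*, where U_t^* = U_{-t}. *)
Definition Ad (U : R -> R -> op H) (s t : R) T : op H :=
  fun x => U s t (T (U (- s) (- t) x)).

Definition Ad_pop (U : R -> R -> op H) (s t : R) P : pop :=
  {| dom := fun x => dom P (U (- s) (- t) x);
     pfun := fun x => U s t (P (U (- s) (- t) x)) |}.

Definition A_infty (A : op H -> Prop) (D absD : pop) (U : R -> R -> op H)
    T : Prop :=
  delta_completion A D absD T /\
  delta_smooth (delta_completion A D absD) D absD (fun s t => Ad U s t T).

Definition smooth_action (A : op H -> Prop) (D absD : pop)
    (U : R -> R -> op H) : Prop :=
  (forall s t a, A a -> A (Ad U s t a)) /\
  (forall a, A a -> delta_smooth A D absD (fun s t => Ad U s t a)).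

Definition is_generator_value (V : R -> op H) x y : Prop :=
  filterlim (fun t : R => scal (/ t) (minus (V t x) x))
    (locally' (0 : R)) (locally y).

Definition generator (V : R -> op H) : pop :=
  {| dom := fun x => exists y, is_generator_value V x y;
     pfun := fun x => epsilon (inhabits zero) (is_generator_value V x) |}.

Definition h1 (U : R -> R -> op H) : pop := generator (fun t => U t 0).
Definition h2 (U : R -> R -> op H) : pop := generator (fun t => U 0 t).

Definition hcomm (U : R -> R -> op H) (al : nat * nat) T : op H :=
  iter_comm (h1 U) (fst al) (iter_comm (h2 U) (snd al) T).

Definition nu_dom (D absD : pop) (U : R -> R -> op H) (k : nat)
    (al : nat * nat) T : Prop :=
  dom_iter_comm (h2 U) (snd al) T /\
  dom_iter_comm (h1 U) (fst al) (iter_comm (h2 U) (snd al) T) /\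
  dom_iter_comm absD k (hcomm U al T) /\
  has_comm D (hcomm U al T) /\
  dom_iter_comm absD k (comm D (hcomm U al T)).

Definition nu (D absD : pop) (U : R -> R -> op H) (k : nat)
    (al : nat * nat) T : R :=
  opnorm (iter_comm absD k (hcomm U al T)) +
  opnorm (iter_comm absD k (comm D (hcomm U al T))).

(* The family of seminorms is countable, so sequential completeness is
   completeness. *)
Definition nu_complete (A : op H -> Prop) (D absD : pop)
    (U : R -> R -> op H) : Prop :=
  (forall a, A a -> forall k al, nu_dom D absD U k al a) /\
  forall a : nat -> op H,
    (forall n, A (a n)) ->
    (forall k al (eps : R), 0 < eps ->
       exists N, forall n m, (N <= n)%nat -> (N <= m)%nat ->
         nu D absD U k al (op_minus (a n) (a m)) < eps) ->
    exists b, A b /\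
      forall k al, is_lim_seq (fun n => nu D absD U k al (op_minus (a n) b)) 0.

Definition cis (r : R) : C := (cos r, sin r).

Definition spectral_subspace (U : R -> R -> op H) (m n : Z) x : Prop :=
  forall s t, U s t x = cscal (cis (2 * PI * (IZR m * s + IZR n * t))) x.

(* T_(m,n); the integral over the torus is taken in the strong sense. *)
Definition spectral_component (U : R -> R -> op H) (m n : Z) T : op H :=
  fun x =>
    RInt (fun s : R => RInt (fun t : R =>
      cscal (cis (- (2 * PI * (IZR m * s + IZR n * t)))) (Ad U s t T x))
      0 1) 0 1.

Definition is_twist (U : R -> R -> op H) (theta : R) (m n : Z) T S : Prop :=
  bounded_op S /\
  forall (m' n' : Z) x, spectral_subspace U m' n' x ->
    S x = cscal (cis (PI * theta * (IZR m * IZR n' - IZR m' * IZR n))) (T x).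

(* T^(theta) for T homogeneous of degree (m,n); it is unique because the
   spectral subspaces span a dense subspace. *)
Definition twist (U : R -> R -> op H) (theta : R) (m n : Z) T : op H :=
  epsilon (inhabits op_zero) (is_twist U theta m n T).

Definition deform_partial_sum (U : R -> R -> op H) (theta : R) T
    (L : list (Z * Z)) : op H :=
  fold_right (fun p S =>
      op_plus (twist U theta (fst p) (snd p)
                 (spectral_component U (fst p) (snd p) T)) S)
    op_zero L.

(* S is the norm limit of the series over Z^2, summed along finite subsets. *)
Definition is_deform (U : R -> R -> op H) (theta : R) T S : Prop :=
  bounded_op S /\
  forall eps : R, 0 < eps ->
    exists L0, forall L, NoDup L -> incl L0 L ->
      opnorm (op_minus S (deform_partial_sum U theta T L)) < eps.

Definition deform (U : R -> R -> op H) (theta : R) T : op H :=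
  epsilon (inhabits op_zero) (is_deform U theta T).

Definition A_theta (A : op H -> Prop) (U : R -> R -> op H) (theta : R)
    T : Prop :=
  exists a, A a /\ T = deform U theta a.

End Operators.

(* Main.v *)
(* If T is homogeneous of degree (m,n) then T^(theta) = U_tau T with
   tau = (- theta n / 2, theta m / 2), and U_tau commutes with T.  Since U
   commutes with D and |D|, left multiplication by U_tau preserves the domains
   of delta and [D,.] and all the seminorms.  The smoothness of the action makes
   the components of a in A rapidly decreasing for every seminorm, and
   conversely the sum of a rapidly decreasing family of homogeneous elements of A
   is smooth and lies in the completion, hence in A, because A is complete for
   smooth elements.  So A_theta consists of the sums of U_tau(d_i) c_i over the
   rapidly decreasing families of homogeneous c_i in A, and each claim reduces to
   the c_i: products become double families with phases of modulus one,
   compactness follows by norm limits, and a nu-Cauchy sequence converges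
   componentwise with the decay preserved.

   That U commutes with |D| comes from the uniqueness of the positive square root
   of the bounded operator R - R^2 with R = (1+D^2)^{-1}, namely |D| R. *)

(* The vector tau is orthogonal to the degree (m,n). Hence moving [U_tau] through an element of that
   degree costs no phase, and through one of another degree only a scalar of modulus one.

   Families are indexed by an arbitrary type with a degree map, not by Z^2: a product is a family
   over pairs in which degrees repeat, an adjoint reverses degrees, and a single homogeneous element
   is a family with one member. Regrouping by degree is avoided: bounded operators are compared
   through their homogeneous components, which determine them by uniqueness of the Fourier
   coefficients of a continuous function.

   The delicate membership is that the components of an element of A lie in A. A strong integral
   need not be a limit in the seminorms, but continuity of the action for the seminorms makes its
   Riemann sums converge there, which places it in the completion; being homogeneous, it is smooth.

   Commutators, twists and sums are values of a choice operator, so each identity for them needs an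
   explicit candidate and a uniqueness argument. *)
Require Import Defs.
From Stdlib Require Import Reals ZArith List ClassicalEpsilon FunctionalExtensionality.
From Stdlib Require Import Lra Lia Permutation.
From Coquelicot Require Import Coquelicot.
From mathcomp Require Import ssreflect.

Set Implicit Arguments.
Unset Strict Implicit.
Open Scope R_scope.

(** * Real inner product calculus in a complex Hilbert space *)

Section HilbertSpace.
Context {H : Hilbert}.
Implicit Types x y z : H.

(** The real part carries all the information, since the imaginary part is recovered through [Ci] in
    [inner_rin]; being real valued, it admits order arguments and scalar integrals. *)
Definition rin x y : R := Re (inner x y).

Lemma inner_zero_l y : inner zero y = RtoC 0.
Proof.
by rewrite -(scal_zero_l (zero : H)) -cscal_real inner_cscal_l Cmult_0_l.
Qed.

Lemma inner_opp_l x y : inner (opp x) y = Copp (inner x y).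
Proof.
have -> : opp x = cscal (RtoC (-1)) x.
  by rewrite cscal_real -scal_opp_one.
rewrite inner_cscal_l; apply injective_projections => /=; ring.
Qed.

Lemma inner_minus_l x y z : inner (minus x y) z = Cminus (inner x z) (inner y z).
Proof. by rewrite /minus inner_plus_l inner_opp_l. Qed.

Lemma inner_scal_l (r : R) x y : inner (scal r x) y = Cmult (RtoC r) (inner x y).
Proof. by rewrite -cscal_real inner_cscal_l. Qed.

Lemma inner_cscal_r (a : C) x y : inner x (cscal a y) = Cmult (Cconj a) (inner x y).
Proof.
rewrite (inner_conj _ x) inner_cscal_l (inner_conj x y).
by apply injective_projections => /=; ring.
Qed.

Lemma rin_self x : rin x x = norm x * norm x.
Proof. by rewrite /rin inner_norm. Qed.

Lemma rin_sym x y : rin x y = rin y x.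
Proof. by rewrite /rin (inner_conj x y). Qed.

Lemma rin_plus_l x y z : rin (plus x y) z = rin x z + rin y z.
Proof. by rewrite /rin inner_plus_l. Qed.

Lemma rin_opp_l x z : rin (opp x) z = - rin x z.
Proof. by rewrite /rin inner_opp_l. Qed.

Lemma rin_minus_l x y z : rin (minus x y) z = rin x z - rin y z.
Proof. by rewrite /minus rin_plus_l rin_opp_l. Qed.

Lemma rin_scal_l (r : R) x z : rin (scal r x) z = r * rin x z.
Proof. rewrite /rin inner_scal_l /Re /=; ring. Qed.

Lemma rin_zero_l z : rin zero z = 0.
Proof. by rewrite /rin inner_zero_l. Qed.

Lemma rin_plus_r x y z : rin z (plus x y) = rin z x + rin z y.
Proof. by rewrite !(rin_sym z) rin_plus_l. Qed.

Lemma rin_opp_r x z : rin z (opp x) = - rin z x.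
Proof. by rewrite !(rin_sym z) rin_opp_l. Qed.

Lemma rin_minus_r x y z : rin z (minus x y) = rin z x - rin z y.
Proof. by rewrite !(rin_sym z) rin_minus_l. Qed.

Lemma rin_scal_r (r : R) x z : rin z (scal r x) = r * rin z x.
Proof. by rewrite !(rin_sym z) rin_scal_l. Qed.

Lemma rin_zero_r z : rin z zero = 0.
Proof. by rewrite rin_sym rin_zero_l. Qed.

Lemma inner_ext x y : (forall z, inner x z = inner y z) -> x = y.
Proof.
move=> E.
have N : norm (minus x y) = 0.
  have := inner_norm (minus x y).
  rewrite {1}/minus inner_plus_l inner_opp_l E => Q.
  have : norm (minus x y) * norm (minus x y) = 0.
    by move: (f_equal fst Q) => /=; lra.
  by move/Rmult_integral; case.
have := norm_eq_zero _ N => M.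
have -> : x = plus (minus x y) y.
  by rewrite /minus -plus_assoc plus_opp_l plus_zero_r.
by rewrite M plus_zero_l.
Qed.

Lemma inner_rin x y : inner x y = (rin x y, - rin (cscal Ci x) y).
Proof.
rewrite /rin inner_cscal_l; apply injective_projections => //=; ring.
Qed.

Lemma rin_ext x y : (forall z, rin x z = rin y z) -> x = y.
Proof.
move=> E; apply: inner_ext => z.
rewrite (inner_conj z x) (inner_conj z y) !inner_rin.
by rewrite !(rin_sym z) !(rin_sym (cscal Ci z)) !E.
Qed.

Lemma norm_pos x : 0 <= norm x.
Proof. exact: norm_ge_0. Qed.

Lemma norm_sq_eq x y : rin x x = rin y y -> norm x = norm y.
Proof.
rewrite !rin_self => E.
have := norm_pos x; have := norm_pos y => a b; nra.
Qed.

Lemma norm_sq_le x y : rin x x <= rin y y -> norm x <= norm y.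
Proof.
rewrite !rin_self => E.
have := norm_pos x; have := norm_pos y => a b; nra.
Qed.

Lemma norm_cscal (c : C) x : norm (cscal c x) = Cmod c * norm x.
Proof.
have E : norm (cscal c x) * norm (cscal c x) = (Cmod c * norm x) * (Cmod c * norm x).
  rewrite -rin_self /rin inner_cscal_l inner_cscal_r inner_norm.
  have M := Cmod2_conj c.
  have -> : Cmod c * norm x * (Cmod c * norm x) = Cmod c ^ 2 * (norm x * norm x) by ring.
  have -> : Cmult c (Cmult (Cconj c) (RtoC (norm x * norm x))) =
            Cmult (RtoC (Cmod c ^ 2)) (RtoC (norm x * norm x)).
    by rewrite M Cmult_assoc.
  rewrite /=; ring.
have := norm_pos (cscal c x); have := norm_pos x; have := Cmod_ge_0 c => a b d.
have : 0 <= Cmod c * norm x by nra.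
nra.
Qed.

Lemma norm_scal_eq (r : R) x : norm (scal r x) = Rabs r * norm x.
Proof. by rewrite -cscal_real norm_cscal Cmod_R. Qed.

Lemma norm_minus_sym x y : norm (minus x y) = norm (minus y x).
Proof. by rewrite -norm_opp opp_minus. Qed.

Lemma norm_le_plus x y : norm (plus x y) <= norm x + norm y.
Proof. exact: norm_triangle. Qed.

Lemma norm_le_minus x y : norm (minus x y) <= norm x + norm y.
Proof. by rewrite -(norm_opp y); exact: norm_triangle. Qed.

Lemma norm_minus_trans x y z : norm (minus x z) <= norm (minus x y) + norm (minus y z).
Proof.
have -> : minus x z = plus (minus x y) (minus y z).
  by apply: inner_ext => w; rewrite ?(inner_plus_l, inner_opp_l); ring.
exact: norm_triangle.
Qed.

(** The vector [|y|^2 x - (x,y) y] is a multiple of the part of x orthogonal to y, and its squared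
    norm is [|y|^2] times the defect of the squared inequality. The scaling avoids a division. *)
Lemma cauchy_schwarz x y : Rabs (rin x y) <= norm x * norm y.
Proof.
case: (Req_dec (norm y) 0) => [Hy|Hy].
  by rewrite (norm_eq_zero _ Hy) rin_zero_r Rabs_R0 norm_zero; lra.
have hy := norm_pos y; have hx := norm_pos x.
have P : 0 <= rin (minus (scal (norm y * norm y) x) (scal (rin x y) y))
                  (minus (scal (norm y * norm y) x) (scal (rin x y) y)).
  by rewrite rin_self; have := norm_pos (minus (scal (norm y * norm y) x) (scal (rin x y) y)); nra.
move: P; rewrite !(rin_minus_l, rin_minus_r, rin_scal_l, rin_scal_r) (rin_sym y x) !rin_self.
set a := rin x y; set n := norm y; set m := norm x => P.
have Q : 0 <= n * n * (m * m * (n * n) - a * a) by nra.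
have Q' : a * a <= (m * n) * (m * n).
  have np : 0 < n by case: hy => // E0; case: Hy.
  have nn : 0 < n * n by nra.
  by apply: (Rmult_le_reg_l (n * n)) => //; lra.
have mn : 0 <= m * n by apply: Rmult_le_pos.
by rewrite -(Rabs_pos_eq (m * n)) //; apply: Rsqr_le_abs_0; rewrite /Rsqr.
Qed.

Lemma norm_zero_eq x y : norm (minus x y) = 0 -> x = y.
Proof.
move/norm_eq_zero => E; rewrite -(plus_zero_l y) -E.
by rewrite /minus -plus_assoc plus_opp_l plus_zero_r.
Qed.

Lemma norm_small_eq x y : (forall eps, 0 < eps -> norm (minus x y) <= eps) -> x = y.
Proof.
move=> E; apply: norm_zero_eq.
have P := norm_pos (minus x y).
case: (Req_dec (norm (minus x y)) 0) => // N.
have E' := E (norm (minus x y) / 2).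
have : 0 < norm (minus x y) / 2 by lra.
move/E'; lra.
Qed.

End HilbertSpace.

(** Pairing with an arbitrary vector turns an identity between vectors into a ring identity in C.
    Values of operators count as atoms, so their linearity has to be applied beforehand. *)
Ltac cvec :=
  apply: inner_ext => ?;
  rewrite ?(inner_minus_l, inner_plus_l, inner_opp_l, inner_scal_l, inner_cscal_l, inner_zero_l);
  ring.

Ltac rvec :=
  rewrite ?(rin_plus_l, rin_minus_l, rin_opp_l, rin_scal_l, rin_zero_l,
    rin_plus_r, rin_minus_r, rin_opp_r, rin_scal_r, rin_zero_r).

(** * Unit complex numbers *)

Lemma Cmod_cis r : Cmod (cis r) = 1.
Proof.
rewrite /Cmod /cis /= -[RHS]sqrt_1; f_equal.
have := sin2_cos2 r; rewrite /Rsqr; lra.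
Qed.

Lemma cis_plus a b : cis (a + b) = Cmult (cis a) (cis b).
Proof. rewrite /cis /Cmult /= sin_plus cos_plus; f_equal; ring. Qed.

Lemma cis_0 : cis 0 = RtoC 1.
Proof. by rewrite /cis cos_0 sin_0. Qed.

Lemma cis_conj a : Cconj (cis a) = cis (- a).
Proof. by rewrite /cis /Cconj /= cos_neg sin_neg. Qed.

Lemma cis_opp_l a : Cmult (cis (- a)) (cis a) = RtoC 1.
Proof. by rewrite -cis_plus Rplus_opp_l cis_0. Qed.

Lemma cis_2PI_Z (m : Z) : cis (2 * PI * IZR m) = RtoC 1.
Proof.
have N : forall n : nat, cis (2 * PI * INR n) = RtoC 1.
  elim=> [|n IH]; first by rewrite Rmult_0_r cis_0.
  rewrite S_INR Rmult_plus_distr_l cis_plus IH Rmult_1_r /cis cos_2PI sin_2PI.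
  by rewrite Cmult_1_l.
case: (Z_le_gt_dec 0 m) => h.
  by rewrite -(Z2Nat.id m) // -INR_IZR_INZ N.
have -> : m = (- Z.of_nat (Z.to_nat (- m)))%Z by lia.
rewrite opp_IZR -INR_IZR_INZ.
have -> : 2 * PI * - INR (Z.to_nat (- m)) = - (2 * PI * INR (Z.to_nat (- m))) by ring.
rewrite -cis_conj N; apply injective_projections => /=; ring.
Qed.

Lemma cis_PI : cis PI = RtoC (-1).
Proof. by rewrite /cis cos_PI sin_PI. Qed.

(** * Bounded operators and the operator norm *)

Section Operators.
Context {H : Hilbert}.
Implicit Types (T S B : op H) (x y z : H).

Definition bnd (M : R) T : Prop := forall x, norm (T x) <= M * norm x.

Lemma op_ext T S : (forall x, T x = S x) -> T = S.
Proof. by move=> E; apply: functional_extensionality. Qed.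

Lemma bo_plus T : bounded_op T -> forall x y, T (plus x y) = plus (T x) (T y).
Proof. by case. Qed.
Lemma bo_cscal T : bounded_op T -> forall c x, T (cscal c x) = cscal c (T x).
Proof. by case=> _ []. Qed.
Lemma bo_scal T : bounded_op T -> forall (r : R) x, T (scal r x) = scal r (T x).
Proof. by move=> h r x; rewrite -!cscal_real bo_cscal. Qed.
Lemma bo_zero T : bounded_op T -> T zero = zero.
Proof.
move=> h; rewrite -(scal_zero_l (zero : H)) bo_scal // scal_zero_l.
by rewrite scal_zero_l.
Qed.
Lemma bo_opp T : bounded_op T -> forall x, T (opp x) = opp (T x).
Proof. by move=> h x; rewrite -(scal_opp_one x) bo_scal // scal_opp_one. Qed.
Lemma bo_minus T : bounded_op T -> forall x y, T (minus x y) = minus (T x) (T y).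
Proof. by move=> h x y; rewrite /minus bo_plus // bo_opp. Qed.

Lemma bounded_bnd T : bounded_op T -> exists M, 0 <= M /\ bnd M T.
Proof.
case=> _ [_ [M h]]; exists (Rabs M); split; first exact: Rabs_pos.
move=> x; apply: Rle_trans (h x) _.
apply: Rmult_le_compat_r; [exact: norm_pos | exact: Rle_abs].
Qed.

Lemma opnorm_le T M : 0 <= M -> bnd M T -> opnorm T <= M.
Proof.
move=> M0 h; rewrite /opnorm.
set E := (fun r => _).
(* [real] sends an infinite bound to 0, so those cases only need 0 <= M. *)
have := Lub_Rbar_correct E; case: (Lub_Rbar E) => [l||] //= [ub least].
have := least (Finite M); apply=> r [x [hx ->]] /=.
apply: Rle_trans (h x) _; have := norm_pos x; nra.
Qed.

(** Homogeneity reduces the estimate to the unit vector x/|x|. Boundedness of T excludes an infinite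
    supremum, for which [opnorm] would be 0. *)
Lemma opnorm_bnd T : bounded_op T -> bnd (opnorm T) T.
Proof.
move=> hT x; have [M [M0 h]] := bounded_bnd hT; rewrite /opnorm.
set E := (fun r => _).
have := Lub_Rbar_correct E; case: (Lub_Rbar E) => [l||] [ub least].
- case: (Req_dec (norm x) 0) => hx.
    by rewrite hx Rmult_0_r (norm_eq_zero _ hx) bo_zero // norm_zero; lra.
  have px := norm_pos x.
  have ix : 0 <= / norm x.
    by apply: Rlt_le; apply: Rinv_0_lt_compat; case: px => // E0; case: hx.
  have : E (norm (T (scal (/ norm x) x))).
    exists (scal (/ norm x) x); split => //.
    rewrite norm_scal_eq Rabs_pos_eq //.
    by rewrite Rinv_l //; lra.
  move/ub => /=; rewrite bo_scal // norm_scal_eq Rabs_pos_eq //.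
  have px' : 0 < norm x by case: px => // E0; case: hx.
  move=> h'; apply: (Rmult_le_reg_l (/ norm x)); first by apply: Rinv_0_lt_compat.
  apply: Rle_trans h' _; right; field; lra.
- have : Rbar_le p_infty (Finite M).
    apply: least => r [y [hy ->]] /=.
    apply: Rle_trans (h y) _; have := norm_pos y; nra.
  by [].
- have : Rbar_le (norm (T zero)) m_infty.
    by apply: ub; exists zero; rewrite norm_zero; split => //; lra.
  by [].
Qed.

Lemma opnorm_pos T : bounded_op T -> 0 <= opnorm T.
Proof.
move=> hT; have [M [M0 h]] := bounded_bnd hT; rewrite /opnorm.
set E := (fun r => _).
have := Lub_Rbar_correct E; case: (Lub_Rbar E) => [l||] [ub least] //=; try lra.
have : Rbar_le (norm (T zero)) l.
  by apply: ub; exists zero; rewrite norm_zero; split => //; lra.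
by rewrite /= bo_zero // norm_zero.
Qed.

Lemma bnd_bounded T M : (forall x y, T (plus x y) = plus (T x) (T y)) ->
  (forall c x, T (cscal c x) = cscal c (T x)) -> bnd M T -> bounded_op T.
Proof. by move=> a b c; split=> //; split=> //; exists M. Qed.

Lemma bo_op_zero : bounded_op (@op_zero H).
Proof.
apply: (@bnd_bounded _ 0).
- by move=> x y; rewrite /op_zero plus_zero_l.
- by move=> c x; rewrite /op_zero; cvec.
- by move=> x; rewrite /op_zero norm_zero; lra.
Qed.

Lemma bo_op_plus T S : bounded_op T -> bounded_op S -> bounded_op (op_plus T S).
Proof.
move=> hT hS; apply: (@bnd_bounded _ (opnorm T + opnorm S)).
- by move=> x y; rewrite /op_plus (bo_plus hT) (bo_plus hS); cvec.
- by move=> c x; rewrite /op_plus (bo_cscal hT) (bo_cscal hS); cvec.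
- move=> x; rewrite /op_plus; apply: Rle_trans (norm_triangle _ _) _.
  by rewrite Rmult_plus_distr_r; apply: Rplus_le_compat; apply: opnorm_bnd.
Qed.

Lemma bo_op_scal c T : bounded_op T -> bounded_op (op_scal c T).
Proof.
move=> hT; apply: (@bnd_bounded _ (Cmod c * opnorm T)).
- by move=> x y; rewrite /op_scal (bo_plus hT); cvec.
- by move=> a x; rewrite /op_scal (bo_cscal hT); cvec.
- move=> x; rewrite /op_scal norm_cscal Rmult_assoc.
  by apply: Rmult_le_compat_l; [apply: Cmod_ge_0 | apply: opnorm_bnd].
Qed.

Lemma bo_op_comp T S : bounded_op T -> bounded_op S -> bounded_op (op_comp T S).
Proof.
move=> hT hS; apply: (@bnd_bounded _ (opnorm T * opnorm S)).
- by move=> x y; rewrite /op_comp (bo_plus hS) (bo_plus hT).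
- by move=> a x; rewrite /op_comp (bo_cscal hS) (bo_cscal hT).
- move=> x; rewrite /op_comp; apply: Rle_trans (opnorm_bnd hT _) _.
  rewrite Rmult_assoc; apply: Rmult_le_compat_l; [exact: opnorm_pos | exact: opnorm_bnd].
Qed.

Lemma op_minus_plus T S : op_minus T S = op_plus T (op_scal (RtoC (-1)) S).
Proof. by apply: op_ext => x; rewrite /op_minus /op_plus /op_scal; cvec. Qed.

Lemma bo_op_minus T S : bounded_op T -> bounded_op S -> bounded_op (op_minus T S).
Proof. by move=> hT hS; rewrite op_minus_plus; apply: bo_op_plus => //; apply: bo_op_scal. Qed.

Lemma opnorm_plus T S : bounded_op T -> bounded_op S ->
  opnorm (op_plus T S) <= opnorm T + opnorm S.
Proof.
move=> hT hS; apply: opnorm_le.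
  by have := opnorm_pos hT; have := opnorm_pos hS; lra.
move=> x; rewrite /op_plus; apply: Rle_trans (norm_triangle _ _) _.
by rewrite Rmult_plus_distr_r; apply: Rplus_le_compat; apply: opnorm_bnd.
Qed.

Lemma opnorm_scal c T : bounded_op T -> opnorm (op_scal c T) <= Cmod c * opnorm T.
Proof.
move=> hT; apply: opnorm_le.
  by apply: Rmult_le_pos; [apply: Cmod_ge_0 | apply: opnorm_pos].
move=> x; rewrite /op_scal norm_cscal Rmult_assoc.
by apply: Rmult_le_compat_l; [apply: Cmod_ge_0 | apply: opnorm_bnd].
Qed.

Lemma opnorm_comp T S : bounded_op T -> bounded_op S ->
  opnorm (op_comp T S) <= opnorm T * opnorm S.
Proof.
move=> hT hS; apply: opnorm_le.
  by apply: Rmult_le_pos; apply: opnorm_pos.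
move=> x; rewrite /op_comp; apply: Rle_trans (opnorm_bnd hT _) _.
rewrite Rmult_assoc; apply: Rmult_le_compat_l; [exact: opnorm_pos | exact: opnorm_bnd].
Qed.

Lemma opnorm_zero : opnorm (@op_zero H) = 0.
Proof.
apply: Rle_antisym; last by apply: opnorm_pos; apply: bo_op_zero.
by apply: opnorm_le; [lra | move=> x; rewrite /op_zero norm_zero; lra].
Qed.

Lemma opnorm_small_eq T S : bounded_op T -> bounded_op S ->
  (forall eps, 0 < eps -> opnorm (op_minus T S) <= eps) -> T = S.
Proof.
move=> hT hS h; apply: op_ext => x; apply: norm_small_eq => eps e0.
have nx := norm_pos x.
have := opnorm_bnd (bo_op_minus hT hS) x; rewrite {1}/op_minus => h'.
apply: Rle_trans h' _.
apply: Rle_trans (_ : eps / (norm x + 1) * norm x <= _).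
  apply: Rmult_le_compat_r => //; apply: h; apply: Rdiv_lt_0_compat; lra.
apply: (Rmult_le_reg_r (norm x + 1)); first lra.
by rewrite /Rdiv; field_simplify; nra.
Qed.

Lemma op_zero_plus_r T : op_plus T (@op_zero H) = T.
Proof. by apply: op_ext => x; rewrite /op_plus /op_zero plus_zero_r. Qed.

End Operators.

(** * Self-adjoint operators, positive square roots and the absolute value of D *)

Section SelfAdjoint.
Context {H : Hilbert}.
Implicit Types (P Q D : pop H) (T S K : op H) (x y z : H).

(** A ball of a normed module contains the norm ball of the same radius, but lies only in the one
    enlarged by [norm_factor]; the radius is divided by this factor when returning to norms. *)
Lemma cauchy_complete (u : nat -> H) :
  (forall eps, 0 < eps -> exists N, forall n m, (N <= n)%nat -> (N <= m)%nat ->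
     norm (minus (u n) (u m)) <= eps) ->
  exists l, forall eps, 0 < eps -> exists N, forall n, (N <= n)%nat ->
     norm (minus (u n) l) <= eps.
Proof.
move=> Hc.
have [l hl] : exists l, filterlim u eventually (locally l).
  apply/(filterlim_locally_cauchy (F := eventually)) => eps.
  have [N hN] := Hc (eps / 2) ltac:(have := cond_pos eps; lra).
  exists (fun n => (N <= n)%nat); split; first by exists N.
  move=> n m hn hm; apply: norm_compat1.
  apply: Rle_lt_trans (hN m n hm hn) _; have := cond_pos eps; lra.
exists l => eps e0.
have f0 := @norm_factor_gt_0 _ H.
have e1 : 0 < eps / norm_factor (V := H) by apply: Rdiv_lt_0_compat.
have [N hN] := proj1 (filterlim_locally u l) hl (mkposreal _ e1).
exists N => n /hN /norm_compat2 /=.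
have -> : norm_factor (V := H) * (eps / norm_factor (V := H)) = eps by field; lra.
exact: Rlt_le.
Qed.

Lemma sa_linear P : selfadjoint P -> pop_linear P.
Proof. by case. Qed.

Lemma sa_cscal P : selfadjoint P -> forall c x, dom P x ->
  dom P (cscal c x) /\ P (cscal c x) = cscal c (P x).
Proof. by case=> [[_ [_ h]] _]. Qed.

Lemma sa_plus P : selfadjoint P -> forall x y, dom P x -> dom P y ->
  dom P (plus x y) /\ P (plus x y) = plus (P x) (P y).
Proof. by case=> [[_ [h _]] _]. Qed.

Lemma sa_zero P : selfadjoint P -> dom P zero /\ P zero = zero.
Proof.
move=> sa; have d0 : dom P zero by case: (sa_linear sa).
split=> //; have [_] := sa_cscal sa (RtoC 0) d0.
have z w : cscal (RtoC 0) w = zero :> H by cvec.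
by rewrite !z.
Qed.

Lemma sa_minus P : selfadjoint P -> forall x y, dom P x -> dom P y ->
  dom P (minus x y) /\ P (minus x y) = minus (P x) (P y).
Proof.
move=> sa x y hx hy.
have [a b] := sa_cscal sa (RtoC (-1)) hy.
have [c d] := sa_plus sa hx a.
have E w w' : minus w w' = plus w (cscal (RtoC (-1)) w') :> H by cvec.
by rewrite !E d b.
Qed.

Lemma sa_sym P : selfadjoint P -> forall x y, dom P x -> dom P y ->
  rin (P x) y = rin x (P y).
Proof.
case=> _ [_ h] x y hx hy; rewrite /rin.
by have [_ h'] := h y (P y); rewrite (h' (conj hy eq_refl)).
Qed.

(** The domain is stable under multiplication by i, so the hypothesis at x and at i x recovers the
    complex relation that defines the adjoint. *)
Lemma sa_crit P : selfadjoint P -> forall y z,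
  (forall x, dom P x -> rin (P x) y = rin x z) -> dom P y /\ P y = z.
Proof.
move=> sa y z h; case: (sa) => _ [_ h']; apply/h' => x hx.
rewrite !inner_rin (h x hx); f_equal.
have [a b] := sa_cscal sa Ci hx.
by rewrite -b (h _ a).
Qed.

(** A self-adjoint operator is an adjoint, hence closed: for w in the domain, the defect [d] of the
    adjoint relation is at most eps times a constant that depends only on w. *)
Lemma sa_closed P : selfadjoint P -> forall y z,
  (forall eps, 0 < eps -> exists x, dom P x /\ norm (minus x y) <= eps /\
     norm (minus (P x) z) <= eps) -> dom P y /\ P y = z.
Proof.
move=> sa y z h; apply: sa_crit => // w hw.
apply: Rminus_diag_uniq.
set d := rin _ _ - _.
have B : forall eps, 0 < eps -> Rabs d <= eps * (norm (P w) + norm w).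
  move=> eps /h [x [hx [h1 h2]]].
  have -> : d = - rin (P w) (minus x y) + rin w (minus (P x) z).
    by rewrite /d; rvec; rewrite (@sa_sym _ sa w x) //; ring.
  apply: Rle_trans (Rabs_triang _ _) _; rewrite Rabs_Ropp.
  have a := cauchy_schwarz (P w) (minus x y).
  have b := cauchy_schwarz w (minus (P x) z).
  have := norm_pos (P w); have := norm_pos w; nra.
have := Rabs_pos d => d0.
have nw : 0 < norm (P w) + norm w + 1 by have := norm_pos (P w); have := norm_pos w; lra.
case: (Req_dec d 0) => // dn.
have d1 : 0 < Rabs d by apply: Rabs_pos_lt.
have e0 : 0 < Rabs d / (norm (P w) + norm w + 1) by apply: Rdiv_lt_0_compat.
have := B _ e0.
have -> : Rabs d / (norm (P w) + norm w + 1) * (norm (P w) + norm w) =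
  Rabs d - Rabs d / (norm (P w) + norm w + 1) by field; lra.
lra.
Qed.

Definition sym_op T := forall x y, rin (T x) y = rin x (T y).
Definition pos_op T := forall x, 0 <= rin (T x) x.
Definition le_one T := forall x, rin (T x) x <= rin x x.

Lemma pos_contraction K : bounded_op K -> sym_op K -> pos_op K -> le_one K ->
  forall x, rin (K x) (K x) <= rin (K x) x.
Proof.
(* [K - K^2 = K (1 - K) K + (1 - K) K (1 - K)] *)
move=> bK sK pK lK y.
have a := lK (K y); have b := pK (minus y (K y)).
move: b; rewrite (bo_minus bK); rvec; rewrite (sK (K y) y) => b.
rewrite (rin_sym (K y) y) in b *; lra.
Qed.

(** The moments [a n] decrease and are nonnegative, hence converge, and the squared distance of two
    iterates is a(2n) - 2 a(n+m) + a(2m). The limit is fixed because K is a contraction. *)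
Lemma iter_power_converges K : bounded_op K -> sym_op K -> pos_op K -> le_one K ->
  forall x, exists y, K y = y /\ forall eps, 0 < eps -> exists N, forall n, (N <= n)%nat ->
    norm (minus (Nat.iter n K x) y) <= eps.
Proof.
move=> bK sK pK lK x.
have cK := pos_contraction bK sK pK lK.
pose a n := rin (Nat.iter n K x) x.
have Ha n m : rin (Nat.iter n K x) (Nat.iter m K x) = a (n + m)%nat.
  elim: m n => [|m IH] n /=; first by rewrite -plus_n_O.
  by rewrite -sK -[K (Nat.iter n K x)]/(Nat.iter (S n) K x) IH -plus_n_Sm.
(* Even moments are squared norms and odd ones are values of the form of K, so each step down uses K
   <= 1 or K^2 <= K according to parity. *)
have even m : exists n, (m = n + n \/ m = n + S n)%nat.
  elim: m => [|m [n [IH|IH]]]; first by exists 0%nat; lia.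
    by exists n; lia.
  by exists (S n); lia.
have dec n : a (S n) <= a n.
  have [m [E|E]] := even n.
    have := lK (Nat.iter m K x).
    by rewrite -[K (Nat.iter m K x)]/(Nat.iter (S m) K x) !Ha E.
  have := cK (Nat.iter m K x).
  have e1 : (S m + S m = S n)%nat by lia.
  have e2 : (S m + m = n)%nat by lia.
  by rewrite -[K (Nat.iter m K x)]/(Nat.iter (S m) K x) !Ha e1 e2.
have pos n : 0 <= a n.
  have [m [E|E]] := even n.
    by rewrite E -Ha rin_self; have := norm_pos (Nat.iter m K x); nra.
  rewrite E -Ha rin_sym; exact: pK.
have [l hl] : ex_finite_lim_seq a by apply: (ex_finite_lim_seq_decr _ 0).
have hl' := proj2 (is_lim_seq_spec _ _) hl.
have [y hy] : exists y, forall eps, 0 < eps -> exists N, forall n, (N <= n)%nat ->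
    norm (minus (Nat.iter n K x) y) <= eps.
  apply: cauchy_complete => eps e0.
  have e1 : 0 < eps * eps / 4 by nra.
  have [N hN] := hl' (mkposreal _ e1); exists N => n m hn hm.
  have E : rin (minus (Nat.iter n K x) (Nat.iter m K x))
               (minus (Nat.iter n K x) (Nat.iter m K x)) = a (n + n)%nat - 2 * a (n + m)%nat + a (m + m)%nat.
    by rvec; rewrite !Ha (Nat.add_comm m n); ring.
  have /= h1 := hN (n + n)%nat ltac:(lia).
  have /= h2 := hN (n + m)%nat ltac:(lia).
  have /= h3 := hN (m + m)%nat ltac:(lia).
  rewrite rin_self in E.
  have := norm_pos (minus (Nat.iter n K x) (Nat.iter m K x)).
  move: h1 h2 h3 => /Rabs_def2 h1 /Rabs_def2 h2 /Rabs_def2 h3 h0.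
  nra.
exists y; split=> //.
apply: norm_small_eq => eps e0.
have [N hN] := hy (eps / 2) ltac:(lra).
have h1 := hN N ltac:(lia); have h2 := hN (S N) ltac:(lia).
apply: Rle_trans (norm_minus_trans _ (Nat.iter (S N) K x) _) _.
have : norm (minus (K y) (Nat.iter (S N) K x)) <= norm (minus y (Nat.iter N K x)).
  rewrite /= -(bo_minus bK); apply: norm_sq_le.
  by apply: Rle_trans (cK _) (lK _).
rewrite (norm_minus_sym y); lra.
Qed.

Definition one_plus T : op H := fun x => plus x (T x).
Definition one_minus T : op H := fun x => minus x (T x).

(** Each factor 1 + T adds at least twice the current (T w, w) to the squared norm, and (T w, w)
    never decreases along the iteration; the growth is at least linear unless (T y, y) <= 0. *)
Lemma iter_grow T : bounded_op T -> sym_op T -> pos_op T -> forall y M,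
  (forall n, norm (Nat.iter n (one_plus T) y) <= M) -> rin (T y) y <= 0.
Proof.
move=> bT sT pT y M hM.
have step x : rin (T (plus x (T x))) (plus x (T x)) =
    rin (T x) x + 2 * rin (T x) (T x) + rin (T (T x)) (T x).
  rewrite (bo_plus bT); rvec; rewrite (sT (T x) x); ring.
have sq x : 0 <= rin x x by rewrite rin_self; have := norm_pos x; nra.
have G n : rin y y + 2 * INR n * rin (T y) y <=
      rin (Nat.iter n (one_plus T) y) (Nat.iter n (one_plus T) y) /\
    rin (T y) y <= rin (T (Nat.iter n (one_plus T) y)) (Nat.iter n (one_plus T) y).
  elim: n => [|n [IH1 IH2]]; first by rewrite /=; lra.
  rewrite S_INR; move: IH1 IH2.
  rewrite [Nat.iter (S n) _ _]/=.
  set w := Nat.iter n _ y => IH1 IH2; split.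
    rewrite /one_plus; rvec; rewrite (rin_sym w (T w)); have := sq (T w); lra.
  rewrite /one_plus step; have := sq (T w); have := pT (T w); lra.
case: (Rle_lt_dec (rin (T y) y) 0) => // p.
have [n hn] := INR_archimed (rin (T y) y) (M * M) p.
have [h _] := G n; have := hM n; have := sq y.
move: h; rewrite (rin_self (Nat.iter _ _ _)); set w := norm (Nat.iter _ _ _) => h q m.
have := norm_pos (Nat.iter n (one_plus T) y); rewrite -/w => w0.
have : w * w <= M * M by nra.
have := pos_INR n; nra.
Qed.

(* With [X = S - T], [S X = - X T] gives [(1 + T)^n X = X (1 - S)^n], which is bounded
   in [n], whereas [(1 + T)^n y] grows unless [T y] is orthogonal to [y]. *)
Lemma sqrt_diff_kernel S T : bounded_op S -> bounded_op T -> sym_op S -> sym_op T ->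
  pos_op S -> pos_op T -> le_one S -> (forall x, S (S x) = T (T x)) ->
  forall x, T (minus (S x) (T x)) = zero.
Proof.
move=> bS bT sS sT pS pT lS E.
have [X XE] : exists X : op H, forall x, X x = minus (S x) (T x) by exists (op_minus S T).
have sq x : 0 <= rin x x by rewrite rin_self; have := norm_pos x; nra.
have cS := pos_contraction bS sS pS lS.
have TX x : T (X x) = opp (X (S x)).
  by rewrite !XE (bo_minus bT) E; cvec.
have Xm x y : X (minus x y) = minus (X x) (X y).
  by rewrite !XE (bo_minus bT) (bo_minus bS); cvec.
have shift x : plus (X x) (T (X x)) = X (minus x (S x)).
  by rewrite TX Xm; cvec.
have I n x : Nat.iter n (one_plus T) (X x) = X (Nat.iter n (one_minus S) x).
  by elim: n => //= n ->; exact: shift.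
have nI n x : norm (Nat.iter n (one_minus S) x) <= norm x.
  elim: n => [|n IH] /=; first lra.
  apply: Rle_trans IH; set w := Nat.iter n _ x.
  apply: norm_sq_le; rewrite /one_minus; rvec; rewrite (rin_sym w (S w)).
  have := cS w; have := pS w; lra.
have Z x : rin (T (X x)) (X x) = 0.
  apply: Rle_antisym; last exact: pT.
  apply: (iter_grow bT sT pT (M := (opnorm S + opnorm T) * norm x)) => n.
  rewrite I; set w := Nat.iter n _ x; rewrite XE.
  apply: Rle_trans (norm_le_minus _ _) _.
  have a := opnorm_bnd bS w; have b := opnorm_bnd bT w.
  have := nI n x; rewrite -/w => c.
  have := opnorm_pos bS; have := opnorm_pos bT; nra.
move=> x; apply: norm_eq_zero.
(* X sends (1 - S) x to (1 + T) X x. As the form of T vanishes on the range of X, expanding it at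
   this vector leaves 2 |T X x|^2 plus a nonnegative term. *)
have := Z (minus x (S x)); rewrite -shift (bo_plus bT); rvec.
rewrite (sT (T (X x)) (X x)) Z.
have := pT (T (X x)); rewrite -XE rin_self.
have := norm_pos (T (X x)); nra.
Qed.

(** The kernel lemma, used once in each order, shows that S and T both kill w = (S - T) x; then
    |w|^2 = (x, S w - T w) = 0. *)
Lemma pos_sqrt_unique S T : bounded_op S -> bounded_op T -> sym_op S -> sym_op T ->
  pos_op S -> pos_op T -> le_one S -> le_one T -> (forall x, S (S x) = T (T x)) ->
  forall x, S x = T x.
Proof.
move=> bS bT sS sT pS pT lS lT E x.
have a := sqrt_diff_kernel bS bT sS sT pS pT lS E.
have b := sqrt_diff_kernel bT bS sT sS pT pS lT (fun x => eq_sym (E x)).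
apply: norm_zero_eq.
have Z : rin (minus (S x) (T x)) (minus (S x) (T x)) = 0.
  set w := minus (S x) (T x).
  have -> : rin w w = rin x (S w) - rin x (T w).
    by rewrite -(sS x w) -(sT x w) /w; rvec; ring.
  have Sw : S w = zero.
    have -> : w = opp (minus (T x) (S x)) by rewrite /w; cvec.
    by rewrite (bo_opp bS) b; cvec.
  by rewrite Sw /w a; rvec; ring.
move: Z; rewrite rin_self; have := norm_pos (minus (S x) (T x)); nra.
Qed.

Definition commutes (u : op H) P := forall x, dom P x -> dom P (u x) /\ P (u x) = u (P x).

Section SquareRoot.
Variables (D P : pop H) (J : op H).
Hypotheses (HP : is_abs D P) (HJ : is_inv_sqrt D J).

Let R0 : op H := fun x => J (J x).

Let saP : selfadjoint P. Proof. by case: HP. Qed.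

Let posP x : dom P x -> 0 <= rin (P x) x.
Proof. by case: HP => _ [h _] /h []. Qed.

(** The squares of [P] and [D] agree together with their domains, so [R0], the inverse of 1 + D^2,
    also inverts 1 + P^2. *)
Let domR x : dom P (R0 x) /\ dom P (P (R0 x)) /\ plus (R0 x) (P (P (R0 x))) = x.
Proof.
case: HP => _ [_ [d e]]; case: HJ => _ [_ [h _]].
have [h1 h2] := h x; have /= h3 := proj2 (d _) h1; have /= h4 := e _ h3.
by case: h3 => a b; rewrite /R0 h4.
Qed.

Let bR : bounded_op R0.
Proof. by case: HJ => bJ _; exact: (bo_op_comp bJ bJ). Qed.

Let sq x : 0 <= rin x x. Proof. by rewrite rin_self; have := norm_pos x; nra. Qed.

(** Pairs x = R0 x + P^2 R0 x with R0 x. Positivity of [R0] and the bound 1 for P R0 rest on this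
    identity. *)
Let energy x : rin x (R0 x) = rin (R0 x) (R0 x) + rin (P (R0 x)) (P (R0 x)).
Proof.
have [a [b c]] := domR x.
rewrite -{1}c; rvec; rewrite (@sa_sym _ saP (P (R0 x)) (R0 x)) //.
Qed.

Let symR : sym_op R0.
Proof.
move=> x y; have [a [b c]] := domR x; have [a' [b' c']] := domR y.
rewrite -{1}c' -{2}c; rvec.
by rewrite (@sa_sym _ saP (P (R0 x)) (R0 y)) // -(@sa_sym _ saP (R0 x)) //.
Qed.

Let posR : pos_op R0.
Proof. by move=> x; rewrite rin_sym energy; have := sq (R0 x); have := sq (P (R0 x)); lra. Qed.

Let leR : le_one R0.
Proof.
move=> x; have [a [b c]] := domR x.
have : 0 <= rin (P (P (R0 x))) x.
  rewrite -{2}c; rvec; rewrite (@sa_sym _ saP (P (R0 x)) (R0 x)) //.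
  by have := sq (P (R0 x)); have := sq (P (P (R0 x))); lra.
have : rin x x = rin (R0 x) x + rin (P (P (R0 x))) x by rewrite -rin_plus_l c.
lra.
Qed.

Let PR x : dom P x -> P (R0 x) = R0 (P x).
Proof.
move=> dx; apply: rin_ext => y.
have [a [b c]] := domR x; have [a' [b' c']] := domR y.
rewrite symR (@sa_sym _ saP x (R0 y)) // -{1}c'; rvec.
rewrite -(@sa_sym _ saP _ (P (R0 y))) // -[in RHS]c; rvec.
rewrite (@sa_sym _ saP (R0 x) (R0 y)) //.
Qed.

Let S0 : op H := fun x => P (R0 x).

Let bS : bounded_op S0.
Proof.
apply: (@bnd_bounded _ _ 1).
- move=> x y; rewrite /S0 (bo_plus bR); apply (sa_plus saP); apply domR.
- move=> c x; rewrite /S0 (bo_cscal bR); apply (sa_cscal saP); apply domR.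
- move=> x; rewrite Rmult_1_l; apply: norm_sq_le.
  have := energy x; have := leR x; rewrite (rin_sym x) /S0.
  have := sq (R0 x); lra.
Qed.

Let symS : sym_op S0.
Proof.
move=> x y; rewrite /S0; have [a [b c]] := domR x; have [a' [b' c']] := domR y.
rewrite -{1}c' -{2}c; rvec.
rewrite (@sa_sym _ saP (R0 x) (R0 y)) // (@sa_sym _ saP (P (R0 x)) (P (R0 y))) //.
Qed.

Let posS : pos_op S0.
Proof.
move=> x; rewrite /S0; have [a [b c]] := domR x.
rewrite -{2}c; rvec.
have := posP a; have := posP b; rewrite (rin_sym (P (P _))); lra.
Qed.

Let S2 x : S0 (S0 x) = minus (R0 x) (R0 (R0 x)).
Proof.
rewrite /S0; have [a _] := domR x; have [_ [_ c]] := domR (R0 x).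
rewrite -PR //; move: c; set z := R0 x; set w := P (P (R0 z)) => c.
by rewrite -{1}c; cvec.
Qed.

Let leS : le_one S0.
Proof.
move=> x.
have N : norm (S0 x) <= norm x by apply: norm_sq_le; have := energy x; have := leR x;
  rewrite (rin_sym x) /S0; have := sq (R0 x); lra.
have := cauchy_schwarz (S0 x) x; rewrite rin_self.
have := Rle_abs (rin (S0 x) x); have := norm_pos x; nra.
Qed.

(* [S0 = P R0] is the positive square root of [R0 - R0^2], so it commutes with [u]; this
   gives the claim on dom D^2 = ran R0, which is a core for P because
   [x - (1 - R0)^n x] lies in ran R0 and converges to [x]. *)
Lemma abs_commutes (u v : op H) : bounded_op u -> bounded_op v ->
  (forall x y, rin (u x) (u y) = rin x y) -> (forall x, u (v x) = x) -> (forall x, v (u x) = x) ->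
  commutes u D -> commutes u P.
Proof.
move=> bu bv iu uv vu uD.
have vin x y : rin (v x) y = rin x (u y) by rewrite -iu uv.
(* [u (R0 x)] solves the equation (1 + D^2) z = u x, whose only solution is [R0 (u x)]. *)
have uR x : u (R0 x) = R0 (u x).
  case: (HJ) => _ [_ [h1 h2]].
  have [/= [a b] c] := h1 x; have [a' e1] := uD _ a; have [b' e2] := uD _ b.
  have /= := h2 (u (R0 x)); rewrite /R0 e1 => <-; last by split=> //; rewrite e1.
  by rewrite e2 -(bo_plus bu) c.
(* Conjugation by u fixes R0 - R0^2, so both sides are positive square roots of the same
   operator. *)
have key x : S0 x = v (S0 (u x)).
  apply: (@pos_sqrt_unique S0 (fun x => v (S0 (u x)))) => //.
  - exact: (bo_op_comp bv (bo_op_comp bS bu)).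
  - by move=> a b; rewrite vin symS rin_sym -vin rin_sym.
  - by move=> a; rewrite vin.
  - by move=> a; rewrite vin -(iu a a).
  - move=> a; rewrite uv !S2 -!uR -(bo_minus bu) vu //.
have uS x : u (S0 x) = S0 (u x) by rewrite key uv.
have coreP x : dom P (R0 x) /\ dom P (u (R0 x)) /\ P (u (R0 x)) = u (P (R0 x)).
  have [a _] := domR x; have [b _] := domR (u x).
  by rewrite uR; split=> //; split=> //; rewrite -/(S0 (u x)) -uS.
pose K : op H := one_minus R0.
have Kp x y : K (plus x y) = plus (K x) (K y) by rewrite /K /one_minus (bo_plus bR); cvec.
have bK : bounded_op K.
  apply: (@bnd_bounded _ _ (1 + opnorm R0)) => //.
    by move=> c x; rewrite /K /one_minus (bo_cscal bR); cvec.
  move=> x; rewrite Rmult_plus_distr_r Rmult_1_l; apply: Rle_trans (norm_le_minus _ _) _.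
  by apply: Rplus_le_compat_l; apply: opnorm_bnd.
have sK : sym_op K by move=> a b; rewrite /K; rvec; rewrite symR.
have pK : pos_op K by move=> a; rewrite /K; rvec; have := leR a; lra.
have lK : le_one K by move=> a; rewrite /K; rvec; have := posR a; lra.
have lim x : forall eps, 0 < eps -> exists N, forall n, (N <= n)%nat -> norm (Nat.iter n K x) <= eps.
  have [y [Ky hy]] := iter_power_converges bK sK pK lK x.
  (* A vector fixed by 1 - R0 is killed by R0, which is injective. *)
  have y0 : y = zero.
    have Ry : R0 y = zero.
      have -> : R0 y = minus y (K y) by rewrite /K; cvec.
      by rewrite Ky; cvec.
    have [_ [_ <-]] := domR y; rewrite Ry.
    have [_ P0] := sa_zero saP; by rewrite !P0 plus_zero_l.
  move=> eps /hy [N hN]; exists N => n /hN; rewrite y0.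
  by have -> : minus (Nat.iter n K x) zero = Nat.iter n K x by cvec.
have ranK n x : exists w, Nat.iter n K x = minus x (R0 w).
  elim: n => [|n [w IH]] /=.
    by exists zero; rewrite (bo_zero bR); cvec.
  exists (plus w (minus x (R0 w))); rewrite IH /K /one_minus (bo_plus bR); cvec.
have PK n x : dom P x -> dom P (Nat.iter n K x) /\ P (Nat.iter n K x) = Nat.iter n K (P x).
  move=> dx; elim: n => //= n [IH1 IH2].
  have [a _] := domR (Nat.iter n K x).
  have [b c] := sa_minus saP IH1 a.
  by split=> //; rewrite c PR // IH2.
have nu0 x : norm (u x) = norm x by apply: norm_sq_eq.
move=> x dx; apply: sa_closed => // eps e0.
have [N1 h1] := lim x eps e0; have [N2 h2] := lim (P x) eps e0.
have [w hw] := ranK (N1 + N2)%nat x.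
have h1' := h1 (N1 + N2)%nat ltac:(lia); have h2' := h2 (N1 + N2)%nat ltac:(lia).
have [d1 [d2 e]] := coreP w.
exists (u (R0 w)); split=> //; rewrite e -!(bo_minus bu) !nu0; split.
  by rewrite norm_minus_sym -hw.
have [c1 c2] := PK (N1 + N2)%nat x dx; have [_ c3] := sa_minus saP dx d1.
by rewrite norm_minus_sym -c3 -hw c2.
Qed.

End SquareRoot.
End SelfAdjoint.

(** * Riemann integrals of vector-valued functions *)

Lemma is_RInt_linear_map (V W : NormedModule R_AbsRing) (phi : V -> W) :
  (forall x y, phi (plus x y) = plus (phi x) (phi y)) ->
  (forall (r : R) x, phi (scal r x) = scal r (phi x)) ->
  (forall x, continuous phi x) ->
  forall (f : R -> V) a b l, is_RInt f a b l -> is_RInt (fun t => phi (f t)) a b (phi l).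
Proof.
move=> hp hs hc f a b l h.
have hz : phi zero = zero.
  by rewrite -(scal_zero_l (zero : V)) hs [LHS]scal_zero_l.
have E ptd : Riemann_sum (fun t => phi (f t)) ptd = phi (Riemann_sum f ptd).
  move: ptd; apply: SF_cons_ind => [x0|h0 s IH].
    by rewrite /Riemann_sum /= hz.
  by rewrite !Riemann_sum_cons hp hs IH.
have E' : forall ptd, phi (scal (sign (b - a)) (Riemann_sum f ptd)) =
    scal (sign (b - a)) (Riemann_sum (fun t => phi (f t)) ptd).
  by move=> ptd; rewrite hs E.
apply: (filterlim_ext _ _ E').
exact: filterlim_comp h (hc l).
Qed.

Section VectorIntegrals.
Context {H : Hilbert}.
Implicit Types (f g : R -> H) (T : op H) (x y z : H).

Definition ct f : Prop := forall t, continuous f t.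

Lemma continuous_eps f t : continuous f t <->
  forall eps, 0 < eps -> exists delta, 0 < delta /\
    forall s, Rabs (s - t) < delta -> norm (minus (f s) (f t)) <= eps.
Proof.
have f0 := @norm_factor_gt_0 _ H.
split=> h.
  move=> eps e0.
  have e1 : 0 < eps / norm_factor (V := H) by apply: Rdiv_lt_0_compat.
  have [d hd] := proj1 (filterlim_locally f (f t)) h (mkposreal _ e1).
  exists d; split; first exact: cond_pos.
  move=> s hs; have := norm_compat2 _ _ _ (hd s hs) => /=.
  have -> : norm_factor (V := H) * (eps / norm_factor (V := H)) = eps by field; lra.
  exact: Rlt_le.
apply/filterlim_locally => eps.
have [d [d0 hd]] := h (eps / 2) ltac:(have := cond_pos eps; lra).
exists (mkposreal d d0) => s hs; apply: norm_compat1.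
apply: Rle_lt_trans (hd s hs) _; have := cond_pos eps; lra.
Qed.

Lemma ct_ex_RInt f a b : ct f -> ex_RInt f a b.
Proof. by move=> h; apply: ex_RInt_continuous => z _; exact: h. Qed.

Lemma ct_is_RInt f a b : ct f -> is_RInt f a b (RInt f a b).
Proof. by move=> h; apply: RInt_correct; exact: ct_ex_RInt. Qed.

Lemma bo_continuous T : bounded_op T -> forall x, continuous (T : H -> H) x.
Proof.
move=> bT x; apply/filterlim_locally => eps.
have f0 := @norm_factor_gt_0 _ H.
have [M [M0 hM]] := bounded_bnd bT.
have e0 := cond_pos eps.
have d0 : 0 < eps / ((M + 1) * norm_factor (V := H)).
  apply: Rdiv_lt_0_compat => //; apply: Rmult_lt_0_compat; lra.
exists (mkposreal _ d0) => y /norm_compat2 /= hy; apply: norm_compat1.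
rewrite -(bo_minus bT); apply: Rle_lt_trans (hM _) _.
have hy' : norm (minus y x) < eps / (M + 1).
  apply: Rlt_le_trans hy _; right; field; lra.
have e1 : eps / (M + 1) * (M + 1) = eps by field; lra.
have n0 := norm_pos (minus y x).
apply: Rle_lt_trans (_ : (M + 1) * norm (minus y x) < _); last first.
  rewrite -e1 Rmult_comm; apply: Rmult_lt_compat_r; [lra | exact: hy'].
apply: Rmult_le_compat_r; [exact: n0 | lra].
Qed.

Lemma ct_bo T f : bounded_op T -> ct f -> ct (fun t => T (f t)).
Proof. by move=> bT hf t; apply: continuous_comp; [exact: hf | exact: bo_continuous]. Qed.

Lemma ct_plus f g : ct f -> ct g -> ct (fun t => plus (f t) (g t)).
Proof. by move=> hf hg t; exact: (continuous_plus f g t (hf t) (hg t)). Qed.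

Lemma bo_id : bounded_op (fun x : H => x).
Proof. by apply: (@bnd_bounded _ _ 1) => // x; lra. Qed.

Lemma bo_cscal_op c : bounded_op (fun x : H => cscal c x).
Proof. exact: (bo_op_scal c bo_id). Qed.

Lemma RInt_bo T f a b : bounded_op T -> ct f -> RInt (fun t => T (f t)) a b = T (RInt f a b).
Proof.
move=> bT hf; apply: is_RInt_unique.
apply: (@is_RInt_linear_map H H T); [exact: bo_plus | exact: bo_scal | exact: bo_continuous |].
exact: ct_is_RInt.
Qed.

Lemma RInt_plus_ct f g a b : ct f -> ct g ->
  RInt (fun t => plus (f t) (g t)) a b = plus (RInt f a b) (RInt g a b).
Proof. by move=> hf hg; apply: RInt_plus; exact: ct_ex_RInt. Qed.

Lemma rin_continuous z x : continuous (fun y : H => rin z y : R) x.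
Proof.
apply/filterlim_locally => eps.
have f0 := @norm_factor_gt_0 _ H.
have n0 := norm_pos z.
have d0 : 0 < eps / ((norm z + 1) * norm_factor (V := H)).
  apply: Rdiv_lt_0_compat; [exact: cond_pos | apply: Rmult_lt_0_compat; lra].
exists (mkposreal _ d0) => y /norm_compat2 /= hy.
have hy' : norm (minus y x) < eps / (norm z + 1).
  apply: Rlt_le_trans hy _; right; field; lra.
have e1 : eps / (norm z + 1) * (norm z + 1) = eps by field; lra.
change (Rabs (rin z y - rin z x) < eps).
rewrite -rin_minus_r; apply: Rle_lt_trans (cauchy_schwarz _ _) _.
apply: Rle_lt_trans (_ : norm (minus y x) * (norm z + 1) < _); last first.
  rewrite -e1; apply: Rmult_lt_compat_r; [lra | exact: hy'].
rewrite Rmult_comm; apply: Rmult_le_compat_l; [exact: norm_pos | lra].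
Qed.

Lemma rin_RInt z f a b : ct f -> is_RInt (fun t => rin z (f t)) a b (rin z (RInt f a b)).
Proof.
move=> hf; apply: (@is_RInt_linear_map H R_NormedModule (fun y => rin z y)).
- by move=> x y; rewrite rin_plus_r.
- by move=> r x; rewrite rin_scal_r.
- exact: rin_continuous.
- exact: ct_is_RInt.
Qed.

Lemma rin_RInt_eq z w f g a b : ct f -> ct g -> (forall t, rin z (f t) = rin w (g t)) ->
  rin z (RInt f a b) = rin w (RInt g a b).
Proof.
move=> hf hg E; have h1 := @rin_RInt z _ a b hf; have h2 := @rin_RInt w _ a b hg.
rewrite -(is_RInt_unique _ _ _ _ h1) -(is_RInt_unique _ _ _ _ h2).
by apply: RInt_ext => t _.
Qed.

Lemma RInt_norm_le f a b M : a <= b -> ct f -> (forall t, a <= t <= b -> norm (f t) <= M) ->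
  norm (RInt f a b) <= (b - a) * M.
Proof. by move=> ab hf h; apply: norm_RInt_le_const ab h _; exact: ct_is_RInt. Qed.

(** The window [s, 1 + s] is cut at 1, and the piece beyond 1 is moved back by one period. *)
Lemma RInt_shift f s : ct f -> (forall t, f (t + 1) = f t) ->
  RInt (fun t => f (t + s)) 0 1 = RInt f 0 1.
Proof.
move=> hf per.
have sh a b u : RInt (fun t => f (t + u)) a b = RInt f (a + u) (b + u).
  have := RInt_comp_lin f 1 u a b.
  rewrite !Rmult_1_l => <-; last exact: ct_ex_RInt.
  by apply: RInt_ext => t _; rewrite scal_one Rmult_1_l.
rewrite sh Rplus_0_l.
rewrite -(RInt_Chasles f s 1 (1 + s)); try exact: ct_ex_RInt.
rewrite -(RInt_Chasles f 0 s 1); try exact: ct_ex_RInt.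
have := sh 0 s 1; rewrite Rplus_0_l (Rplus_comm s 1) => <-.
rewrite plus_comm; congr plus; apply: RInt_ext => t _; exact: per.
Qed.

Lemma continuous_cscal_fun (c : R -> C) f t :
  continuous (fun t => Re (c t) : R) t -> continuous (fun t => Im (c t) : R) t -> continuous f t ->
  continuous (fun t => cscal (c t) (f t)) t.
Proof.
move=> h1 h2 hf.
apply: (continuous_ext (fun t => plus (scal (Re (c t)) (f t)) (scal (Im (c t)) (cscal Ci (f t))))).
  move=> u; apply: inner_ext => w; rewrite !(inner_plus_l, inner_scal_l, inner_cscal_l).
  by apply: injective_projections => /=; rewrite /Re /Im; ring.
apply: (continuous_plus (fun t => scal (Re (c t)) (f t)) (fun t => scal (Im (c t)) (cscal Ci (f t)))).
  exact: (continuous_scal (fun t => Re (c t) : R_AbsRing) f).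
apply: (continuous_scal (fun t => Im (c t) : R_AbsRing) (fun t => cscal Ci (f t))) => //.
apply: (continuous_comp f (fun x => cscal Ci x)) => //.
exact: (bo_continuous (bo_cscal_op Ci)).
Qed.

Lemma ct_cis (m a : R) f : ct f -> ct (fun t => cscal (cis (m * t + a)) (f t)).
Proof.
move=> hf t; have l : continuous (fun t : R => m * t + a) t.
  apply: (continuous_plus (fun t : R => m * t) (fun _ => a)); last exact: continuous_const.
  apply: (continuous_mult (fun _ : R => m) (fun t => t)); [exact: continuous_const | exact: continuous_id].
by apply: continuous_cscal_fun => //=; [exact: continuous_cos_comp | exact: continuous_sin_comp].
Qed.

(** * Fourier coefficients *)

Definition fchar (m : Z) (t : R) : C := cis (- (2 * PI * (IZR m * t))).

Definition fcoef (m : Z) f : H := RInt (fun t => cscal (fchar m t) (f t)) 0 1.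

Lemma ct_fchar m f : ct f -> ct (fun t => cscal (fchar m t) (f t)).
Proof.
move=> hf; have E t : cscal (fchar m t) (f t) = cscal (cis (- (2 * PI * IZR m) * t + 0)) (f t).
  by rewrite /fchar; do 2 f_equal; ring.
by move=> t; apply: continuous_ext (fun t => eq_sym (E t)) _; exact: ct_cis.
Qed.

Arguments ct_fchar m [f] _ t.

Lemma fchar_plus m n t : fchar (m + n) t = Cmult (fchar m t) (fchar n t).
Proof. by rewrite /fchar -cis_plus plus_IZR; f_equal; ring. Qed.

Lemma fchar_shift m s t : fchar m (t + s) = Cmult (fchar m t) (fchar m s).
Proof. by rewrite /fchar -cis_plus; f_equal; ring. Qed.

Lemma fchar_period m t : fchar m (t + 1) = fchar m t.
Proof.
rewrite fchar_shift /fchar (_ : - (2 * PI * (IZR m * 1)) = 2 * PI * IZR (- m)).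
  by rewrite cis_2PI_Z Cmult_1_r.
by rewrite opp_IZR; ring.
Qed.

Lemma Cmod_fchar m t : Cmod (fchar m t) = 1.
Proof. exact: Cmod_cis. Qed.

(* [k t = sin^2 (pi t)]; its powers, normalised, concentrate at [t = 1/2]. *)
Let k (t : R) : R := sin (PI * t) * sin (PI * t).

Let k_fchar t : RtoC (k t) =
  Cmult (RtoC (1 / 4)) (Cminus (Cminus (RtoC 2) (fchar 1 t)) (fchar (-1) t)).
Proof.
rewrite /k /fchar (_ : - (2 * PI * (IZR 1 * t)) = - (2 * (PI * t))); last by rewrite /=; ring.
rewrite (_ : - (2 * PI * (IZR (-1) * t)) = 2 * (PI * t)); last by rewrite /=; ring.
rewrite /cis cos_neg sin_neg cos_2a sin_2a.
have := sin2_cos2 (PI * t); rewrite /Rsqr => E.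
have -> : cos (PI * t) * cos (PI * t) = 1 - sin (PI * t) * sin (PI * t) by lra.
by apply: injective_projections => /=; field.
Qed.

Let k_range t : 0 <= k t <= 1.
Proof. have := sin2_cos2 (PI * t); rewrite /Rsqr /k; nra. Qed.

Let ct_k : forall t, continuous k t.
Proof.
move=> t; have s : continuous (fun t => sin (PI * t)) t.
  apply: continuous_sin_comp.
  apply: (continuous_mult (fun _ : R => PI) (fun t => t)); [exact: continuous_const | exact: continuous_id].
exact: (continuous_mult _ _ t s s).
Qed.

Let ct_kf f : ct f -> ct (fun t => scal (k t) (f t)).
Proof. by move=> hf t; apply: (continuous_scal (fun t => k t : R_AbsRing) f). Qed.

Let ct_kn n : forall t, continuous (fun t => k t ^ n) t.
Proof.
elim: n => [|n IH] t /=; first exact: continuous_const.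
by apply: (continuous_mult k (fun t => k t ^ n)); [exact: ct_k | exact: IH].
Qed.

Let ct_knf n f : ct f -> ct (fun t => scal (k t ^ n) (f t)).
Proof.
by move=> hf t; apply: (continuous_scal (fun t => k t ^ n : R_AbsRing) f) => //; exact: ct_kn.
Qed.

(** By [k_fchar], multiplication by k mixes only three neighbouring Fourier coefficients. The
    induction absorbs one factor k into f at a time and ends at the zeroth coefficient. *)
Let kf_mem (Q : H -> Prop) : (forall x y, Q x -> Q y -> Q (plus x y)) ->
  (forall c x, Q x -> Q (cscal c x)) ->
  forall n f, ct f -> (forall m, Q (fcoef m f)) -> Q (RInt (fun t => scal (k t ^ n) (f t)) 0 1).
Proof.
move=> Qp Qc; elim=> [|n IH] f hf hQ.
  rewrite (_ : RInt _ 0 1 = fcoef 0 f) //; apply: RInt_ext => t _ /=.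
  by rewrite scal_one /fchar Rmult_0_l Rmult_0_r Ropp_0 cis_0 cscal_real scal_one.
rewrite (_ : RInt _ 0 1 = RInt (fun t => scal (k t ^ n) (scal (k t) (f t))) 0 1); last first.
  by apply: RInt_ext => t _ /=; rewrite scal_assoc /mult /= Rmult_comm.
apply: IH; first exact: ct_kf.
move=> m.
have -> : fcoef m (fun t => scal (k t) (f t)) =
    cscal (RtoC (1 / 4)) (plus (cscal (RtoC 2) (fcoef m f))
      (plus (cscal (RtoC (-1)) (fcoef (m + 1) f)) (cscal (RtoC (-1)) (fcoef (m + -1) f)))).
  rewrite /fcoef.
  have c0 j := ct_fchar j hf.
  have c1 j c := ct_bo (bo_cscal_op c) (c0 j).
  rewrite -!(RInt_bo _ _ (bo_cscal_op _)) //.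
  rewrite -!RInt_plus_ct //; last exact: ct_plus.
  rewrite -(RInt_bo _ _ (bo_cscal_op _)); last by apply: ct_plus => //; apply: ct_plus.
  apply: RInt_ext => t _.
  rewrite -cscal_real k_fchar !fchar_plus; cvec.
by apply Qc; apply Qp; [apply Qc | apply Qp; apply Qc].
Qed.

Let I n := RInt (fun t => k t ^ n) 0 1.

Let is_I n : is_RInt (fun t => k t ^ n) 0 1 (I n).
Proof. by apply: RInt_correct; apply: ex_RInt_continuous => z _; exact: ct_kn. Qed.

(** Integrates the derivative of sin^(2n+1)(PI t) cos(PI t) / PI, which vanishes at both ends. *)
Let wallis n : (2 * INR n + 2) * (I n - I (S n)) = I n.
Proof.
pose F t := / PI * (sin (PI * t) ^ (2 * n + 1) * cos (PI * t)).
pose dF t := (2 * INR n + 1) * k t ^ n - (2 * INR n + 2) * k t ^ (S n).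
have kp t j : sin (PI * t) ^ (2 * j) = k t ^ j.
  by rewrite pow_mult /k; f_equal; ring.
have D t : is_derive F t (dF t).
  rewrite /F; auto_derive => //.
  rewrite /dF /=.
  have -> : Init.Nat.pred (n + (n + 0) + 1) = (2 * n)%nat by lia.
  have -> : (n + (n + 0) + 1 = S (2 * n))%nat by lia.
  rewrite -kp S_INR mult_INR /= /k.
  have := sin2_cos2 (PI * t); rewrite /Rsqr => E.
  have PI0 := PI_RGT_0.
  set s := sin (PI * t) in E *; set c := cos (PI * t) in E *.
  have -> : (n + (n + 0) = 2 * n)%nat by lia.
  set q := s ^ (2 * n).
  have cc : c * c = 1 - s * s by lra.
  transitivity ((2 * INR n + 1) * q * (c * c) - s * q * s); first by field; lra.
  rewrite cc; ring.
have h : is_RInt dF 0 1 (minus (F 1) (F 0)).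
  apply: is_RInt_derive => t _; first exact: D.
  apply: (continuous_minus (fun t => (2 * INR n + 1) * k t ^ n) (fun t => (2 * INR n + 2) * k t ^ (S n))).
    apply: (continuous_mult (fun _ => _) (fun t => k t ^ n)); [exact: continuous_const | exact: ct_kn].
  apply: (continuous_mult (fun _ => _) (fun t => k t ^ (S n))); [exact: continuous_const | exact: ct_kn].
have z : minus (F 1) (F 0) = 0.
  rewrite /F Rmult_0_r Rmult_1_r sin_0 sin_PI Nat.add_comm /= !Rmult_0_l !Rmult_0_r.
  by rewrite /minus /plus /opp /=; ring.
have h' : is_RInt dF 0 1 (minus (scal (2 * INR n + 1) (I n)) (scal (2 * INR n + 2) (I (S n)))).
  have a := is_RInt_scal _ _ _ (2 * INR n + 1) _ (@is_I n).
  have b := is_RInt_scal _ _ _ (2 * INR n + 2) _ (@is_I (S n)).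
  exact: (is_RInt_minus _ _ _ _ _ _ a b).
have := is_RInt_unique _ _ _ _ h; rewrite (is_RInt_unique _ _ _ _ h') z.
rewrite /minus /plus /opp /scal /= /mult /=; lra.
Qed.

Let I_pos n : 0 < I n.
Proof.
elim: n => [|n IH].
  by rewrite /I /= RInt_const /scal /= /mult /=; lra.
have := wallis n; have := pos_INR n; nra.
Qed.

(* With g = f - f(1/2), continuity gives |g| <= eps + M (1 - k), and the
   normalised integral of k^n (1 - k) is 1/(2n+2) by Wallis. *)
Lemma fourier_density f (Q : H -> Prop) : ct f ->
  (forall x y, Q x -> Q y -> Q (plus x y)) -> (forall c x, Q x -> Q (cscal c x)) ->
  (forall m, Q (fcoef m f)) ->
  forall eps, 0 < eps -> exists y, Q y /\ norm (minus y (f (1 / 2))) <= eps.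
Proof.
move=> hf Qp Qc hQ eps e0.
pose g t := minus (f t) (f (1 / 2)).
have cg : ct g.
  move=> t; apply: (continuous_minus f (fun _ => f (1 / 2))); [exact: hf | exact: continuous_const].
have [M [M0 hM]] : exists M, 0 <= M /\ forall t, 0 <= t <= 1 -> norm (g t) <= eps / 2 + M * (1 - k t).
  have [d [d0 hd]] := proj1 (continuous_eps _ _) (hf (1 / 2)) (eps / 2) ltac:(lra).
  have [B hB] : exists B, forall t, 0 <= t <= 1 -> norm (g t) <= B.
    have cn t : continuous (fun t => norm (g t) : R) t.
      by apply: (continuous_comp g norm); [exact: cg | exact: filterlim_norm].
    have [B [hB _]] := continuity_ab_maj (fun t => norm (g t)) 0 1 ltac:(lra)
      (fun t _ => proj2 (continuity_pt_filterlim _ _) (cn t)).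
    by exists (norm (g B)).
  pose d1 := Rmin d (1 / 2).
  have d10 : 0 < d1 by rewrite /d1; apply: Rmin_pos; lra.
  have d1d : d1 <= d := Rmin_l _ _.
  have d1h : d1 <= 1 / 2 := Rmin_r _ _.
  (* Where |t - 1/2| >= d1, the value 1 - k t = cos^2(PI t) is at least c^2, so the global bound B
     of |g| is at most (B / c^2) (1 - k t). *)
  pose c := cos (PI * (1 / 2 - d1)).
  have PI0 := PI_RGT_0.
  have c0 : 0 < c by rewrite /c; apply: cos_gt_0; nra.
  have B0 : 0 <= B by apply: Rle_trans (norm_pos _) (hB 0 ltac:(lra)).
  exists (B / (c * c)); split.
    by apply: Rdiv_le_0_compat => //; nra.
  move=> t ht.
  case: (Rlt_le_dec (Rabs (t - 1 / 2)) d1) => hdt.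
    have := hd t ltac:(lra); have := k_range t.
    have : 0 <= B / (c * c) by apply: Rdiv_le_0_compat => //; nra.
    rewrite -/(g t); set u := norm (g t); move=> a b; have : 0 <= B / (c * c) * (1 - k t) by nra.
    by move=> a' b'; apply: Rle_trans b' _; lra.
  have kc : c * c <= 1 - k t.
    have -> : 1 - k t = cos (PI * t) * cos (PI * t).
      by rewrite /k; have := sin2_cos2 (PI * t); rewrite /Rsqr; lra.
    case: (Rle_lt_dec t (1 / 2)) => h.
      have : c <= cos (PI * t).
        rewrite /c; move: hdt; rewrite Rabs_left1; last lra.
        by move=> hdt; apply: cos_decr_1; nra.
      nra.
    have : c <= - cos (PI * t).
      have -> : - cos (PI * t) = cos (PI * (1 - t)).
        have -> : PI * (1 - t) = PI - PI * t by ring.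
        by rewrite cos_minus cos_PI sin_PI; ring.
      rewrite /c; move: hdt; rewrite Rabs_pos_eq; last lra.
      by move=> hdt; apply: cos_decr_1; nra.
    nra.
  apply: Rle_trans (hB t ht) _.
  have -> : B = B / (c * c) * (c * c) by field; lra.
  have : 0 <= B / (c * c) by apply: Rdiv_le_0_compat => //; nra.
  have -> : B / (c * c) * (c * c) / (c * c) = B / (c * c) by field; lra.
  nra.
(* For this n the Wallis ratio gives M / (2n + 2) <= eps / 2. *)
have [n hn] := INR_archimed (eps / 2) M ltac:(lra).
have In := I_pos n.
pose Y := RInt (fun t => scal (k t ^ n) (f t)) 0 1.
exists (cscal (RtoC (/ I n)) Y); split.
  by apply Qc; exact: kf_mem.
have hY : is_RInt (fun t => scal (k t ^ n) (g t)) 0 1 (minus Y (scal (I n) (f (1 / 2)))).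
  apply: (is_RInt_ext (fun t => minus (scal (k t ^ n) (f t)) (scal (k t ^ n) (f (1 / 2))))).
    by move=> t _; rewrite /g scal_minus_distr_l.
  apply: is_RInt_minus; first by apply: ct_is_RInt; exact: ct_knf.
  apply: (@is_RInt_linear_map R_NormedModule H (fun r => scal r (f (1 / 2)))); last exact: is_I.
  - by move=> x y; rewrite scal_distr_r.
  - by move=> r x; rewrite scal_assoc.
  - by move=> x; apply: (continuous_scal_l (fun r : R => r : R_AbsRing)); exact: continuous_id.
have hb : norm (minus Y (scal (I n) (f (1 / 2)))) <=
    plus (scal (eps / 2) (I n)) (scal M (minus (I n) (I (S n)))).
  apply: (norm_RInt_le (fun t => scal (k t ^ n) (g t))
     (fun t => plus (scal (eps / 2) (k t ^ n)) (scal M (minus (k t ^ n) (k t ^ S n)))) 0 1 _ _ _ _ hY).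
  - lra.
  - move=> t ht; rewrite norm_scal_eq Rabs_pos_eq; last by apply: pow_le; case: (k_range t).
    apply: Rle_trans (Rmult_le_compat_l _ _ _ (pow_le _ n (proj1 (k_range t))) (hM t ht)) _.
    by rewrite /plus /scal /minus /opp /mult /= /plus /= /mult /=; right; ring.
  - apply: is_RInt_plus; first by apply: is_RInt_scal; exact: is_I.
    by apply: is_RInt_scal; apply: is_RInt_minus; exact: is_I.
have E : minus (cscal (RtoC (/ I n)) Y) (f (1 / 2)) =
    scal (/ I n) (minus Y (scal (I n) (f (1 / 2)))).
  rewrite cscal_real scal_minus_distr_l scal_assoc /mult /= Rinv_l; last lra.
  by rewrite scal_one.
rewrite E norm_scal_eq Rabs_pos_eq; last by apply: Rlt_le; apply: Rinv_0_lt_compat.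
have W := wallis n.
apply: (Rmult_le_reg_l (I n)) => //.
rewrite -Rmult_assoc Rinv_r ?Rmult_1_l; last lra.
apply: Rle_trans hb _.
rewrite /plus /scal /minus /opp /mult /= /plus /= /mult /=.
have n0 := pos_INR n.
have : M * (I n + - I (S n)) <= eps / 2 * I n.
  rewrite -{2}W; have d0 : 0 <= I n - I (S n) by nra.
  have : M <= eps / 2 * (2 * INR n + 2) by nra.
  nra.
lra.
Qed.

(** The density statement for the zero subspace. The single point 1/2 is enough for orbits, whose
    other points are reached through the group. *)
Lemma fourier_unique f : ct f -> (forall m, fcoef m f = zero) -> f (1 / 2) = zero.
Proof.
move=> hf h; apply: eq_sym; apply: norm_small_eq => eps e0.
have Qp (x y : H) : x = zero -> y = zero -> plus x y = zero by move=> -> ->; rewrite plus_zero_l.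
have Qc c (x : H) : x = zero -> cscal c x = zero by move=> ->; cvec.
by have [y [-> hy]] := fourier_density hf Qp Qc h e0.
Qed.

End VectorIntegrals.

(** * Averages over a periodic one-parameter unitary group *)

Section Averages.
Context {H : Hilbert}.
Implicit Types (T S B u v : op H) (x y z : H) (P : pop H).

(** Abstracts the two coordinate circles of the torus, so that each result in one variable serves
    for both. *)
Record ugroup (V : R -> op H) : Prop := {
  ug_bo : forall t, bounded_op (V t);
  ug_in : forall t x y, rin (V t x) (V t y) = rin x y;
  ug_0 : forall x, V 0 x = x;
  ug_add : forall s t x, V (s + t) x = V s (V t x);
  ug_1 : forall x, V 1 x = x;
  ug_ct : forall x, ct (fun t => V t x)
}.

Arguments ug_ct [V] _ x t.

Definition pchar (m : Z) (t : R) : C := cis (2 * PI * (IZR m * t)).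

Lemma fchar_pchar m t : Cmult (fchar m t) (pchar m t) = RtoC 1.
Proof. exact: cis_opp_l. Qed.

Lemma Cmod_pchar m t : Cmod (pchar m t) = 1.
Proof. exact: Cmod_cis. Qed.

Lemma ct_ext (f g : R -> H) : (forall t, f t = g t) -> ct f -> ct g.
Proof. by move=> E hf t; apply: continuous_ext (E) _; exact: hf. Qed.

Variable V : R -> op H.
Hypothesis hV : ugroup V.

Lemma ug_norm t x : norm (V t x) = norm x.
Proof. by apply: norm_sq_eq; rewrite (ug_in hV). Qed.

Lemma ug_inv_r t x : V t (V (- t) x) = x.
Proof. by rewrite -(ug_add hV) Rplus_opp_r (ug_0 hV). Qed.

Lemma ug_inv_l t x : V (- t) (V t x) = x.
Proof. by rewrite -(ug_add hV) Rplus_opp_l (ug_0 hV). Qed.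

Lemma ug_m1 x : V (-1) x = x.
Proof. by rewrite -{1}(ug_1 hV x) (ug_inv_l 1). Qed.

Definition conj (t : R) T : op H := fun x => V t (T (V (- t) x)).

Lemma conj_bo t T : bounded_op T -> bounded_op (conj t T).
Proof. by move=> bT; exact: (bo_op_comp (ug_bo hV t) (bo_op_comp bT (ug_bo hV (- t)))). Qed.

Lemma conj_le t T : bounded_op T -> opnorm (conj t T) <= opnorm T.
Proof.
move=> bT; apply: opnorm_le; first exact: opnorm_pos.
by move=> x; rewrite /conj ug_norm -(ug_norm (- t) x); exact: opnorm_bnd.
Qed.

Lemma conj_0 T : conj 0 T = T.
Proof. by apply: op_ext => x; rewrite /conj Ropp_0 !(ug_0 hV). Qed.

Lemma conj_add s t T : conj (s + t) T = conj s (conj t T).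
Proof. by apply: op_ext => x; rewrite /conj Ropp_plus_distr (Rplus_comm (- s)) !(ug_add hV). Qed.

Lemma conj_period t T : conj (t + 1) T = conj t T.
Proof.
rewrite conj_add; f_equal; apply: op_ext => x.
by rewrite /conj (ug_1 hV) ug_m1.
Qed.

(** Only strong continuity holds for a general bounded T: the left factor moves on the fixed vector
    T V(-t) x, and the change of the right factor is controlled by the bound of T and the isometry
    on the left. *)
Lemma ct_conj T x : bounded_op T -> ct (fun t => conj t T x).
Proof.
move=> bT t; apply/continuous_eps => eps e0.
have [M [M0 hM]] := bounded_bnd bT.
have e1 : 0 < eps / (2 * (M + 1)) by apply: Rdiv_lt_0_compat; lra.
have [d1 [d10 h1]] := proj1 (continuous_eps _ _) (ug_ct hV x (- t)) _ e1.
have [d2 [d20 h2]] := proj1 (continuous_eps _ _) (ug_ct hV (T (V (- t) x)) t) (eps / 2) ltac:(lra).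
exists (Rmin d1 d2); split; first exact: Rmin_pos.
move=> s hs; have hs1 := Rlt_le_trans _ _ _ hs (Rmin_l _ _); have hs2 := Rlt_le_trans _ _ _ hs (Rmin_r _ _).
apply: Rle_trans (norm_minus_trans _ (V s (T (V (- t) x))) _) _.
have a := h2 s hs2; have b := h1 (- s).
have hs3 : Rabs (- s - - t) < d1 by rewrite -Rabs_Ropp; have -> : - (- s - - t) = s - t by ring.
have {}b := b hs3.
rewrite /conj -(bo_minus (ug_bo hV s)) ug_norm -(bo_minus bT).
have c := hM (minus (V (- s) x) (V (- t) x)).
have : M * norm (minus (V (- s) x) (V (- t) x)) <= eps / 2.
  apply: Rle_trans (_ : (M + 1) * (eps / (2 * (M + 1))) <= _).
    by apply: Rmult_le_compat => //; [exact: norm_pos | lra].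
  by right; field; lra.
lra.
Qed.

Arguments ct_conj [T] x _ t.

Definition avg (m : Z) T : op H := fun x => fcoef m (fun t => conj t T x).

Lemma ct_avg m T x : bounded_op T -> ct (fun t => cscal (fchar m t) (conj t T x)).
Proof. by move=> bT; apply: ct_fchar; exact: ct_conj. Qed.

Arguments ct_avg m [T] x _ t.

Lemma avg_bnd m T : bounded_op T -> bnd (opnorm T) (avg m T).
Proof.
move=> bT x; rewrite /avg /fcoef.
have -> : opnorm T * norm x = (1 - 0) * (opnorm T * norm x) by ring.
apply: RInt_norm_le; [lra | exact: ct_avg |].
move=> t _; rewrite norm_cscal Cmod_fchar Rmult_1_l.
apply: Rle_trans (opnorm_bnd (conj_bo t bT) x) _.
by apply: Rmult_le_compat_r; [exact: norm_pos | exact: conj_le].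
Qed.

Lemma avg_bo m T : bounded_op T -> bounded_op (avg m T).
Proof.
move=> bT; apply: (@bnd_bounded _ _ (opnorm T)); last exact: avg_bnd.
- move=> x y; rewrite /avg /fcoef -RInt_plus_ct; try exact: ct_avg.
  by apply: RInt_ext => t _; rewrite (bo_plus (conj_bo t bT)); cvec.
- move=> c x; rewrite /avg /fcoef -(RInt_bo _ _ (bo_cscal_op c)); last exact: ct_avg.
  by apply: RInt_ext => t _; rewrite (bo_cscal (conj_bo t bT)); cvec.
Qed.

Lemma avg_le m T : bounded_op T -> opnorm (avg m T) <= opnorm T.
Proof. by move=> bT; apply: opnorm_le; [exact: opnorm_pos | exact: avg_bnd]. Qed.

Lemma conj_op_plus t T S : conj t (op_plus T S) = op_plus (conj t T) (conj t S).
Proof. by apply: op_ext => x; rewrite /conj /op_plus (bo_plus (ug_bo hV t)). Qed.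

Lemma conj_op_scal t c T : conj t (op_scal c T) = op_scal c (conj t T).
Proof. by apply: op_ext => x; rewrite /conj /op_scal (bo_cscal (ug_bo hV t)). Qed.

Lemma avg_op_plus m T S : bounded_op T -> bounded_op S ->
  avg m (op_plus T S) = op_plus (avg m T) (avg m S).
Proof.
move=> bT bS; apply: op_ext => x; rewrite /op_plus /avg /fcoef -RInt_plus_ct; try exact: ct_avg.
by apply: RInt_ext => t _; rewrite conj_op_plus /op_plus; cvec.
Qed.

Lemma avg_op_scal m c T : bounded_op T -> avg m (op_scal c T) = op_scal c (avg m T).
Proof.
move=> bT; apply: op_ext => x; rewrite /op_scal /avg /fcoef -(RInt_bo _ _ (bo_cscal_op c)); last exact: ct_avg.
by apply: RInt_ext => t _; rewrite conj_op_scal /op_scal; cvec.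
Qed.

Lemma avg_equiv m u v T : bounded_op u -> bounded_op v ->
  (forall t x, u (V t x) = V t (u x)) -> (forall t x, v (V t x) = V t (v x)) -> bounded_op T ->
  (fun x => u (avg m T (v x))) = avg m (fun x => u (T (v x))).
Proof.
move=> bu bv cu cv bT; apply: op_ext => x; rewrite /avg /fcoef -(RInt_bo _ _ bu); last exact: ct_avg.
by apply: RInt_ext => t _; rewrite (bo_cscal bu) /conj cu cv.
Qed.

(** Shifting the periodic integral by s changes only the character. *)
Lemma avg_conj m s T : bounded_op T -> avg m (conj s T) = op_scal (pchar m s) (avg m T).
Proof.
move=> bT; apply: op_ext => x; rewrite /op_scal.
have per t : cscal (fchar m (t + 1)) (conj (t + 1) T x) = cscal (fchar m t) (conj t T x).
  by rewrite fchar_period conj_period.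
rewrite {2}/avg /fcoef -(RInt_shift s (ct_avg m x bT) per) -(RInt_bo _ _ (bo_cscal_op _)); last first.
  have c : ct (fun t => cscal (fchar m s) (cscal (fchar m t) (conj t (conj s T) x))).
    by apply: ct_bo; [exact: bo_cscal_op | apply: ct_avg; exact: conj_bo].
  by apply: ct_ext c => t; rewrite fchar_shift conj_add; cvec.
apply: RInt_ext => t _; rewrite fchar_shift conj_add cscal_assoc.
by rewrite (Cmult_comm (fchar m t)) Cmult_assoc (Cmult_comm (pchar m s)) fchar_pchar Cmult_1_l.
Qed.

Lemma conj_avg m s T : bounded_op T -> conj s (avg m T) = op_scal (pchar m s) (avg m T).
Proof.
move=> bT; rewrite -avg_conj // /conj.
by rewrite (avg_equiv m (ug_bo hV s) (ug_bo hV (- s))) // => t x; rewrite -!(ug_add hV) Rplus_comm.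
Qed.

Lemma pchar_half m m' : m <> m' -> pchar m (/ (2 * IZR (m - m'))) = Cmult (RtoC (-1)) (pchar m' (/ (2 * IZR (m - m')))).
Proof.
move=> ne; rewrite -cis_PI /pchar -cis_plus; f_equal.
have h : IZR m - IZR m' <> 0 by move=> E; apply: ne; apply: eq_IZR; lra.
by rewrite minus_IZR; field.
Qed.

Lemma avg_homog m T : bounded_op T -> (forall t, conj t T = op_scal (pchar m t) T) ->
  avg m T = T.
Proof.
move=> bT h.
apply: op_ext => x; rewrite /avg /fcoef (_ : RInt _ 0 1 = RInt (fun _ => T x) 0 1).
  by rewrite RInt_const Rminus_0_r scal_one.
by apply: RInt_ext => t _; rewrite h /op_scal cscal_assoc fchar_pchar cscal_real scal_one.
Qed.

(** Conjugation by V at 1/(2(m - m')) multiplies the average by each of the two characters, and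
    their quotient at this point is -1; a vector equal to its negative vanishes. No integral of a
    character has to be computed. *)
Lemma avg_homog_ne m m' T : m <> m' -> bounded_op T ->
  (forall t, conj t T = op_scal (pchar m' t) T) -> avg m T = @op_zero H.
Proof.
move=> ne bT h.
have := avg_conj m (/ (2 * IZR (m - m'))) bT; rewrite h avg_op_scal // pchar_half //.
set p := pchar m' _ => E; apply: op_ext => x.
have {E} := f_equal (fun F : op H => F x) E; rewrite /op_scal /op_zero -cscal_assoc.
set y := avg m T x => E.
have z : cscal p y = zero.
  apply: norm_eq_zero; have : cscal p y = cscal (RtoC (1 / 2)) (plus (cscal p y) (cscal p y)).
    by apply: inner_ext => w; rewrite ?(inner_plus_l, inner_cscal_l); apply: injective_projections => /=; field.
  rewrite {3}E => ->.
  have -> : plus (cscal p y) (cscal (RtoC (-1)) (cscal p y)) = zero by cvec.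
  by rewrite norm_cscal norm_zero; ring.
by apply: norm_eq_zero; rewrite -(Rmult_1_l (norm y)) -(Cmod_pchar m' (/ (2 * IZR (m - m')))) -norm_cscal -/p z norm_zero.
Qed.

Lemma avg_unique T : bounded_op T -> (forall m, avg m T = @op_zero H) -> T = @op_zero H.
Proof.
move=> bT h; apply: op_ext => x.
(* The test vector is V(1/2) x, so that the value at the point 1/2, where uniqueness applies, is
   V(1/2) T x. *)
have E : conj (1 / 2) T (V (1 / 2) x) = zero.
  apply: (@fourier_unique _ (fun t => conj t T (V (1 / 2) x))); first exact: ct_conj.
  by move=> m; have := f_equal (fun F : op H => F (V (1 / 2) x)) (h m).
move: E; rewrite /conj ug_inv_l => E; rewrite /op_zero.
by apply: norm_eq_zero; rewrite -(ug_norm (1 / 2)) E norm_zero.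
Qed.

Definition proj (m : Z) x : H := fcoef m (fun t => V t x).

Lemma V_proj m s x : V s (proj m x) = cscal (pchar m s) (proj m x).
Proof.
have c : ct (fun t => cscal (fchar m t) (V t x)) by apply: ct_fchar; exact: (ug_ct hV).
rewrite /proj /fcoef -(RInt_bo _ _ (ug_bo hV s)) //.
have per t : cscal (fchar m (t + 1)) (V (t + 1) x) = cscal (fchar m t) (V t x).
  by rewrite fchar_period (ug_add hV) (ug_1 hV).
have E t : V s (cscal (fchar m t) (V t x)) = cscal (pchar m s) (cscal (fchar m (t + s)) (V (t + s) x)).
  rewrite (bo_cscal (ug_bo hV s)) -(ug_add hV) Rplus_comm fchar_shift cscal_assoc.
  by rewrite (Cmult_comm (fchar m t)) Cmult_assoc (Cmult_comm (pchar m s)) fchar_pchar Cmult_1_l.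
rewrite (RInt_ext _ (fun t => cscal (pchar m s) (cscal (fchar m (t + s)) (V (t + s) x)))) //.
rewrite -(RInt_shift s c per) -(RInt_bo _ _ (bo_cscal_op _)) //.
have c' : ct (fun t => cscal (fchar m s) (cscal (fchar m t) (V t (V s x)))).
  by apply: ct_bo; [exact: bo_cscal_op | apply: ct_fchar; exact: (ug_ct hV)].
by apply: ct_ext c' => t; rewrite fchar_shift (ug_add hV); cvec.
Qed.

Lemma proj_bo m u x : bounded_op u -> (forall t y, u (V t y) = V t (u y)) -> u (proj m x) = proj m (u x).
Proof.
move=> bu cu; rewrite /proj /fcoef -(RInt_bo _ _ bu); last by apply: ct_fchar; exact: (ug_ct hV).
by apply: RInt_ext => t _; rewrite (bo_cscal bu) cu.
Qed.

(** x is the value at 1/2 of the orbit of V(-1/2) x, whose Fourier coefficients are scalar multiples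
    of the projections of x. *)
Lemma proj_dense x (Q : H -> Prop) :
  (forall y z, Q y -> Q z -> Q (plus y z)) -> (forall c y, Q y -> Q (cscal c y)) ->
  (forall m, Q (proj m x)) ->
  forall eps, 0 < eps -> exists y, Q y /\ norm (minus y x) <= eps.
Proof.
move=> Qp Qc hQ eps e0.
have -> : x = V (1 / 2) (V (- (1 / 2)) x) by rewrite ug_inv_r.
apply: (@fourier_density _ (fun t => V t (V (- (1 / 2)) x))) => //; first exact: (ug_ct hV).
move=> m; rewrite -/(proj m _).
rewrite -(proj_bo m x (ug_bo hV _)); last by move=> t y; rewrite -!(ug_add hV) Rplus_comm.
by rewrite V_proj; apply Qc.
Qed.

Lemma vanish_of_proj T x : bounded_op T -> (forall m, T (proj m x) = zero) -> T x = zero.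
Proof.
move=> bT h; apply: norm_small_eq => eps e0.
have [M [M0 hM]] := bounded_bnd bT.
have Qp y z : T y = zero -> T z = zero -> T (plus y z) = zero.
  by move=> a b; rewrite (bo_plus bT) a b plus_zero_l.
have Qc c y : T y = zero -> T (cscal c y) = zero by move=> a; rewrite (bo_cscal bT) a; cvec.
have e1 : 0 < eps / (M + 1) by apply: Rdiv_lt_0_compat; lra.
have [y [Ty hy]] := @proj_dense x (fun y => T y = zero) Qp Qc h _ e1.
have -> : minus (T x) zero = opp (T (minus y x)) by rewrite (bo_minus bT) Ty; cvec.
rewrite norm_opp; apply: Rle_trans (hM _) _.
apply: Rle_trans (_ : (M + 1) * (eps / (M + 1)) <= _); last by right; field; lra.
by apply: Rmult_le_compat => //; [exact: norm_pos | lra].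
Qed.

(** An unbounded P cannot be moved through the integral directly. Tested against z in its domain,
    the claim becomes a pointwise identity of scalar integrands, and self-adjointness then places
    the integral in the domain. *)
Lemma avg_is_comm P T B m : selfadjoint P -> (forall t, commutes (V t) P) -> bounded_op T ->
  is_comm P T B -> is_comm P (avg m T) (avg m B).
Proof.
move=> sa cV bT [bB h]; split; first exact: avg_bo.
have key x : dom P x -> forall t, dom P (conj t T x) /\
    P (conj t T x) = plus (conj t B x) (conj t T (P x)).
  move=> dx t; have [a b] := cV (- t) _ dx; have [c e] := h _ a.
  have [f g] := cV t _ c; split=> //; rewrite /conj g -b e.
  by rewrite -(bo_plus (ug_bo hV t)); congr (V t); cvec.
move=> x dx.
have [a b] : dom P (avg m T x) /\ P (avg m T x) = plus (avg m B x) (avg m T (P x)).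
  apply: sa_crit => // z dz.
  rewrite {2 3}/avg /fcoef -RInt_plus_ct; try exact: ct_avg.
  apply: rin_RInt_eq; [exact: ct_avg | by apply: ct_plus; exact: ct_avg |].
  move=> t; have [c d] := key x dx t; have [e f] := sa_cscal sa (fchar m t) c.
  rewrite (sa_sym sa dz e) f d; congr rin; cvec.
by split=> //; rewrite b; cvec.
Qed.

(** Left Riemann sums of [avg] taken as operators: finite combinations of conjugates of T, so they
    stay in any space stable under these. The mesh 1/N is kept apart from the number n of cells to
    allow induction on n. *)
Fixpoint riemann (m : Z) (N n : nat) T : op H :=
  match n with
  | O => @op_zero H
  | S n => op_plus (riemann m N n T)
      (op_scal (Cmult (RtoC (/ INR N)) (fchar m (INR n * / INR N))) (conj (INR n * / INR N) T))
  end.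

(** Up to conjugation and a phase, the integrand changes between s and s + h as it does between 0
    and h, so norm continuity at 0 alone bounds the error on all cells by one constant. *)
Lemma riemann_avg m N T eps : (0 < N)%nat -> bounded_op T -> 0 <= eps ->
  (forall t, Rabs t <= / INR N -> opnorm (op_minus (op_scal (fchar m t) (conj t T)) T) <= eps) ->
  opnorm (op_minus (riemann m N N T) (avg m T)) <= eps.
Proof.
move=> N0 bT e0 h; apply: opnorm_le => // x.
have iN : 0 < / INR N by apply: Rinv_0_lt_compat; apply: lt_0_INR.
set q := / INR N in iN h *.
pose f t := cscal (fchar m t) (conj t T x).
have cf : ct f by exact: ct_avg.
have close s t : Rabs (t - s) <= q -> norm (minus (f t) (f s)) <= eps * norm x.
  move=> hst.
  have -> : minus (f t) (f s) =
      cscal (fchar m s) (conj s (op_minus (op_scal (fchar m (t - s)) (conj (t - s) T)) T) x).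
    have -> : f t = f (s + (t - s)) by congr f; ring.
    rewrite /f fchar_shift conj_add /conj /op_minus /op_scal (bo_minus (ug_bo hV s)) (bo_cscal (ug_bo hV s)).
    by cvec.
  rewrite norm_cscal Cmod_fchar Rmult_1_l /conj ug_norm -(ug_norm (- s) x).
  apply: Rle_trans (opnorm_bnd _ _) _.
    by apply: bo_op_minus => //; apply: bo_op_scal; exact: conj_bo.
  by apply: Rmult_le_compat_r; [exact: norm_pos | exact: h].
have main n : norm (minus (riemann m N n T x) (RInt f 0 (INR n * q))) <= INR n * q * (eps * norm x).
  elim: n => [|n IH].
    rewrite /= /op_zero !Rmult_0_l RInt_point.
    by rewrite /zero /= (_ : minus zero zero = zero) ?norm_zero; [lra | cvec].
  rewrite -(RInt_Chasles f 0 (INR n * q)); try exact: ct_ex_RInt.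
  rewrite [riemann _ _ _ _ _]/= /op_plus -/q.
  set R1 := riemann m N n T x in IH *; set I1 := RInt f 0 _ in IH *; set I2 := RInt f _ _.
  set w := op_scal _ _ x.
  have -> : minus (plus R1 w) (plus I1 I2) = plus (minus R1 I1) (minus w I2) by cvec.
  apply: Rle_trans (norm_triangle _ _) _.
  rewrite S_INR.
  have -> : (INR n + 1) * q * (eps * norm x) = INR n * q * (eps * norm x) + q * (eps * norm x) by ring.
  apply: Rplus_le_compat => //.
  pose g t := minus (f t) (f (INR n * q)).
  have cg : ct g.
    by move=> t; apply: (continuous_minus f (fun _ => f (INR n * q))); [exact: cf | exact: continuous_const].
  have E : I2 = plus (RInt g (INR n * q) (INR (S n) * q)) w.
    have -> : w = RInt (fun _ => f (INR n * q)) (INR n * q) (INR (S n) * q).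
      rewrite RInt_const /w /op_scal -cscal_assoc cscal_real.
      by have -> : INR (S n) * q - INR n * q = q by rewrite S_INR; ring.
    rewrite -RInt_plus_ct //; last by move=> t; exact: continuous_const.
    by apply: RInt_ext => t _; rewrite /g; cvec.
  have -> : minus w I2 = opp (RInt g (INR n * q) (INR (S n) * q)) by rewrite E; cvec.
  rewrite norm_opp.
  have -> : q * (eps * norm x) = (INR (S n) * q - INR n * q) * (eps * norm x) by rewrite S_INR; ring.
  apply: RInt_norm_le => //; first by rewrite S_INR; lra.
  move=> t ht; rewrite /g; apply: close; rewrite S_INR in ht.
  by rewrite Rabs_pos_eq; lra.
have := main N; rewrite /q Rinv_r ?Rmult_1_l; last by apply: not_0_INR; lia.
by [].
Qed.

End Averages.

(** * Commutators and the smooth domain of the derivations *)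

Section Commutators.
Context {H : Hilbert}.
Implicit Types (T S B C u v : op H) (x y z : H) (P : pop H).

Lemma op_cauchy_complete (T : nat -> op H) : (forall n, bounded_op (T n)) ->
  (forall eps, 0 < eps -> exists N, forall n m, (N <= n)%nat -> (N <= m)%nat ->
     opnorm (op_minus (T n) (T m)) <= eps) ->
  exists S, bounded_op S /\ forall eps, 0 < eps -> exists N, forall n, (N <= n)%nat ->
     opnorm (op_minus (T n) S) <= eps.
Proof.
move=> bT hc.
have close x eps N : 0 < eps -> (forall n m, (N <= n)%nat -> (N <= m)%nat ->
     opnorm (op_minus (T n) (T m)) <= eps) -> forall n m, (N <= n)%nat -> (N <= m)%nat ->
     norm (minus (T n x) (T m x)) <= eps * norm x.
  move=> e0 h n m hn hm; apply: Rle_trans (opnorm_bnd (bo_op_minus (bT n) (bT m)) x) _.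
  by apply: Rmult_le_compat_r; [exact: norm_pos | exact: h].
have lim (x : H) : exists l : H, forall eps, 0 < eps -> exists N, forall n, (N <= n)%nat ->
     norm (minus (T n x) l) <= eps.
  apply: cauchy_complete => eps e0.
  have nx := norm_pos x.
  have e1 : 0 < eps / (norm x + 1) by apply: Rdiv_lt_0_compat; lra.
  have [N hN] := hc _ e1; exists N => n m hn hm.
  apply: Rle_trans (close x _ _ e1 hN n m hn hm) _.
  apply: Rle_trans (_ : eps / (norm x + 1) * (norm x + 1) <= _); last by right; field; lra.
  by apply: Rmult_le_compat_l; lra.
have [S hS] : exists S : op H, forall x eps, 0 < eps ->
    exists N, forall n, (N <= n)%nat -> norm (minus (T n x) (S x)) <= eps.
  exists (fun x => proj1_sig (constructive_indefinite_description _ (lim x))) => x.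
  exact: proj2_sig (constructive_indefinite_description _ (lim x)).
have unif eps N : 0 < eps -> (forall n m, (N <= n)%nat -> (N <= m)%nat ->
     opnorm (op_minus (T n) (T m)) <= eps) -> forall n x, (N <= n)%nat ->
     norm (minus (T n x) (S x)) <= eps * norm x.
  move=> e0 h n x hn; apply: le_epsilon => e e1.
  have [M hM] := hS x e e1.
  apply: Rle_trans (norm_minus_trans _ (T (N + M)%nat x) _) _.
  apply: Rplus_le_compat; [apply: close h _ _ _ _ => //; lia | apply: hM; lia].
have Splus x y : S (plus x y) = plus (S x) (S y).
  apply: norm_small_eq => eps e0.
  have [N1 h1] := hS x (eps / 3) ltac:(lra).
  have [N2 h2] := hS y (eps / 3) ltac:(lra).
  have [N3 h3] := hS (plus x y) (eps / 3) ltac:(lra).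
  have {}h1 := h1 (N1 + N2 + N3)%nat ltac:(lia).
  have {}h2 := h2 (N1 + N2 + N3)%nat ltac:(lia).
  have {}h3 := h3 (N1 + N2 + N3)%nat ltac:(lia).
  set n := (N1 + N2 + N3)%nat in h1 h2 h3.
  have -> : minus (S (plus x y)) (plus (S x) (S y)) =
    minus (plus (minus (T n x) (S x)) (minus (T n y) (S y))) (minus (T n (plus x y)) (S (plus x y))).
    by rewrite (bo_plus (bT n)); cvec.
  apply: Rle_trans (norm_le_minus _ _) _.
  apply: Rle_trans (Rplus_le_compat_r _ _ _ (norm_le_plus _ _)) _; lra.
have Sscal c x : S (cscal c x) = cscal c (S x).
  apply: norm_small_eq => eps e0.
  have c0 := Cmod_ge_0 c.
  have e1 : 0 < eps / (2 * (Cmod c + 1)) by apply: Rdiv_lt_0_compat; lra.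
  have [N1 h1] := hS x _ e1.
  have [N2 h2] := hS (cscal c x) (eps / 2) ltac:(lra).
  have {}h1 := h1 (N1 + N2)%nat ltac:(lia).
  have {}h2 := h2 (N1 + N2)%nat ltac:(lia).
  set n := (N1 + N2)%nat in h1 h2.
  have -> : minus (S (cscal c x)) (cscal c (S x)) =
    minus (cscal c (minus (T n x) (S x))) (minus (T n (cscal c x)) (S (cscal c x))).
    by rewrite (bo_cscal (bT n)); cvec.
  apply: Rle_trans (norm_le_minus _ _) _; rewrite norm_cscal.
  have : Cmod c * norm (minus (T n x) (S x)) <= eps / 2.
    apply: Rle_trans (_ : (Cmod c + 1) * (eps / (2 * (Cmod c + 1))) <= _); last by right; field; lra.
    by apply: Rmult_le_compat => //; [exact: norm_pos | lra].
  lra.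
have bS : bounded_op S.
  have [N hN] := hc 1 ltac:(lra).
  apply: (@bnd_bounded _ _ (opnorm (T N) + 1)) => // x.
  have a := unif 1 N ltac:(lra) hN N x ltac:(lia); have b := opnorm_bnd (bT N) x.
  have -> : S x = minus (T N x) (minus (T N x) (S x)) by cvec.
  apply: Rle_trans (norm_le_minus _ _) _; lra.
exists S; split=> // eps e0; have [N hN] := hc eps e0; exists N => n hn.
by apply: opnorm_le; [lra | move=> x; exact: unif hN n x hn].
Qed.

Lemma opnorm_minus_sym T S : bounded_op T -> bounded_op S ->
  opnorm (op_minus T S) = opnorm (op_minus S T).
Proof.
have le A B : bounded_op A -> bounded_op B -> opnorm (op_minus A B) <= opnorm (op_minus B A).
  move=> bA bB; have -> : op_minus A B = op_scal (RtoC (-1)) (op_minus B A).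
    by apply: op_ext => x; rewrite /op_minus /op_scal; cvec.
  apply: Rle_trans (opnorm_scal _ (bo_op_minus bB bA)) _.
  by rewrite Cmod_R Rabs_Ropp Rabs_R1; lra.
by move=> bT bS; apply: Rle_antisym; exact: le.
Qed.

Lemma opnorm_minus_trans T S B : bounded_op T -> bounded_op S -> bounded_op B ->
  opnorm (op_minus T B) <= opnorm (op_minus T S) + opnorm (op_minus S B).
Proof.
move=> bT bS bB; have -> : op_minus T B = op_plus (op_minus T S) (op_minus S B).
  by apply: op_ext => x; rewrite /op_minus /op_plus; cvec.
by apply: opnorm_plus; exact: bo_op_minus.
Qed.

(** The property that makes the chosen [comm] equal to any exhibited commutator. It is isolated
    because for the generators [h1] and [h2] it is obtained from joint eigenvectors instead of
    self-adjointness. *)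
Definition determining P := forall B, bounded_op B -> (forall x, dom P x -> B x = zero) -> B = @op_zero H.

Lemma sa_determining P : selfadjoint P -> determining P.
Proof.
case=> _ [dd _] B bB h; apply: op_ext => x; apply: norm_small_eq => eps e0.
have e1 : 0 < eps / (opnorm B + 1).
  by apply: Rdiv_lt_0_compat => //; have := opnorm_pos bB; lra.
have [y [dy hy]] := dd x _ e1.
have -> : minus (B x) (op_zero x) = B (minus x y).
  by rewrite (bo_minus bB) (h y dy) /op_zero; cvec.
apply: Rle_trans (opnorm_bnd bB _) _.
have B0 := opnorm_pos bB.
apply: Rle_trans (_ : (opnorm B + 1) * (eps / (opnorm B + 1)) <= _); last by right; field; lra.
by apply: Rmult_le_compat => //; [exact: norm_pos | lra | exact: Rlt_le].
Qed.

Lemma is_comm_uniq P T B C : determining P -> is_comm P T B -> is_comm P T C -> B = C.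
Proof.
move=> det [bB hB] [bC hC].
have E : op_minus B C = @op_zero H.
  apply: det; first exact: bo_op_minus.
  by move=> x dx; rewrite /op_minus; have [_ ->] := hB x dx; have [_ ->] := hC x dx; cvec.
apply: op_ext => x; have := f_equal (fun F : op H => F x) E; rewrite /op_minus /op_zero => E'.
by apply: norm_zero_eq; rewrite E' norm_zero.
Qed.

Lemma comm_eq P T B : determining P -> is_comm P T B -> comm P T = B.
Proof.
move=> det h; apply: (is_comm_uniq (P := P) (T := T) det) => //.
by rewrite /comm; apply: epsilon_spec; exists B.
Qed.

Lemma comm_spec P T : has_comm P T -> is_comm P T (comm P T).
Proof. by move=> h; apply: epsilon_spec. Qed.

Lemma iter_comm_eq P (f : nat -> op H) : determining P -> (forall k, is_comm P (f k) (f (S k))) ->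
  forall k, iter_comm P k (f O) = f k.
Proof.
move=> det h; elim=> // k IH; change (comm P (iter_comm P k (f O)) = f (S k)); rewrite IH.
exact: comm_eq.
Qed.

Lemma dom_iter_comm_of P (f : nat -> op H) : determining P -> bounded_op (f O) -> (forall k, is_comm P (f k) (f (S k))) ->
  forall k, dom_iter_comm P k (f O).
Proof.
move=> det b0 h k; split=> // j _.
by rewrite -[Nat.iter j _ _]/(iter_comm P j (f O)) iter_comm_eq //; exists (f (S j)).
Qed.

Section SA.
Variable P : pop H.
Hypothesis sa : selfadjoint P.

Lemma is_comm_zero : is_comm P (@op_zero H) (@op_zero H).
Proof.
have [a b] := sa_zero sa.
by split; [exact: bo_op_zero | move=> x dx; rewrite /op_zero b; split=> //; cvec].
Qed.

Lemma is_comm_plus T S B C : is_comm P T B -> is_comm P S C -> is_comm P (op_plus T S) (op_plus B C).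
Proof.
move=> [bB hB] [bC hC]; split; first exact: bo_op_plus.
move=> x dx; have [a ea] := hB x dx; have [c ec] := hC x dx.
by rewrite /op_plus; have [d ->] := sa_plus sa a c; split=> //; rewrite ea ec; cvec.
Qed.

Lemma is_comm_scal c T B : is_comm P T B -> is_comm P (op_scal c T) (op_scal c B).
Proof.
move=> [bB hB]; split; first exact: bo_op_scal.
move=> x dx; have [a ea] := hB x dx.
by rewrite /op_scal; have [d ->] := sa_cscal sa c a; split=> //; rewrite ea; cvec.
Qed.

Lemma is_comm_comp T S B C : bounded_op T -> bounded_op S -> is_comm P T B -> is_comm P S C ->
  is_comm P (op_comp T S) (op_plus (op_comp B S) (op_comp T C)).
Proof.
move=> bT bS [bB hB] [bC hC]; split.
  by apply: bo_op_plus; exact: bo_op_comp.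
move=> x dx; have [a ea] := hC x dx; have [c ec] := hB _ a.
rewrite /op_comp /op_plus; split=> //; rewrite ec ea (bo_minus bT); cvec.
Qed.

Lemma is_comm_left u T B : bounded_op u -> commutes u P -> is_comm P T B ->
  is_comm P (op_comp u T) (op_comp u B).
Proof.
move=> bu cu [bB hB]; split; first exact: bo_op_comp.
move=> x dx; have [a ea] := hB x dx; have [c ec] := cu _ a.
by rewrite /op_comp; split=> //; rewrite ec ea (bo_minus bu).
Qed.

Lemma is_comm_conj V t T B : ugroup V -> (forall t, commutes (V t) P) -> is_comm P T B ->
  is_comm P (conj V t T) (conj V t B).
Proof.
move=> hV cV [bB hB]; split; first exact: conj_bo.
move=> x dx; have [a ea] := cV (- t) _ dx; have [b eb] := hB _ a; have [c ec] := cV t _ b.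
by rewrite /conj; split=> //; rewrite ec eb (bo_minus (ug_bo hV t)) ea.
Qed.

(** Commutation with P is a closed derivation because P is closed: for fixed x, T' x tends to T x
    while P T' x = B' x + T' P x tends to B x + T P x. *)
Lemma is_comm_limit T B : bounded_op T -> bounded_op B ->
  (forall eps, 0 < eps -> exists T' B', bounded_op T' /\ is_comm P T' B' /\
     opnorm (op_minus T' T) <= eps /\ opnorm (op_minus B' B) <= eps) ->
  is_comm P T B.
Proof.
move=> bT bB h; split=> // x dx.
have [a b] : dom P (T x) /\ P (T x) = plus (B x) (T (P x)).
  apply: sa_closed => // eps e0.
  have nx := norm_pos x; have np := norm_pos (P x).
  have n0 : 0 < norm x + norm (P x) + 1 by lra.
  have e1 : 0 < eps / (norm x + norm (P x) + 1) by apply: Rdiv_lt_0_compat.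
  have [T' [B' [bT' [[bB' hB'] [h1 h2]]]]] := h _ e1.
  have [d e] := hB' x dx; exists (T' x); split=> //.
  set q := eps / (norm x + norm (P x) + 1) in e1 h1 h2.
  have qe : q * (norm x + norm (P x) + 1) = eps by rewrite /q; field; lra.
  have a1 : norm (minus (T' x) (T x)) <= q * norm x.
    apply: Rle_trans (opnorm_bnd (bo_op_minus bT' bT) x) _.
    by apply: Rmult_le_compat_r.
  have a2 : norm (minus (T' (P x)) (T (P x))) <= q * norm (P x).
    apply: Rle_trans (opnorm_bnd (bo_op_minus bT' bT) (P x)) _.
    by apply: Rmult_le_compat_r.
  have a3 : norm (minus (B' x) (B x)) <= q * norm x.
    apply: Rle_trans (opnorm_bnd (bo_op_minus bB' bB) x) _.
    by apply: Rmult_le_compat_r.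
  split; first nra.
  have -> : P (T' x) = plus (B' x) (T' (P x)) by rewrite e; cvec.
  have -> : minus (plus (B' x) (T' (P x))) (plus (B x) (T (P x))) =
    plus (minus (B' x) (B x)) (minus (T' (P x)) (T (P x))) by cvec.
  apply: Rle_trans (norm_le_plus _ _) _; nra.
by split=> //; rewrite b; cvec.
Qed.

Definition radj T S := forall x y, rin (T x) y = rin x (S y).

(** Symmetry of P gives the relation when both vectors lie in dom P; boundedness extends it by
    density, one variable at a time. Taking adjoints reverses the order in the commutator, hence the
    sign. *)
Lemma radj_comm T S B C : radj T S -> is_comm P T B -> is_comm P S C ->
  radj B (op_scal (RtoC (-1)) C).
Proof.
move=> adj [bB hB] [bC hC].
have det := sa_determining sa.
have nC := bo_op_scal (RtoC (-1)) bC.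
case: (sa) => _ [dd _].
have base x y : dom P x -> dom P y -> rin (B x) y = rin x (op_scal (RtoC (-1)) C y).
  move=> dx dy; have [a ->] := hB x dx; have [c ec] := hC y dy.
  rewrite /op_scal ec cscal_real; rvec.
  rewrite (sa_sym sa a dy) !adj -(sa_sym sa dx c); ring.
have ext (f : H -> R) (g : H -> R) M : 0 <= M -> (forall x y, f (minus x y) = f x - f y) ->
   (forall x, Rabs (f x) <= M * norm x) -> (forall x, dom P x -> f x = 0) -> forall x, f x = 0.
  move=> M0 fm fb fz x; apply: Rabs_eq_0; apply: Rle_antisym; last exact: Rabs_pos.
  apply: le_epsilon => eps e0.
  have e1 : 0 < eps / (M + 1) by apply: Rdiv_lt_0_compat; lra.
  have [y [dy hy]] := dd x _ e1.
  have -> : f x = f (minus x y) by rewrite fm (fz y dy); ring.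
  apply: Rle_trans (fb _) _; rewrite Rplus_0_l.
  apply: Rle_trans (_ : (M + 1) * (eps / (M + 1)) <= _); last by right; field; lra.
  by apply: Rmult_le_compat => //; [exact: norm_pos | lra | exact: Rlt_le].
have B0 := opnorm_pos bB; have C0 := opnorm_pos nC.
have step x y : dom P x -> rin (B x) y - rin x (op_scal (RtoC (-1)) C y) = 0.
  move=> dx; apply: (ext (fun y => rin (B x) y - rin x (op_scal (RtoC (-1)) C y)) (fun _ => 0)
     (norm (B x) + norm x * opnorm (op_scal (RtoC (-1)) C))).
  - by have := norm_pos (B x); have := norm_pos x; nra.
  - by move=> a b; rewrite (bo_minus nC); rvec; ring.
  - move=> z; apply: Rle_trans (Rabs_triang _ _) _; rewrite Rabs_Ropp.
    have a := cauchy_schwarz (B x) z; have b := cauchy_schwarz x (op_scal (RtoC (-1)) C z).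
    have c := opnorm_bnd nC z; have := norm_pos x; nra.
  - by move=> z dz; rewrite base //; ring.
move=> x y; apply: Rminus_diag_uniq.
apply: (ext (fun x => rin (B x) y - rin x (op_scal (RtoC (-1)) C y)) (fun _ => 0)
     (opnorm B * norm y + norm (op_scal (RtoC (-1)) C y))).
- by have := norm_pos y; have := norm_pos (op_scal (RtoC (-1)) C y); nra.
- by move=> a b; rewrite (bo_minus bB); rvec; ring.
- move=> z; apply: Rle_trans (Rabs_triang _ _) _; rewrite Rabs_Ropp.
  have a := cauchy_schwarz (B z) y; have b := cauchy_schwarz z (op_scal (RtoC (-1)) C y).
  have c := opnorm_bnd bB z; have := norm_pos y; nra.
- by move=> z dz; exact: step.
Qed.

(** |S y|^2 = (T S y, y) <= |T| |S y| |y|, and one factor |S y| cancels. *)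
Lemma radj_opnorm T S : bounded_op T -> bounded_op S -> radj T S -> opnorm S <= opnorm T.
Proof.
move=> bT bS adj; apply: opnorm_le; first exact: opnorm_pos.
move=> y; have := adj (S y) y; rewrite rin_self => E.
have := cauchy_schwarz (T (S y)) y; rewrite E.
have := opnorm_bnd bT (S y); have := norm_pos y; have n0 := norm_pos (S y).
rewrite Rabs_pos_eq; last nra.
move=> a b c; case: (Req_dec (norm (S y)) 0) => [->|ne].
  by have := opnorm_pos bT; nra.
have p : 0 < norm (S y) by case: n0 => // E0; case: ne.
apply: (Rmult_le_reg_l (norm (S y))) => //; nra.
Qed.

(** The k-th derivative of a product expanded into 2^k terms without collecting binomial
    coefficients; [a i] and [b i] stand for i-th derivatives. The factor 2^k in [leibniz_le] counts
    these terms. *)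
Fixpoint leibniz (k : nat) (a b : nat -> op H) : op H :=
  match k with
  | O => op_comp (a O) (b O)
  | S k => op_plus (leibniz k (fun i => a (S i)) b) (leibniz k a (fun i => b (S i)))
  end.

Lemma leibniz_is_comm k (a b : nat -> op H) :
  (forall i, bounded_op (a i)) -> (forall i, bounded_op (b i)) ->
  (forall i, is_comm P (a i) (a (S i))) -> (forall i, is_comm P (b i) (b (S i))) ->
  is_comm P (leibniz k a b) (leibniz (S k) a b).
Proof.
elim: k a b => [|k IH] a b ba bb ha hb; first exact: is_comm_comp.
by apply: is_comm_plus; apply: IH => i.
Qed.

Definition nsum (k : nat) (a : nat -> op H) : R := sum_f_R0 (fun i => opnorm (a i)) k.

Lemma nsum_pos k a : (forall i, bounded_op (a i)) -> 0 <= nsum k a.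
Proof. by move=> h; apply: cond_pos_sum => i; exact: opnorm_pos. Qed.

Lemma nsum_shift k a : (forall i, bounded_op (a i)) -> nsum k (fun i => a (S i)) <= nsum (S k) a.
Proof.
move=> h; rewrite /nsum (decomp_sum _ (S k)) /=; last lia.
have := opnorm_pos (h O); lra.
Qed.

Lemma nsum_S k a : (forall i, bounded_op (a i)) -> nsum k a <= nsum (S k) a.
Proof. by move=> h; rewrite /nsum /=; have := opnorm_pos (h (S k)); lra. Qed.

Lemma leibniz_bo k (a b : nat -> op H) : (forall i, bounded_op (a i)) -> (forall i, bounded_op (b i)) ->
  bounded_op (leibniz k a b).
Proof.
elim: k a b => [|k IH] a b ba bb /=; first exact: bo_op_comp.
by apply: bo_op_plus; apply: IH.
Qed.

Lemma leibniz_le k (a b : nat -> op H) : (forall i, bounded_op (a i)) -> (forall i, bounded_op (b i)) ->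
  opnorm (leibniz k a b) <= 2 ^ k * (nsum k a * nsum k b).
Proof.
elim: k a b => [|k IH] a b ba bb.
  by rewrite /nsum /= Rmult_1_l; exact: opnorm_comp.
have ba' i := ba (S i); have bb' i := bb (S i).
rewrite [leibniz _ _ _]/=.
apply: Rle_trans (opnorm_plus (leibniz_bo k ba' bb) (leibniz_bo k ba bb')) _.
have h1 := IH _ _ ba' bb; have h2 := IH _ _ ba bb'.
have p : 0 <= 2 ^ k by apply: pow_le; lra.
have m1 : nsum k (fun i => a (S i)) * nsum k b <= nsum (S k) a * nsum (S k) b.
  by apply: Rmult_le_compat; [exact: nsum_pos | exact: nsum_pos | exact: nsum_shift | exact: nsum_S].
have m2 : nsum k a * nsum k (fun i => b (S i)) <= nsum (S k) a * nsum (S k) b.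
  by apply: Rmult_le_compat; [exact: nsum_pos | exact: nsum_pos | exact: nsum_S | exact: nsum_shift].
have -> : 2 ^ S k = 2 * 2 ^ k by [].
nra.
Qed.

End SA.

(** * The common domain of the derivations as a complete algebra *)

Section Delta.
Variables D P : pop H.
Hypotheses (saD : selfadjoint D) (saP : selfadjoint P).

Notation X := (delta_dom D P).
(* [delta^k T] for [j = false] and [delta^k [D, T]] for [j = true], where [P] is |D|. *)
Definition Lam (j : bool) (k : nat) T : op H := iter_comm P k (if j then comm D T else T).
Notation p := (delta_seminorm D P).

(** A candidate for all iterated commutators at once. As [comm] is defined by choice, [Lam] is
    computed by exhibiting such a family and applying [tower_spec]. *)
Definition tower T (f : bool -> nat -> op H) : Prop :=
  bounded_op T /\ f false O = T /\ is_comm D T (f true O) /\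
  forall j k, is_comm P (f j k) (f j (S k)).

Lemma tower_spec T f : tower T f -> X T /\ forall j k, Lam j k T = f j k.
Proof.
move=> [bT [e0 [hD hP]]].
have eD : comm D T = f true O by apply: comm_eq => //; exact: sa_determining.
have bD : bounded_op (f true O) by case: hD.
split.
  split; first by move=> k; rewrite -e0; apply: (dom_iter_comm_of (sa_determining saP) (f := f false)) => //; rewrite e0.
  split; first by exists (f true O).
  by move=> k; rewrite eD; apply: (dom_iter_comm_of (sa_determining saP) (f := f true)).
case=> k; rewrite /Lam.
  by rewrite eD; apply: (iter_comm_eq (sa_determining saP) (f := f true)).
by rewrite -e0; apply: (iter_comm_eq (sa_determining saP) (f := f false)).
Qed.

Lemma delta_dom_tower T : X T -> tower T (fun j k => Lam j k T).
Proof.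
move=> [h1 [h2 h3]]; split; first by case: (h1 O).
split=> //; split; first exact: comm_spec.
case=> k; rewrite /Lam /=; apply: comm_spec.
  by have [_ h] := h3 (S k); apply: h; lia.
by have [_ h] := h1 (S k); apply: h; lia.
Qed.

Lemma delta_dom_bo T : X T -> bounded_op T.
Proof. by case=> h _; case: (h O). Qed.

Lemma Lam_bo T j k : X T -> bounded_op (Lam j k T).
Proof.
move=> hT; have [a [b [c d]]] := delta_dom_tower hT.
case: k => [|k]; last by case: (d j k).
by case: j; [case: c | rewrite b].
Qed.

(** A map on operators that respects both commutator relations carries a tower to a tower. Scalars,
    commuting operators on the left, conjugations and averages are all instances. *)
Lemma delta_dom_map (phi : op H -> op H) T : (forall S, bounded_op S -> bounded_op (phi S)) ->
  (forall S B, bounded_op S -> is_comm D S B -> is_comm D (phi S) (phi B)) ->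
  (forall S B, bounded_op S -> is_comm P S B -> is_comm P (phi S) (phi B)) ->
  X T -> X (phi T) /\ forall j k, Lam j k (phi T) = phi (Lam j k T).
Proof.
move=> hb hD hP hT; have [a [b [c d]]] := delta_dom_tower hT.
apply: (@tower_spec (phi T) (fun j k => phi (Lam j k T))); split; first exact: hb.
split=> //; split; first exact: hD.
by move=> j k; apply: hP => //; exact: Lam_bo.
Qed.

Lemma delta_dom_zero : X (@op_zero H) /\ forall j k, Lam j k (@op_zero H) = @op_zero H.
Proof.
apply: (@tower_spec _ (fun _ _ => @op_zero H)); split; first exact: bo_op_zero.
by split=> //; split; [exact: is_comm_zero | move=> _ _; exact: is_comm_zero].
Qed.

Lemma delta_dom_plus T S : X T -> X S ->
  X (op_plus T S) /\ forall j k, Lam j k (op_plus T S) = op_plus (Lam j k T) (Lam j k S).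
Proof.
move=> hT hS; have [a [b [c d]]] := delta_dom_tower hT; have [a' [b' [c' d']]] := delta_dom_tower hS.
apply: (@tower_spec _ (fun j k => op_plus (Lam j k T) (Lam j k S))).
split; first exact: bo_op_plus.
by split=> //; split; [exact: is_comm_plus | move=> j k; exact: is_comm_plus].
Qed.

Lemma delta_dom_scal c T : X T -> X (op_scal c T) /\ forall j k, Lam j k (op_scal c T) = op_scal c (Lam j k T).
Proof.
apply: (delta_dom_map (phi := op_scal c)); first exact: bo_op_scal.
  by move=> S B _; exact: is_comm_scal.
by move=> S B _; exact: is_comm_scal.
Qed.

Lemma delta_dom_minus T S : X T -> X S ->
  X (op_minus T S) /\ forall j k, Lam j k (op_minus T S) = op_minus (Lam j k T) (Lam j k S).
Proof.
move=> hT hS; have [a b] := delta_dom_scal (RtoC (-1)) hS; have [c d] := delta_dom_plus hT a.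
rewrite op_minus_plus; split=> // j k; by rewrite d b op_minus_plus.
Qed.

Definition leib T S (j : bool) (k : nat) : op H :=
  match j with
  | false => leibniz k (fun i => Lam false i T) (fun i => Lam false i S)
  | true => op_plus (leibniz k (fun i => Lam true i T) (fun i => Lam false i S))
                    (leibniz k (fun i => Lam false i T) (fun i => Lam true i S))
  end.

Lemma tower_comp T S : X T -> X S -> tower (op_comp T S) (leib T S).
Proof.
move=> hT hS; have [a [b [c d]]] := delta_dom_tower hT; have [a' [b' [c' d']]] := delta_dom_tower hS.
have bT j k := Lam_bo j k hT; have bS j k := Lam_bo j k hS.
split; first exact: bo_op_comp.
split=> //; split; first exact: is_comm_comp.
case=> k; last exact: leibniz_is_comm.
by apply: is_comm_plus => //; exact: leibniz_is_comm.
Qed.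

Lemma delta_dom_comp T S : X T -> X S -> X (op_comp T S).
Proof. by move=> hT hS; have [] := tower_spec (tower_comp hT hS). Qed.

Definition psum (k : nat) T : R := nsum k (fun i => Lam false i T) + nsum k (fun i => Lam true i T).

Lemma psum_pos k T : X T -> 0 <= psum k T.
Proof. by move=> h; rewrite /psum; apply: Rplus_le_le_0_compat; apply: nsum_pos => i; exact: Lam_bo. Qed.

Lemma seminorm_comp j k T S : X T -> X S -> p j k (op_comp T S) <= 2 ^ k * (psum k T * psum k S).
Proof.
move=> hT hS; have bT i l := Lam_bo i l hT; have bS i l := Lam_bo i l hS.
have [_ E] := tower_spec (tower_comp hT hS).
rewrite /delta_seminorm -/(Lam j k (op_comp T S)) E /leib.
have q : 0 <= 2 ^ k by apply: pow_le; lra.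
have n1 := nsum_pos k (bT false); have n2 := nsum_pos k (bT true).
have n3 := nsum_pos k (bS false); have n4 := nsum_pos k (bS true).
have l1 := leibniz_le k (bT false) (bS false).
have l2 := leibniz_le k (bT true) (bS false).
have l3 := leibniz_le k (bT false) (bS true).
rewrite /psum; case: j.
  apply: Rle_trans (opnorm_plus (leibniz_bo k (bT true) (bS false)) (leibniz_bo k (bT false) (bS true))) _.
  set u := nsum k (fun i => Lam false i T) in n1 l1 l3 *.
  set v := nsum k (fun i => Lam true i T) in n2 l2 *.
  set w := nsum k (fun i => Lam false i S) in n3 l1 l2 *.
  set x := nsum k (fun i => Lam true i S) in n4 l3 *.
  apply: Rle_trans (Rplus_le_compat _ _ _ _ l2 l3) _.
  have : 0 <= 2 ^ k * (u * w + v * x) by apply: Rmult_le_pos => //; nra.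
  nra.
apply: Rle_trans l1 _; apply: Rmult_le_compat_l => //.
by apply: Rmult_le_compat => //; lra.
Qed.

Lemma delta_dom_left u T : bounded_op u -> commutes u D -> commutes u P -> X T ->
  X (op_comp u T) /\ forall j k, Lam j k (op_comp u T) = op_comp u (Lam j k T).
Proof.
move=> bu cD cP; apply: (delta_dom_map (phi := op_comp u)).
- by move=> S; exact: bo_op_comp.
- by move=> S B _; exact: is_comm_left.
- by move=> S B _; exact: is_comm_left.
Qed.

Lemma delta_dom_conj V t T : ugroup V -> (forall t, commutes (V t) D) -> (forall t, commutes (V t) P) -> X T ->
  X (conj V t T) /\ forall j k, Lam j k (conj V t T) = conj V t (Lam j k T).
Proof.
move=> hV cD cP; apply: (delta_dom_map (phi := conj V t)).
- by move=> S; exact: conj_bo.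
- by move=> S B _; exact: is_comm_conj.
- by move=> S B _; exact: is_comm_conj.
Qed.

Lemma delta_dom_avg V m T : ugroup V -> (forall t, commutes (V t) D) -> (forall t, commutes (V t) P) -> X T ->
  X (avg V m T) /\ forall j k, Lam j k (avg V m T) = avg V m (Lam j k T).
Proof.
move=> hV cD cP; apply: (delta_dom_map (phi := avg V m)).
- by move=> S; exact: avg_bo.
- by move=> S B; exact: avg_is_comm.
- by move=> S B; exact: avg_is_comm.
Qed.

Lemma seminorm_Lam j k T : p j k T = opnorm (Lam j k T).
Proof. by []. Qed.

Lemma seminorm_pos j k T : X T -> 0 <= p j k T.
Proof. by move=> h; apply: opnorm_pos; exact: Lam_bo. Qed.

Lemma seminorm_zero j k : p j k (@op_zero H) = 0.
Proof. by have [_ E] := delta_dom_zero; rewrite seminorm_Lam E opnorm_zero. Qed.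

Lemma seminorm_plus j k T S : X T -> X S -> p j k (op_plus T S) <= p j k T + p j k S.
Proof.
by move=> hT hS; have [_ E] := delta_dom_plus hT hS; rewrite !seminorm_Lam E; apply: opnorm_plus; exact: Lam_bo.
Qed.

Lemma seminorm_scal j k c T : X T -> p j k (op_scal c T) <= Cmod c * p j k T.
Proof.
by move=> hT; have [_ E] := delta_dom_scal c hT; rewrite !seminorm_Lam E; apply: opnorm_scal; exact: Lam_bo.
Qed.

Lemma seminorm_scal_ge j k (z : C) T : X T -> Cmod z * p j k T <= p j k (op_scal z T).
Proof.
move=> hT; have [hz _] := delta_dom_scal z hT.
case: (Req_dec (Cmod z) 0) => [->|z0]; first by rewrite Rmult_0_l; exact: seminorm_pos.
have z1 : 0 < Cmod z by have := Cmod_ge_0 z; case=> // E0; case: z0.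
have z2 : z <> RtoC 0 by move=> E0; apply: z0; rewrite E0 Cmod_0.
apply: (Rmult_le_reg_l (/ Cmod z)); first exact: Rinv_0_lt_compat.
rewrite -Rmult_assoc Rinv_l // Rmult_1_l.
have {1}-> : T = op_scal (Cinv z) (op_scal z T).
  by apply: op_ext => x; rewrite /op_scal cscal_assoc Cinv_l // cscal_real scal_one.
by rewrite -Cmod_inv //; exact: seminorm_scal.
Qed.

Lemma seminorm_minus_sym j k T S : X T -> X S -> p j k (op_minus T S) = p j k (op_minus S T).
Proof.
move=> hT hS; have [_ E] := delta_dom_minus hT hS; have [_ E'] := delta_dom_minus hS hT.
by rewrite !seminorm_Lam E E'; apply: opnorm_minus_sym; exact: Lam_bo.
Qed.

Lemma seminorm_minus_trans j k T S B : X T -> X S -> X B ->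
  p j k (op_minus T B) <= p j k (op_minus T S) + p j k (op_minus S B).
Proof.
move=> hT hS hB; have [_ E] := delta_dom_minus hT hS; have [_ E'] := delta_dom_minus hS hB; have [_ E2] := delta_dom_minus hT hB.
by rewrite !seminorm_Lam E E' E2; apply: opnorm_minus_trans; exact: Lam_bo.
Qed.

Lemma seminorm_le_minus j k T S : X T -> X S -> p j k T <= p j k S + p j k (op_minus T S).
Proof.
move=> hT hS; have [hm _] := delta_dom_minus hT hS.
have {1}-> : T = op_plus S (op_minus T S) by apply: op_ext => x; rewrite /op_plus /op_minus; cvec.
exact: seminorm_plus.
Qed.

Lemma seminorm_small_eq T S : X T -> X S -> (forall eps, 0 < eps -> p false 0 (op_minus T S) <= eps) -> T = S.
Proof. by move=> hT hS h; apply: opnorm_small_eq => //; exact: delta_dom_bo. Qed.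

(** Each [Lam j k] of the sequence converges in operator norm, and closedness of the two derivations
    makes these limits a tower. *)
Lemma delta_dom_complete (T : nat -> op H) : (forall n, X (T n)) ->
  (forall j k eps, 0 < eps -> exists N, forall n m, (N <= n)%nat -> (N <= m)%nat ->
     p j k (op_minus (T n) (T m)) <= eps) ->
  exists S, X S /\ forall j k eps, 0 < eps -> exists N, forall n, (N <= n)%nat ->
     p j k (op_minus (T n) S) <= eps.
Proof.
move=> hT hc.
have lim jk : exists S, bounded_op S /\ forall eps, 0 < eps -> exists N, forall n, (N <= n)%nat ->
     opnorm (op_minus (Lam (fst jk) (snd jk) (T n)) S) <= eps.
  apply: op_cauchy_complete; first by move=> n; exact: Lam_bo.
  move=> eps e0; have [N hN] := hc (fst jk) (snd jk) eps e0; exists N => n m hn hm.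
  by have [_ <-] := delta_dom_minus (hT n) (hT m); exact: hN.
pose f j k := proj1_sig (constructive_indefinite_description _ (lim (j, k))).
have hf j k : bounded_op (f j k) /\ forall eps, 0 < eps -> exists N, forall n, (N <= n)%nat ->
     opnorm (op_minus (Lam j k (T n)) (f j k)) <= eps.
  exact: proj2_sig (constructive_indefinite_description _ (lim (j, k))).
have two j k j' k' eps : 0 < eps -> exists n, opnorm (op_minus (Lam j k (T n)) (f j k)) <= eps /\
    opnorm (op_minus (Lam j' k' (T n)) (f j' k')) <= eps.
  move=> e0; have [N1 h1] := proj2 (hf j k) eps e0; have [N2 h2] := proj2 (hf j' k') eps e0.
  by exists (N1 + N2)%nat; split; [apply: h1 | apply: h2]; lia.
have [hS E] : X (f false O) /\ forall j k, Lam j k (f false O) = f j k.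
  apply: tower_spec; split; first by case: (hf false O).
  split=> //; split.
    apply: is_comm_limit => //; [by case: (hf false O) | by case: (hf true O) |].
    move=> eps /(two false O true O) [n [h1 h2]].
    have [a [b [c d]]] := delta_dom_tower (hT n).
    by exists (T n), (Lam true 0 (T n)).
  move=> j k; apply: is_comm_limit => //; [by case: (hf j k) | by case: (hf j (S k)) |].
  move=> eps /(two j k j (S k)) [n [h1 h2]].
  have [a [b [c d]]] := delta_dom_tower (hT n).
  exists (Lam j k (T n)), (Lam j (S k) (T n)); split; first exact: Lam_bo.
  by split.
exists (f false O); split=> // j k eps e0.
have [N hN] := proj2 (hf j k) eps e0; exists N => n hn.
by rewrite seminorm_Lam; have [_ ->] := delta_dom_minus (hT n) hS; rewrite E; exact: hN.
Qed.

(** Up to a sign, [Lam j k S] is the adjoint of [Lam j k T]: every commutator reverses the sign,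
    which s records and the norm does not see. *)
Lemma radj_X T S : X T -> X S -> radj T S -> forall j k, p j k S <= p j k T.
Proof.
move=> hT hS adj; have [a [b [c d]]] := delta_dom_tower hT; have [a' [b' [c' d']]] := delta_dom_tower hS.
have key j k : exists s : R, (s = 1 \/ s = -1) /\ radj (Lam j k T) (op_scal (RtoC s) (Lam j k S)).
  have sgn s B C Q : selfadjoint Q -> (s = 1 \/ s = -1) -> forall B' C', radj B (op_scal (RtoC s) C) ->
      is_comm Q B B' -> is_comm Q C C' ->
      exists s : R, (s = 1 \/ s = -1) /\ radj B' (op_scal (RtoC s) C').
    move=> saQ hs B' C' hadj hB hC; exists (- s); split; first by case: hs => ->; [right | left]; ring.
    have := radj_comm saQ hadj hB (is_comm_scal saQ (RtoC s) hC).
    have -> // : op_scal (RtoC (-1)) (op_scal (RtoC s) C') = op_scal (RtoC (- s)) C'.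
    apply: op_ext => x; rewrite /op_scal cscal_assoc; congr cscal.
    by apply: injective_projections => /=; ring.
  have adj1 : radj T (op_scal (RtoC 1) S).
    by move=> x y; rewrite /op_scal cscal_real scal_one.
  elim: k => [|k [s [hs IH]]]; last exact: sgn hs _ _ IH (d j k) (d' j k).
  case: j; last by exists 1; split; [left | ].
  by apply: sgn adj1 c c'; [exact: saD | left].
move=> j k; have [s [hs h]] := key j k; rewrite !seminorm_Lam.
have bT := Lam_bo j k hT; have bS := Lam_bo j k hS.
apply: Rle_trans (_ : opnorm (op_scal (RtoC s) (Lam j k S)) <= _); last first.
  by apply: radj_opnorm => //; exact: bo_op_scal.
have {1}-> : Lam j k S = op_scal (RtoC s) (op_scal (RtoC s) (Lam j k S)).
  apply: op_ext => x; rewrite /op_scal !cscal_real scal_assoc /mult /=.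
  have -> : s * s = 1 by case: hs => ->; ring.
  by rewrite scal_one.
apply: Rle_trans (opnorm_scal _ (bo_op_scal (RtoC s) bS)) _.
have -> : Cmod (RtoC s) = 1.
  by rewrite Cmod_R; case: hs => ->; [exact: Rabs_R1 | rewrite Rabs_left; lra].
lra.
Qed.

End Delta.
End Commutators.

(** * Homogeneous components under the torus action *)

Definition pairchar (d : Z * Z) (s t : R) : C := cis (2 * PI * (IZR (fst d) * s + IZR (snd d) * t)).

Lemma pairchar_split d s t : pairchar d s t = Cmult (pchar (fst d) s) (pchar (snd d) t).
Proof. by rewrite /pairchar /pchar -cis_plus; f_equal; ring. Qed.

Lemma Cmod_pairchar d s t : Cmod (pairchar d s t) = 1.
Proof. exact: Cmod_cis. Qed.

Definition dadd (d e : Z * Z) : Z * Z := (fst d + fst e, snd d + snd e)%Z.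
Definition dopp (d : Z * Z) : Z * Z := (- fst d, - snd d)%Z.

Lemma pairchar_dadd d e s t : pairchar (dadd d e) s t = Cmult (pairchar d s t) (pairchar e s t).
Proof. by rewrite /pairchar -cis_plus /= !plus_IZR; f_equal; ring. Qed.

Lemma pairchar_add d s t s' t' : pairchar d (s + s') (t + t') = Cmult (pairchar d s t) (pairchar d s' t').
Proof. by rewrite /pairchar -cis_plus; f_equal; ring. Qed.

Section Torus.
Context {H : Hilbert}.
Variable U : R -> R -> op H.
Hypothesis HU : torus_unitary_rep U.
Implicit Types (T S B : op H) (x y z : H) (d e : Z * Z) (P : pop H).

Definition V1 (s : R) : op H := U s 0.
Definition V2 (t : R) : op H := U 0 t.

Lemma U_bo s t : bounded_op (U s t).
Proof. by case: HU. Qed.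

Lemma U_rin s t x y : rin (U s t x) (U s t y) = rin x y.
Proof. by case: HU => _ [h _]; rewrite /rin h. Qed.

Lemma U_add s t s' t' x : U (s + s') (t + t') x = U s t (U s' t' x).
Proof. by case: HU => _ [_ [_ [h _]]]. Qed.

Lemma U_0 x : U 0 0 x = x.
Proof. by case: HU => _ [_ [h _]]. Qed.

Lemma U_inv_r s t x : U s t (U (- s) (- t) x) = x.
Proof. by rewrite -U_add !Rplus_opp_r U_0. Qed.

Lemma U_inv_l s t x : U (- s) (- t) (U s t x) = x.
Proof. by rewrite -U_add !Rplus_opp_l U_0. Qed.

Lemma U_norm s t x : norm (U s t x) = norm x.
Proof. by apply: norm_sq_eq; rewrite U_rin. Qed.

Lemma U_split s t x : U s t x = V1 s (V2 t x).
Proof. by rewrite /V1 /V2 -U_add Rplus_0_r Rplus_0_l. Qed.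

Lemma U_split' s t x : U s t x = V2 t (V1 s x).
Proof. by rewrite /V1 /V2 -U_add Rplus_0_r Rplus_0_l. Qed.

Lemma V12 s t x : V1 s (V2 t x) = V2 t (V1 s x).
Proof. by rewrite -U_split U_split'. Qed.

Lemma ugroup_V1 : ugroup V1.
Proof.
case: HU => hb [hi [h0 [ha [h1 [h2 hc]]]]]; split.
- by move=> t; exact: hb.
- by move=> t x y; exact: U_rin.
- by move=> x; exact: h0.
- by move=> s t x; rewrite /V1 -ha Rplus_0_r.
- exact: h1.
- move=> x t; apply: (continuous_comp (fun t => (t, 0)) (fun q : R * R => U (fst q) (snd q) x)); last exact: hc.
  apply: (continuous_comp_2 (fun t => t) (fun _ => 0) (fun a b : R => (a, b))).
  + exact: continuous_id.
  + exact: continuous_const.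
  + by apply: (continuous_ext (fun q => q)); [case | exact: continuous_id].
Qed.

Lemma ugroup_V2 : ugroup V2.
Proof.
case: HU => hb [hi [h0 [ha [h1 [h2 hc]]]]]; split.
- by move=> t; exact: hb.
- by move=> t x y; exact: U_rin.
- by move=> x; exact: h0.
- by move=> s t x; rewrite /V2 -ha Rplus_0_r.
- exact: h2.
- move=> x t; apply: (continuous_comp (fun t => (0, t)) (fun q : R * R => U (fst q) (snd q) x)); last exact: hc.
  apply: (continuous_comp_2 (fun _ => 0) (fun t => t) (fun a b : R => (a, b))).
  + exact: continuous_const.
  + exact: continuous_id.
  + by apply: (continuous_ext (fun q => q)); [case | exact: continuous_id].
Qed.

Lemma Ad_conj s t T : Ad U s t T = conj V1 s (conj V2 t T).
Proof. by apply: op_ext => x; rewrite /Ad /conj U_split U_split'. Qed.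

Lemma Ad_bo s t T : bounded_op T -> bounded_op (Ad U s t T).
Proof.
by move=> bT; rewrite Ad_conj; apply: conj_bo; [exact: ugroup_V1 | apply: conj_bo => //; exact: ugroup_V2].
Qed.

Lemma Ad_op_plus s t T S : Ad U s t (op_plus T S) = op_plus (Ad U s t T) (Ad U s t S).
Proof. by apply: op_ext => x; rewrite /Ad /op_plus (bo_plus (U_bo s t)). Qed.

Lemma Ad_op_scal s t c T : Ad U s t (op_scal c T) = op_scal c (Ad U s t T).
Proof. by apply: op_ext => x; rewrite /Ad /op_scal (bo_cscal (U_bo s t)). Qed.

Lemma Ad_op_minus s t T S : Ad U s t (op_minus T S) = op_minus (Ad U s t T) (Ad U s t S).
Proof. by apply: op_ext => x; rewrite /Ad /op_minus (bo_minus (U_bo s t)). Qed.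

Lemma Ad_op_comp s t T S : Ad U s t (op_comp T S) = op_comp (Ad U s t T) (Ad U s t S).
Proof. by apply: op_ext => x; rewrite /Ad /op_comp U_inv_l. Qed.

Lemma Ad_add s t s' t' T : Ad U (s + s') (t + t') T = Ad U s t (Ad U s' t' T).
Proof.
apply: op_ext => x; rewrite /Ad U_add; do 3 f_equal.
by rewrite -U_add; f_equal; ring.
Qed.

Lemma Ad_0 T : Ad U 0 0 T = T.
Proof. by apply: op_ext => x; rewrite /Ad Ropp_0 !U_0. Qed.

Definition homog d T : Prop := forall s t, Ad U s t T = op_scal (pairchar d s t) T.

Lemma homog_plus d T S : homog d T -> homog d S -> homog d (op_plus T S).
Proof.
move=> hT hS s t; rewrite Ad_op_plus hT hS; apply: op_ext => x; rewrite /op_plus /op_scal; cvec.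
Qed.

Lemma homog_scal d c T : homog d T -> homog d (op_scal c T).
Proof. by move=> hT s t; rewrite Ad_op_scal hT; apply: op_ext => x; rewrite /op_scal; cvec. Qed.

Lemma homog_zero d : homog d (@op_zero H).
Proof.
move=> s t; apply: op_ext => x; rewrite /Ad /op_scal /op_zero (bo_zero (U_bo s t)); cvec.
Qed.

Lemma homog_op_comp d e T S : bounded_op T -> homog d T -> homog e S -> homog (dadd d e) (op_comp T S).
Proof.
move=> bT hT hS s t; rewrite Ad_op_comp hT hS pairchar_dadd; apply: op_ext => x.
by rewrite /op_comp /op_scal (bo_cscal bT); cvec.
Qed.

Lemma homog_U d s t T : homog d T -> forall x, U s t (T x) = cscal (pairchar d s t) (T (U s t x)).
Proof.
move=> hT x; have := f_equal (fun F : op H => F (U s t x)) (hT s t).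
by rewrite /Ad /op_scal U_inv_l.
Qed.

Lemma homog_left_U d s t T : homog d T -> homog d (op_comp (U s t) T).
Proof.
move=> hT s' t'; apply: op_ext => x; rewrite /Ad /op_comp /op_scal.
have := f_equal (fun F : op H => F x) (hT s' t'); rewrite /Ad /op_scal => E.
by rewrite -U_add Rplus_comm (Rplus_comm t') U_add E (bo_cscal (U_bo s t)).
Qed.

(** The torus integral of [spectral_component] as two averages in one variable each, so that the
    lemmas on a single circle apply twice. *)
Definition hcomp d T : op H := avg V1 (fst d) (avg V2 (snd d) T).

Lemma spectral_component_hcomp m n T : bounded_op T -> spectral_component U m n T = hcomp (m, n) T.
Proof.
move=> bT; apply: op_ext => x; rewrite /spectral_component /hcomp /avg /fcoef /=.
apply: RInt_ext => s _.
rewrite /conj -(RInt_bo _ _ (ug_bo ugroup_V1 s)); last exact: (@ct_avg H V2 ugroup_V2 n T (V1 (- s) x) bT).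
rewrite -(RInt_bo _ _ (bo_cscal_op _)); last first.
  by apply: ct_bo; [exact: (ug_bo ugroup_V1) | exact: (@ct_avg H V2 ugroup_V2 n T (V1 (- s) x) bT)].
apply: RInt_ext => t _.
rewrite (bo_cscal (ug_bo ugroup_V1 s)) cscal_assoc /Ad U_split U_split'.
congr cscal; rewrite /fchar -cis_plus; f_equal; ring.
Qed.

Lemma hcomp_bo d T : bounded_op T -> bounded_op (hcomp d T).
Proof. by move=> bT; apply: avg_bo; [exact: ugroup_V1 | apply: avg_bo => //; exact: ugroup_V2]. Qed.

Lemma hcomp_le d T : bounded_op T -> opnorm (hcomp d T) <= opnorm T.
Proof.
move=> bT; apply: Rle_trans (avg_le ugroup_V1 _ (avg_bo ugroup_V2 _ bT)) _.
by apply: (avg_le ugroup_V2).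
Qed.

Lemma hcomp_op_plus d T S : bounded_op T -> bounded_op S ->
  hcomp d (op_plus T S) = op_plus (hcomp d T) (hcomp d S).
Proof.
move=> bT bS; rewrite /hcomp (avg_op_plus ugroup_V2) // (avg_op_plus ugroup_V1) //.
  exact: (avg_bo ugroup_V2 _ bT).
exact: (avg_bo ugroup_V2 _ bS).
Qed.

Lemma hcomp_op_scal d c T : bounded_op T -> hcomp d (op_scal c T) = op_scal c (hcomp d T).
Proof.
move=> bT; rewrite /hcomp (avg_op_scal ugroup_V2) // (avg_op_scal ugroup_V1) //.
exact: (avg_bo ugroup_V2 _ bT).
Qed.

Lemma hcomp_op_minus d T S : bounded_op T -> bounded_op S ->
  hcomp d (op_minus T S) = op_minus (hcomp d T) (hcomp d S).
Proof.
by move=> bT bS; rewrite !op_minus_plus hcomp_op_plus ?hcomp_op_scal //; exact: bo_op_scal.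
Qed.

Lemma conj2_avg1 m t T : bounded_op T -> conj V2 t (avg V1 m T) = avg V1 m (conj V2 t T).
Proof.
move=> bT; rewrite /conj (avg_equiv ugroup_V1 m (ug_bo ugroup_V2 t) (ug_bo ugroup_V2 (- t))) //.
  by move=> s x; rewrite V12.
by move=> s x; rewrite V12.
Qed.

Lemma conj1_avg2 m t T : bounded_op T -> conj V1 t (avg V2 m T) = avg V2 m (conj V1 t T).
Proof.
move=> bT; rewrite /conj (avg_equiv ugroup_V2 m (ug_bo ugroup_V1 t) (ug_bo ugroup_V1 (- t))) //.
  by move=> s x; rewrite V12.
by move=> s x; rewrite V12.
Qed.

Lemma hcomp_homog d T : bounded_op T -> homog d (hcomp d T).
Proof.
move=> bT s t; have b2 := avg_bo ugroup_V2 (snd d) bT.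
rewrite Ad_conj /hcomp conj2_avg1 // (conj_avg ugroup_V2) // (avg_op_scal ugroup_V1) //.
rewrite (conj_op_scal ugroup_V1) (conj_avg ugroup_V1) // pairchar_split.
by apply: op_ext => x; rewrite /op_scal cscal_assoc Cmult_comm.
Qed.

Lemma hcomp_Ad d s t T : bounded_op T -> hcomp d (Ad U s t T) = op_scal (pairchar d s t) (hcomp d T).
Proof.
move=> bT; have b2 := avg_bo ugroup_V2 (snd d) bT.
have c2 := conj_bo ugroup_V2 t bT.
rewrite Ad_conj /hcomp -conj1_avg2 // (avg_conj ugroup_V1) //; last exact: (avg_bo ugroup_V2 _ c2).
rewrite (avg_conj ugroup_V2) // (avg_op_scal ugroup_V1) // pairchar_split.
by apply: op_ext => x; rewrite /op_scal cscal_assoc.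
Qed.

Lemma homog_V1 d T : homog d T -> forall s, conj V1 s T = op_scal (pchar (fst d) s) T.
Proof.
move=> hT s; have := hT s 0; rewrite Ad_conj (conj_0 ugroup_V2) pairchar_split => ->.
by rewrite {2}/pchar !Rmult_0_r cis_0 Cmult_1_r.
Qed.

Lemma homog_V2 d T : homog d T -> forall t, conj V2 t T = op_scal (pchar (snd d) t) T.
Proof.
move=> hT t; have := hT 0 t; rewrite Ad_conj (conj_0 ugroup_V1) pairchar_split => ->.
by rewrite {1}/pchar !Rmult_0_r cis_0 Cmult_1_l.
Qed.

Lemma hcomp_of_homog d T : bounded_op T -> homog d T -> hcomp d T = T.
Proof.
move=> bT hT; rewrite /hcomp (avg_homog bT (homog_V2 hT)).
exact: (avg_homog bT (homog_V1 hT)).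
Qed.

Lemma avg_zero V m : ugroup V -> avg V m (@op_zero H) = @op_zero H.
Proof.
move=> hV.
have E : @op_zero H = op_scal (RtoC 0) (@op_zero H) by apply: op_ext => x; rewrite /op_scal /op_zero; cvec.
rewrite {1}E (avg_op_scal hV); last exact: bo_op_zero.
by apply: op_ext => x; rewrite /op_scal /op_zero; cvec.
Qed.

Lemma hcomp_of_homog_ne d e T : d <> e -> bounded_op T -> homog e T -> hcomp d T = @op_zero H.
Proof.
move=> ne bT hT; rewrite /hcomp.
case: (Z.eq_dec (snd d) (snd e)) => h2.
  rewrite h2 (avg_homog bT (homog_V2 hT)).
  have h1 : fst d <> fst e by move=> h1; apply: ne; rewrite (surjective_pairing d) (surjective_pairing e) h1 h2.
  exact: (avg_homog_ne ugroup_V1 h1 bT (homog_V1 hT)).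
by rewrite (avg_homog_ne ugroup_V2 h2 bT (homog_V2 hT)) (avg_zero _ ugroup_V1).
Qed.

(** Uniqueness of Fourier coefficients on one circle, used for the second circle and then for the
    first. *)
Lemma hcomp_unique T S : bounded_op T -> bounded_op S -> (forall d, hcomp d T = hcomp d S) -> T = S.
Proof.
move=> bT bS h; have bm := bo_op_minus bT bS.
have E : op_minus T S = @op_zero H.
  apply: (avg_unique ugroup_V2 bm) => n; apply: (avg_unique ugroup_V1); first exact: (avg_bo ugroup_V2 _ bm).
  move=> m; rewrite -[avg V1 m _]/(hcomp (m, n) (op_minus T S)) hcomp_op_minus // h.
  by apply: op_ext => x; rewrite /op_minus /op_zero; cvec.
apply: op_ext => x; have := f_equal (fun F : op H => F x) E; rewrite /op_minus /op_zero => E'.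
by apply: norm_zero_eq; rewrite E' norm_zero.
Qed.

(** Projecting along the first circle and then along the second gives joint eigenvectors, since the
    circles commute; density of the projections is used once for each. *)
Lemma spectral_subspaces_total T : bounded_op T ->
  (forall m n x, spectral_subspace U m n x -> T x = zero) -> T = @op_zero H.
Proof.
move=> bT h; apply: op_ext => x; rewrite /op_zero.
apply: (vanish_of_proj ugroup_V1 bT) => m; apply: (vanish_of_proj ugroup_V2 bT) => n.
apply: (h m n) => s t; set y := proj V1 m x.
rewrite U_split' (proj_bo ugroup_V2 n y (ug_bo ugroup_V1 s)); last by move=> r w; rewrite V12.
rewrite /y (V_proj ugroup_V1) -/y -(proj_bo ugroup_V2 n y (bo_cscal_op _)); last first.
  by move=> r w; rewrite (bo_cscal (ug_bo ugroup_V2 r)).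
rewrite (bo_cscal (ug_bo ugroup_V2 t)) (V_proj ugroup_V2) cscal_assoc /pchar -cis_plus.
by congr cscal; f_equal; ring.
Qed.

Variable theta : R.

(* The unitary [U_tau] with [T^(theta) = U_tau T] for [T] homogeneous of degree [d]. *)
Definition twistU d : op H := U (- (theta * IZR (snd d) / 2)) (theta * IZR (fst d) / 2).

(** The parameter of [twistU] is orthogonal to (m,n), so this unitary passes through T without a
    phase, and on the subspace of degree (m',n') it is the prescribed scalar. Totality of the
    spectral subspaces makes the chosen twist unique. *)
Lemma twist_homog m n T : bounded_op T -> homog (m, n) T ->
  twist U theta m n T = op_comp (twistU (m, n)) T.
Proof.
move=> bT hT.
have ok : is_twist U theta m n T (op_comp (twistU (m, n)) T).
  split; first by apply: bo_op_comp => //; exact: U_bo.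
  move=> m' n' x hx; rewrite /op_comp /twistU (homog_U _ _ hT) hx (bo_cscal bT) cscal_assoc.
  by congr cscal; rewrite /pairchar -cis_plus /=; f_equal; field.
have [bS hS] : is_twist U theta m n T (twist U theta m n T).
  by apply: epsilon_spec; exists (op_comp (twistU (m, n)) T).
case: ok => bS' hS'.
have E : op_minus (twist U theta m n T) (op_comp (twistU (m, n)) T) = @op_zero H.
  apply: spectral_subspaces_total; first exact: bo_op_minus.
  by move=> m' n' x hx; rewrite /op_minus (hS _ _ _ hx) (hS' _ _ _ hx); cvec.
apply: op_ext => x; have := f_equal (fun F : op H => F x) E; rewrite /op_minus /op_zero => E'.
by apply: norm_zero_eq; rewrite E' norm_zero.
Qed.

Section DeltaTorus.
Variables D P : pop H.
Hypotheses (saD : selfadjoint D) (saP : selfadjoint P).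
Hypotheses (UD : forall s t, commutes (U s t) D) (UP : forall s t, commutes (U s t) P).
Notation X := (delta_dom D P).
Notation p := (delta_seminorm D P).

Lemma delta_dom_Ad s t T : X T -> X (Ad U s t T) /\ forall j k, Lam D P j k (Ad U s t T) = Ad U s t (Lam D P j k T).
Proof.
move=> hT; rewrite Ad_conj.
have [a ea] := delta_dom_conj saD saP t ugroup_V2 (fun t => @UD 0 t) (fun t => @UP 0 t) hT.
have [b eb] := delta_dom_conj saD saP s ugroup_V1 (fun t => @UD t 0) (fun t => @UP t 0) a.
by split=> // j k; rewrite eb ea Ad_conj.
Qed.

Lemma Ad_opnorm s t T : bounded_op T -> opnorm (Ad U s t T) <= opnorm T.
Proof.
move=> bT; rewrite Ad_conj; apply: Rle_trans (conj_le ugroup_V1 _ (conj_bo ugroup_V2 _ bT)) _.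
by apply: (conj_le ugroup_V2).
Qed.

Lemma seminorm_Ad j k s t T : X T -> p j k (Ad U s t T) <= p j k T.
Proof.
by move=> hT; have [_ E] := delta_dom_Ad s t hT; rewrite !seminorm_Lam E; apply: Ad_opnorm; exact: Lam_bo.
Qed.

Lemma delta_dom_comp2 d T : X T -> X (hcomp d T) /\ forall j k, Lam D P j k (hcomp d T) = hcomp d (Lam D P j k T).
Proof.
move=> hT.
have [a ea] := delta_dom_avg saD saP (snd d) ugroup_V2 (fun t => @UD 0 t) (fun t => @UP 0 t) hT.
have [b eb] := delta_dom_avg saD saP (fst d) ugroup_V1 (fun t => @UD t 0) (fun t => @UP t 0) a.
by split=> // j k; rewrite eb ea.
Qed.

Lemma seminorm_comp2 j k d T : X T -> p j k (hcomp d T) <= p j k T.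
Proof.
by move=> hT; have [_ E] := delta_dom_comp2 d hT; rewrite !seminorm_Lam E; apply: hcomp_le; exact: Lam_bo.
Qed.

Lemma delta_dom_leftU s t T : X T -> X (op_comp (U s t) T) /\ forall j k, p j k (op_comp (U s t) T) <= p j k T.
Proof.
move=> hT; have [a E] := delta_dom_left saD saP (U_bo s t) (@UD s t) (@UP s t) hT; split=> // j k.
rewrite !seminorm_Lam E; have bL := Lam_bo j k hT.
apply: opnorm_le; first exact: opnorm_pos.
by move=> x; rewrite /op_comp U_norm; exact: opnorm_bnd.
Qed.

End DeltaTorus.
End Torus.

(** * Unordered sums *)

Section FiniteSums.
Variable I : Type.
Implicit Types (f g : I -> R) (L : list I).

Definition rsum f L : R := fold_right (fun i r => f i + r) 0 L.

(** Meant for nonnegative f, where bounded finite sums amount to unordered convergence;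
    duplicate-free lists replace finite sets, so no enumeration of the index type is needed. *)
Definition summable f : Prop := exists M, forall L, NoDup L -> rsum f L <= M.

Lemma rsum_app f L L' : rsum f (L ++ L') = rsum f L + rsum f L'.
Proof. by elim: L => [|a L IH] /=; [ring | rewrite IH; ring]. Qed.

Lemma rsum_perm f L L' : Permutation L L' -> rsum f L = rsum f L'.
Proof. by elim=> //= [x l l' _ -> // | x y l | l l' l'' _ -> _ ->] //; ring. Qed.

Lemma rsum_nonneg f L : (forall i, 0 <= f i) -> 0 <= rsum f L.
Proof. by move=> h; elim: L => [|a L IH] /=; [lra | have := h a; lra]. Qed.

Lemma rsum_le f g L : (forall i, f i <= g i) -> rsum f L <= rsum g L.
Proof. by move=> h; elim: L => [|a L IH] /=; [lra | have := h a; lra]. Qed.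

Lemma rsum_plus f g L : rsum (fun i => f i + g i) L = rsum f L + rsum g L.
Proof. by elim: L => [|a L IH] /=; [ring | rewrite IH; ring]. Qed.

Lemma rsum_scal k f L : rsum (fun i => k * f i) L = k * rsum f L.
Proof. by elim: L => [|a L IH] /=; [ring | rewrite IH; ring]. Qed.

Lemma summable_le f g : summable g -> (forall i, f i <= g i) -> summable f.
Proof. by move=> [M h] le; exists M => L nd; apply: Rle_trans (rsum_le L le) (h L nd). Qed.

Lemma summable_plus f g : summable f -> summable g -> summable (fun i => f i + g i).
Proof.
move=> [M h] [M' h']; exists (M + M') => L nd; rewrite rsum_plus.
by apply: Rplus_le_compat; [exact: h | exact: h'].
Qed.

Lemma summable_scal k f : 0 <= k -> summable f -> summable (fun i => k * f i).
Proof.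
move=> k0 [M h]; exists (k * M) => L nd; rewrite rsum_scal.
by apply: Rmult_le_compat_l => //; exact: h.
Qed.

Lemma eq_dec_classic (x y : I) : {x = y} + {x <> y}.
Proof. exact: excluded_middle_informative. Qed.

Lemma list_union L L' : exists L2, NoDup L2 /\ incl L L2 /\ incl L' L2.
Proof.
exists (nodup eq_dec_classic (L ++ L')); split; first exact: NoDup_nodup.
by split=> x hx; apply/nodup_In; apply: in_or_app; [left | right].
Qed.

Lemma list_split L0 L : NoDup L0 -> NoDup L -> incl L0 L ->
  exists L', NoDup L' /\ (forall i, In i L' -> ~ In i L0) /\ Permutation L (L0 ++ L').
Proof.
move=> n0 n h.
pose q i := match in_dec eq_dec_classic i L0 with left _ => false | right _ => true end.
exists (filter q L).
have F i : In i (filter q L) <-> In i L /\ ~ In i L0.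
  by rewrite filter_In /q; case: in_dec => hi; split; case.
split; first exact: NoDup_filter.
split; first by move=> i /F [].
apply: NoDup_Permutation => //.
  apply: NoDup_app => //; first exact: NoDup_filter.
  by move=> a h1 /F [].
move=> i; rewrite in_app_iff F; split.
  by case: (in_dec eq_dec_classic i L0); [left | right].
by case=> [/h|[]].
Qed.

(** [L0] comes within eps of the supremum of all finite sums, so a disjoint list can add at most
    eps. *)
Lemma summable_tail f eps : (forall i, 0 <= f i) -> summable f -> 0 < eps ->
  exists L0, NoDup L0 /\ forall L, NoDup L -> (forall i, In i L -> ~ In i L0) -> rsum f L <= eps.
Proof.
move=> f0 [M hM] e0.
pose E r := exists L, NoDup L /\ r = rsum f L.
have [m [ub lb]] : {m : R | is_lub E m}.
  apply: completeness; first by exists M => r [L [nd ->]]; exact: hM.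
  by exists 0, nil; split=> //; exact: NoDup_nil.
have [L0 [nd h0]] : exists L0, NoDup L0 /\ m - eps < rsum f L0.
  apply: NNPP => no.
  have : m <= m - eps.
    apply: lb => r [L [nd ->]].
    case: (Rle_lt_dec (rsum f L) (m - eps)) => // lt.
    by case: no; exists L.
  lra.
exists L0; split=> // L ndL dj.
have : rsum f (L0 ++ L) <= m.
  apply: ub; exists (L0 ++ L); split=> //.
  by apply: NoDup_app => // a h1 h2; exact: (dj a h2 h1).
rewrite rsum_app; lra.
Qed.

End FiniteSums.

(** * Sums of operators that converge for all the seminorms *)

Section OperatorSums.
Context {H : Hilbert}.
Implicit Types (T S : op H).

Definition fsum (I : Type) (c : I -> op H) (L : list I) : op H :=
  fold_right (fun i S => op_plus (c i) S) (@op_zero H) L.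

Lemma op_plusA T S S' : op_plus T (op_plus S S') = op_plus (op_plus T S) S'.
Proof. by apply: op_ext => x; rewrite /op_plus plus_assoc. Qed.

Lemma op_plusC T S : op_plus T S = op_plus S T.
Proof. by apply: op_ext => x; rewrite /op_plus plus_comm. Qed.

Lemma fsum_app I (c : I -> op H) L L' : fsum c (L ++ L') = op_plus (fsum c L) (fsum c L').
Proof.
elim: L => [|a L IH] /=; last by rewrite IH op_plusA.
by rewrite op_plusC op_zero_plus_r.
Qed.

Lemma fsum_perm I (c : I -> op H) L L' : Permutation L L' -> fsum c L = fsum c L'.
Proof.
elim=> //= [x l l' _ -> // | x y l | l l' l'' _ -> _ ->] //.
by rewrite !op_plusA (op_plusC (c x)).
Qed.

Lemma fsum_bo I (c : I -> op H) L : (forall i, bounded_op (c i)) -> bounded_op (fsum c L).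
Proof. by move=> h; elim: L => [|a L IH]; [exact: bo_op_zero | exact: bo_op_plus]. Qed.

Lemma fsum_ind I (c : I -> op H) L (Q : op H -> Prop) : Q (@op_zero H) ->
  (forall T S, Q T -> Q S -> Q (op_plus T S)) -> (forall i, Q (c i)) -> Q (fsum c L).
Proof. by move=> q0 qp qc; elim: L => //= a L IH; apply: qp. Qed.

Variables D P : pop H.
Hypotheses (saD : selfadjoint D) (saP : selfadjoint P).
Notation X := (delta_dom D P).
Notation p := (delta_seminorm D P).

Let X0 : X (@op_zero H) := proj1 (delta_dom_zero saD saP).
Let Xp T S (hT : X T) (hS : X S) : X (op_plus T S) := proj1 (delta_dom_plus saD saP hT hS).
Let Xs z T (hT : X T) : X (op_scal z T) := proj1 (delta_dom_scal saD saP z hT).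
Let Xm T S (hT : X T) (hS : X S) : X (op_minus T S) := proj1 (delta_dom_minus saD saP hT hS).

Section OneFamily.
Variable I : Type.
Implicit Types (c : I -> op H) (L : list I).

Lemma delta_dom_fsum c L : (forall i, X (c i)) -> X (fsum c L).
Proof. by move=> h; apply: fsum_ind. Qed.

Lemma seminorm_fsum j k c L : (forall i, X (c i)) -> p j k (fsum c L) <= rsum (fun i => p j k (c i)) L.
Proof.
move=> h; elim: L => [|a L IH] /=; first by rewrite (seminorm_zero saD saP); lra.
apply: Rle_trans (seminorm_plus saD saP j k (h a) (delta_dom_fsum L h)) _; lra.
Qed.

(* Limits along finite subsets, as in [is_deform]. *)
Definition is_sum c S : Prop := forall j k eps, 0 < eps ->
  exists L0, forall L, NoDup L -> incl L0 L -> p j k (op_minus S (fsum c L)) <= eps.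

Definition psummable c : Prop := (forall i, X (c i)) /\ forall j k, summable (fun i => p j k (c i)).

Lemma fsum_close j k c L0 L eps : (forall i, X (c i)) -> NoDup L0 -> NoDup L -> incl L0 L ->
  (forall L', NoDup L' -> (forall i, In i L' -> ~ In i L0) -> rsum (fun i => p j k (c i)) L' <= eps) ->
  p j k (op_minus (fsum c L) (fsum c L0)) <= eps.
Proof.
move=> hc n0 n hi ht; have [L' [n' [dj pm]]] := list_split n0 n hi.
have -> : op_minus (fsum c L) (fsum c L0) = fsum c L'.
  rewrite (fsum_perm c pm) fsum_app; apply: op_ext => x; rewrite /op_minus /op_plus; cvec.
by apply: Rle_trans (seminorm_fsum j k L' hc) (ht L' n' dj).
Qed.

(** One sequence of finite sets has to serve infinitely many seminorms: [g n] adds up those of order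
    at most n, and [Ln n] leaves a tail of [g n] below 1/(n+1). The sets are not nested, so two
    partial sums are compared through their union. *)
Lemma sum_exists c : psummable c -> exists S, X S /\ is_sum c S.
Proof.
move=> [hc hs].
have pos j k i : 0 <= p j k (c i) by exact: seminorm_pos.
pose g n i := sum_f_R0 (fun k => p false k (c i) + p true k (c i)) n.
have g0 n i : 0 <= g n i.
  by apply: cond_pos_sum => k; have := pos false k i; have := pos true k i; lra.
have gs n : summable (g n).
  elim: n => [|n IH] /=; first exact: summable_plus.
  by apply: summable_plus => //; exact: summable_plus.
have gl n k j i : (k <= n)%nat -> p j k (c i) <= g n i.
  move=> kn; apply: Rle_trans (_ : g k i <= _).
    case: k {kn} => [|k] /=.
      by rewrite /g /=; have := pos false 0%nat i; have := pos true 0%nat i; case: j; lra.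
    have -> : g (S k) i = g k i + (p false (S k) (c i) + p true (S k) (c i)) by [].
    by have := g0 k i; have := pos false (S k) i; have := pos true (S k) i; case: j; lra.
  elim: n kn => [|n IH] kn.
    have -> : k = 0%nat by lia.
    lra.
  case: (Nat.eq_dec k (S n)) => [->|ne]; first lra.
  apply: Rle_trans (IH ltac:(lia)) _.
  have -> : g (S n) i = g n i + (p false (S n) (c i) + p true (S n) (c i)) by [].
  by have := pos false (S n) i; have := pos true (S n) i; lra.
have en n : 0 < / INR (S n) by apply: Rinv_0_lt_compat; apply: lt_0_INR; lia.
have tl n : exists L0, NoDup L0 /\ forall L, NoDup L -> (forall i, In i L -> ~ In i L0) -> rsum (g n) L <= / INR (S n).
  by apply: summable_tail.
pose Ln n := proj1_sig (constructive_indefinite_description _ (tl n)).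
have hL n : NoDup (Ln n) /\ forall L, NoDup L -> (forall i, In i L -> ~ In i (Ln n)) -> rsum (g n) L <= / INR (S n).
  exact: proj2_sig (constructive_indefinite_description _ (tl n)).
have close n j k L : (k <= n)%nat -> NoDup L -> incl (Ln n) L ->
   p j k (op_minus (fsum c L) (fsum c (Ln n))) <= / INR (S n).
  move=> kn nd hi; have [n0 ht] := hL n; apply: fsum_close => // L' nd' dj.
  by apply: Rle_trans (ht L' nd' dj); apply: rsum_le => i; exact: gl.
have small eps : 0 < eps -> exists N, forall n, (N <= n)%nat -> / INR (S n) <= eps.
  move=> e0; have [N [hN N0]] := archimed_cor1 eps e0; exists N => n hn.
  apply: Rle_trans (Rlt_le _ _ hN); apply: Rinv_le_contravar; first by apply: lt_0_INR.
  by apply: le_INR; lia.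
have XF L : X (fsum c L) by exact: delta_dom_fsum.
have [S [hS hlim]] : exists S, X S /\ forall j k eps, 0 < eps -> exists N, forall n, (N <= n)%nat ->
     p j k (op_minus (fsum c (Ln n)) S) <= eps.
  apply: (delta_dom_complete saD saP (T := fun n => fsum c (Ln n))) => // j k eps e0.
  have [N hN] := small (eps / 2) ltac:(lra).
  exists (N + k)%nat => n m hn hm.
  have [L [nd [i1 i2]]] := list_union (Ln n) (Ln m).
  have a := close n j k L ltac:(lia) nd i1; have b := close m j k L ltac:(lia) nd i2.
  have a' := hN n ltac:(lia); have b' := hN m ltac:(lia).
  have := seminorm_minus_trans saD saP j k (XF (Ln n)) (XF L) (XF (Ln m)).
  rewrite (seminorm_minus_sym saD saP j k (XF (Ln n)) (XF L)); lra.
exists S; split=> // j k eps e0.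
have [N1 h1] := small (eps / 2) ltac:(lra).
have [N2 h2] := hlim j k (eps / 2) ltac:(lra).
pose n := (N1 + N2 + k)%nat; exists (Ln n) => L nd hi.
have a := close n j k L ltac:(rewrite /n; lia) nd hi.
have b := h1 n ltac:(rewrite /n; lia); have d := h2 n ltac:(rewrite /n; lia).
have := seminorm_minus_trans saD saP j k hS (XF (Ln n)) (XF L).
rewrite (seminorm_minus_sym saD saP j k hS (XF (Ln n))) (seminorm_minus_sym saD saP j k (XF (Ln n)) (XF L)); lra.
Qed.

Lemma is_sum_unique c S S' : (forall i, X (c i)) -> X S -> X S' -> is_sum c S -> is_sum c S' -> S = S'.
Proof.
move=> hc hS hS' h h'; apply: (seminorm_small_eq hS hS') => eps e0.
have [L0 a] := h false O (eps / 2) ltac:(lra); have [L1 b] := h' false O (eps / 2) ltac:(lra).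
have [L [nd [i1 i2]]] := list_union L0 L1.
have := seminorm_minus_trans saD saP false 0 hS (delta_dom_fsum L hc) hS'.
have := a L nd i1; have := b L nd i2.
rewrite (seminorm_minus_sym saD saP false 0 hS' (delta_dom_fsum L hc)); lra.
Qed.

Definition bigsum c : op H := epsilon (inhabits (@op_zero H)) (fun S => X S /\ is_sum c S).

Lemma bigsum_spec c : psummable c -> X (bigsum c) /\ is_sum c (bigsum c).
Proof. by move=> h; apply: (epsilon_spec (inhabits (@op_zero H)) (fun S => X S /\ is_sum c S)); exact: sum_exists. Qed.

Lemma bigsum_X c : psummable c -> X (bigsum c).
Proof. by move=> /bigsum_spec []. Qed.

Lemma bigsum_eq c S : (forall i, X (c i)) -> X S -> is_sum c S -> bigsum c = S.
Proof.
move=> hc hS h.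
have [a b] : X (bigsum c) /\ is_sum c (bigsum c).
  by apply: (epsilon_spec (inhabits (@op_zero H)) (fun S => X S /\ is_sum c S)); exists S.
exact: (is_sum_unique hc a hS b h).
Qed.

Lemma bigsum_ext c c' : (forall i, c i = c' i) -> bigsum c = bigsum c'.
Proof. by move=> h; have -> : c = c' by apply: functional_extensionality. Qed.

Lemma bigsum_le j k c M : psummable c -> (forall L, NoDup L -> rsum (fun i => p j k (c i)) L <= M) ->
  p j k (bigsum c) <= M.
Proof.
move=> hs hM; have [hX h] := bigsum_spec hs; case: (hs) => hc _.
apply: le_epsilon => eps e0; have [L0 hL] := h j k eps e0.
have [L [nd [hi _]]] := list_union L0 nil.
have := seminorm_le_minus saD saP j k hX (delta_dom_fsum L hc).
have := hL L nd hi; have := hM L nd; have := seminorm_fsum j k L hc; lra.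
Qed.

Lemma is_sum_map c S (phi : op H -> op H) : (forall i, X (c i)) -> X S ->
  (forall T S, X T -> X S -> phi (op_plus T S) = op_plus (phi T) (phi S)) ->
  (forall T S, X T -> X S -> phi (op_minus T S) = op_minus (phi T) (phi S)) ->
  phi (@op_zero H) = @op_zero H ->
  (forall j k, exists C, 0 <= C /\ forall T, X T -> p j k (phi T) <= C * p j k T) ->
  is_sum c S -> is_sum (fun i => phi (c i)) (phi S).
Proof.
move=> hc hS fp fm f0 fb h j k eps e0.
have [C [C0 hC]] := fb j k.
have [L0 hL] := h j k (eps / (C + 1)) ltac:(apply: Rdiv_lt_0_compat; lra).
exists L0 => L nd hi.
have -> : fsum (fun i => phi (c i)) L = phi (fsum c L).
  by elim: L {nd hi} => //= a L ->; rewrite fp //; exact: delta_dom_fsum.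
have XL := delta_dom_fsum L hc.
rewrite -fm //; apply: Rle_trans (hC _ (Xm hS XL)) _.
apply: Rle_trans (_ : (C + 1) * (eps / (C + 1)) <= _); last by right; field; lra.
by apply: Rmult_le_compat => //; [apply: seminorm_pos; exact: Xm | lra | exact: hL].
Qed.

Lemma bigsum_map c (phi : op H -> op H) : psummable c ->
  (forall T, X T -> X (phi T)) ->
  (forall T S, X T -> X S -> phi (op_plus T S) = op_plus (phi T) (phi S)) ->
  (forall T S, X T -> X S -> phi (op_minus T S) = op_minus (phi T) (phi S)) ->
  phi (@op_zero H) = @op_zero H ->
  (forall j k, exists C, 0 <= C /\ forall T, X T -> p j k (phi T) <= C * p j k T) ->
  bigsum (fun i => phi (c i)) = phi (bigsum c).
Proof.
move=> hs hX fp fm f0 fb; have [a b] := bigsum_spec hs; case: (hs) => hc _.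
apply: bigsum_eq; [by move=> i; apply: hX | exact: hX | exact: is_sum_map].
Qed.

Lemma psummable_scal c (z : I -> C) K : (forall i, Cmod (z i) <= K) -> psummable c ->
  psummable (fun i => op_scal (z i) (c i)).
Proof.
move=> hz [hc hs]; split; first by move=> i; exact: Xs.
(* One index suffices for 0 <= K; over an empty index type K may be negative, but then all sums are
   empty. *)
case: (excluded_middle_informative (inhabited I)) => [[i0]|no]; last first.
  by move=> j k; exists 0; case=> [|i L] _; [right | case: no].
move=> j k; apply: summable_le (summable_scal _ (hs j k)) _.
  exact: (Rle_trans _ _ _ (Cmod_ge_0 _) (hz i0)).
move=> i; apply: Rle_trans (seminorm_scal saD saP j k (z i) (hc i)) _.
by apply: Rmult_le_compat_r; [exact: seminorm_pos | exact: hz].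
Qed.

Lemma bigsum_plus c c' : psummable c -> psummable c' ->
  bigsum (fun i => op_plus (c i) (c' i)) = op_plus (bigsum c) (bigsum c').
Proof.
move=> h h'; have [a b] := bigsum_spec h; have [a' b'] := bigsum_spec h'.
case: (h) => hc _; case: (h') => hc' _.
apply: bigsum_eq; [by move=> i; exact: Xp | exact: Xp |].
move=> j k eps e0.
have [L0 q] := b j k (eps / 2) ltac:(lra); have [L1 q'] := b' j k (eps / 2) ltac:(lra).
have [L2 [_ [i1 i2]]] := list_union L0 L1; exists L2 => L nd hi.
have E : fsum (fun i => op_plus (c i) (c' i)) L = op_plus (fsum c L) (fsum c' L).
  elim: L {nd hi} => [|x L IH] /=; first by rewrite op_zero_plus_r.
  by rewrite IH; apply: op_ext => y; rewrite /op_plus; cvec.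
have -> : op_minus (op_plus (bigsum c) (bigsum c')) (fsum (fun i => op_plus (c i) (c' i)) L) =
   op_plus (op_minus (bigsum c) (fsum c L)) (op_minus (bigsum c') (fsum c' L)).
  by rewrite E; apply: op_ext => y; rewrite /op_plus /op_minus; cvec.
apply: Rle_trans (seminorm_plus saD saP j k (Xm a (delta_dom_fsum L hc)) (Xm a' (delta_dom_fsum L hc'))) _.
have := q L nd (incl_tran i1 hi); have := q' L nd (incl_tran i2 hi); lra.
Qed.

Lemma bigsum_scal z c : psummable c -> bigsum (fun i => op_scal z (c i)) = op_scal z (bigsum c).
Proof.
move=> h; apply: (bigsum_map (phi := op_scal z)) => //.
- by move=> T; exact: Xs.
- by move=> T S _ _; apply: op_ext => x; rewrite /op_scal /op_plus; cvec.
- by move=> T S _ _; apply: op_ext => x; rewrite /op_scal /op_minus; cvec.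
- by apply: op_ext => x; rewrite /op_scal /op_zero; cvec.
- move=> j k; exists (Cmod z); split; first exact: Cmod_ge_0.
  by move=> T; exact: seminorm_scal.
Qed.

Lemma bigsum_single c i0 : X (c i0) -> (forall i, i <> i0 -> c i = @op_zero H) -> bigsum c = c i0.
Proof.
move=> h0 hz; have hc i : X (c i).
  by case: (eq_dec_classic i i0) => [->|/hz ->].
apply: bigsum_eq => // j k eps e0; exists (i0 :: nil) => L nd hi.
have E : fsum c L = c i0.
  have nd0 : NoDup (i0 :: nil) by constructor; [case | constructor].
  have [L' [_ [dj pm]]] := list_split nd0 nd hi.
  rewrite (fsum_perm c pm) fsum_app /=.
  have -> : fsum c L' = @op_zero H.
    elim: L' dj {pm} => //= a L' IH dj.
    rewrite hz; last by move=> E; apply: (dj a (or_introl eq_refl)); left.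
    by rewrite IH ?op_zero_plus_r // => i hi'; apply: dj; right.
  by rewrite !op_zero_plus_r.
have -> : op_minus (c i0) (fsum c L) = @op_zero H.
  by rewrite E; apply: op_ext => y; rewrite /op_zero /op_minus; cvec.
rewrite (seminorm_zero saD saP); lra.
Qed.

End OneFamily.

Arguments is_sum [I] c S.
End OperatorSums.

(** * Estimates *)

Lemma abs_sin_le x : Rabs (sin x) <= Rabs x.
Proof.
have pos y : 0 <= y -> Rabs (sin y) <= y.
  move=> y0; have PI0 := PI_RGT_0; have [lo hi] := SIN_bound y.
  apply: Rabs_le; split.
    case: (Rle_lt_dec y PI) => h; first by have := sin_ge_0 y y0 h; lra.
    by have := PI2_1; lra.
  case: y0 => [y0|<-]; first exact: (Rlt_le _ _ (sin_lt_x y y0)).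
  by rewrite sin_0; lra.
case: (Rle_lt_dec 0 x) => h; first by rewrite (Rabs_pos_eq x) //; exact: pos.
rewrite -Rabs_Ropp -sin_neg -(Rabs_Ropp x) (Rabs_pos_eq (- x)); last lra.
by apply: pos; lra.
Qed.

Lemma cos_1_abs_le x : Rabs (cos x - 1) <= Rabs x /\ Rabs (cos x - 1) <= x * x.
Proof.
have E : cos x - 1 = - (2 * sin (x / 2) * sin (x / 2)).
  have {1}-> : x = 2 * (x / 2) by field.
  rewrite cos_2a_sin; ring.
have s := abs_sin_le (x / 2).
have b : Rabs (sin (x / 2)) <= 1 by have [a b] := SIN_bound (x / 2); apply: Rabs_le; lra.
have sx : Rabs (x / 2) = Rabs x / 2 by rewrite /Rdiv Rabs_mult (Rabs_pos_eq (/ 2)); lra.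
have xx : x * x = Rabs x * Rabs x by rewrite -Rabs_mult Rabs_pos_eq //; nra.
have p := Rabs_pos (sin (x / 2)); have px := Rabs_pos x.
rewrite E Rabs_Ropp !Rabs_mult (Rabs_pos_eq 2); last lra.
rewrite xx; rewrite sx in s; split; nra.
Qed.

Lemma sin_sub_le x : Rabs (sin x - x) <= x * x.
Proof.
have [c [hc hx]] := MVT_abs (fun x => sin x - x) (fun x => cos x - 1) 0 x
  (fun c _ => derivable_pt_lim_minus sin id c (cos c) 1 (derivable_pt_lim_sin c) (derivable_pt_lim_id c)).
move: hc; rewrite sin_0 !Rminus_0_r => ->.
have [a _] := cos_1_abs_le c.
have cx : Rabs c <= Rabs x.
  case: (Rle_lt_dec 0 x) => h.
    by rewrite Rmin_left // Rmax_right // in hx; rewrite !Rabs_pos_eq; lra.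
  by rewrite Rmin_right ?Rmax_left in hx; try lra; rewrite !Rabs_left1; lra.
have xx : x * x = Rabs x * Rabs x by rewrite -Rabs_mult Rabs_pos_eq //; nra.
rewrite xx; apply: Rmult_le_compat_r; [exact: Rabs_pos | lra].
Qed.

Lemma Cmod_abs_le (z : C) : Cmod z <= Rabs (fst z) + Rabs (snd z).
Proof.
have -> : z = Cplus (RtoC (fst z)) (Cmult Ci (RtoC (snd z))).
  by apply: injective_projections => /=; ring.
apply: Rle_trans (Cmod_triangle _ _) _.
rewrite Cmod_mult !Cmod_R /= (_ : Cmod Ci = 1).
  have -> : fst z + (0 * snd z - 1 * 0) = fst z by ring.
  have -> : 0 + (0 * 0 + 1 * snd z) = snd z by ring.
  lra.
by rewrite /Cmod /= -[RHS]sqrt_1; f_equal; ring.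
Qed.

Lemma cis_lip x : Cmod (Cminus (cis x) (RtoC 1)) <= 2 * Rabs x.
Proof.
apply: Rle_trans (Cmod_abs_le _) _; rewrite /cis /=.
have [a _] := cos_1_abs_le x; have b := abs_sin_le x.
have -> : cos x + - (1) = cos x - 1 by ring.
have -> : sin x + - 0 = sin x by ring.
lra.
Qed.

(** Real and imaginary part are each bounded by x^2 for every real x. A bound for small x only would
    not do, because x will be 2 PI m h with m unbounded. *)
Lemma cis_taylor x : Cmod (Cminus (Cminus (cis x) (RtoC 1)) (Cmult Ci (RtoC x))) <= 2 * (x * x).
Proof.
apply: Rle_trans (Cmod_abs_le _) _; rewrite /cis /=.
have [_ a] := cos_1_abs_le x; have b := sin_sub_le x.
have -> : cos x + - (1) + - (0 * x - 1 * 0) = cos x - 1 by ring.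
have -> : sin x + - 0 + - (0 * 0 + 1 * x) = sin x - x by ring.
lra.
Qed.

(** * Weights on Z^2 *)

Definition wt (d : Z * Z) : R := (1 + Rabs (IZR (fst d))) * (1 + Rabs (IZR (snd d))).

Lemma wt_ge1 d : 1 <= wt d.
Proof. by rewrite /wt; have := Rabs_pos (IZR (fst d)); have := Rabs_pos (IZR (snd d)); nra. Qed.

Lemma wt_pow_ge1 d N : 1 <= wt d ^ N.
Proof. by apply: pow_R1_Rle; exact: wt_ge1. Qed.

Lemma wt_fst d : Rabs (IZR (fst d)) <= wt d.
Proof. by rewrite /wt; have := Rabs_pos (IZR (fst d)); have := Rabs_pos (IZR (snd d)); nra. Qed.

Lemma wt_snd d : Rabs (IZR (snd d)) <= wt d.
Proof. by rewrite /wt; have := Rabs_pos (IZR (fst d)); have := Rabs_pos (IZR (snd d)); nra. Qed.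

Lemma wt_dadd d e : wt (dadd d e) <= wt d * wt e.
Proof.
rewrite /wt /= !plus_IZR.
have a := Rabs_triang (IZR (fst d)) (IZR (fst e)); have b := Rabs_triang (IZR (snd d)) (IZR (snd e)).
have p1 := Rabs_pos (IZR (fst d)); have p2 := Rabs_pos (IZR (fst e)).
have p3 := Rabs_pos (IZR (snd d)); have p4 := Rabs_pos (IZR (snd e)).
apply: Rle_trans (_ : ((1 + Rabs (IZR (fst d))) * (1 + Rabs (IZR (fst e)))) *
  ((1 + Rabs (IZR (snd d))) * (1 + Rabs (IZR (snd e)))) <= _); last by right; ring.
apply: Rmult_le_compat; try nra.
  by have := Rabs_pos (IZR (fst d) + IZR (fst e)); lra.
by have := Rabs_pos (IZR (snd d) + IZR (snd e)); lra.
Qed.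

Lemma wt_dopp d : wt (dopp d) = wt d.
Proof. by rewrite /wt /= !opp_IZR !Rabs_Ropp. Qed.

Lemma rsum_incl (I : Type) (f : I -> R) L L' : (forall i, 0 <= f i) -> NoDup L -> incl L L' ->
  rsum f L <= rsum f L'.
Proof.
move=> f0; elim: L L' => [|a L IH] L' nd hi /=; first exact: rsum_nonneg.
inversion_clear nd as [|? ? na nd'].
have [l1 [l2 E]] := in_split a L' (hi a (or_introl eq_refl)).
have pm : Permutation L' (a :: (l1 ++ l2)) by rewrite E; apply: Permutation_sym; exact: Permutation_middle.
rewrite (rsum_perm f pm) /=; apply: Rplus_le_compat_l; apply: IH => // i hL.
have := hi i (or_intror hL); rewrite E !in_app_iff /= => h.
have ne : a <> i by move=> e; case: na; rewrite e.
by case: h => [h|[h|h]]; [left | case: ne | right].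
Qed.

Lemma rsum_map (I J : Type) (g : I -> J) (f : J -> R) L : rsum f (map g L) = rsum (fun i => f (g i)) L.
Proof. by elim: L => //= a L ->. Qed.

Lemma rsum_list_prod (I J : Type) (f : I -> R) (g : J -> R) L L' :
  rsum (fun ij => f (fst ij) * g (snd ij)) (list_prod L L') = rsum f L * rsum g L'.
Proof.
elim: L => [|a L IH] /=; first ring.
by rewrite rsum_app IH rsum_map /= rsum_scal; ring.
Qed.

Lemma summable_prod (I J : Type) (f : I -> R) (g : J -> R) : (forall i, 0 <= f i) -> (forall j, 0 <= g j) ->
  summable f -> summable g -> summable (fun ij => f (fst ij) * g (snd ij)).
Proof.
move=> f0 g0 [M hM] [M' hM']; exists (M * M') => L nd.
have [L1 [n1 [i1 _]]] := list_union (map fst L) nil.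
have [L2 [n2 [i2 _]]] := list_union (map snd L) nil.
apply: Rle_trans (_ : rsum (fun ij => f (fst ij) * g (snd ij)) (list_prod L1 L2) <= _).
  apply: rsum_incl => //; first by move=> i; apply: Rmult_le_pos.
  move=> [i j] h; apply: in_prod; [apply: i1 | apply: i2].
    exact: (in_map fst _ _ h).
  exact: (in_map snd _ _ h).
rewrite rsum_list_prod; apply: Rmult_le_compat; auto; exact: rsum_nonneg.
Qed.

Lemma summable_inv_sq : summable (fun m : Z => / (1 + Rabs (IZR m)) ^ 2).
Proof.
have f0 (m : Z) : 0 < / (1 + Rabs (IZR m)) ^ 2.
  by apply: Rinv_0_lt_compat; apply: pow_lt; have := Rabs_pos (IZR m); lra.
pose fix zl (K : nat) : list Z := match K with
  | O => 0%Z :: nil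
  | S K' => Z.of_nat K :: (- Z.of_nat K)%Z :: zl K' end.
have inz K (m : Z) : (Z.abs m <= Z.of_nat K)%Z -> In m (zl K).
  elim: K => [|K IH] h; first by left; lia.
  case: (Z.eq_dec m (Z.of_nat (S K))) => [->|n1]; first by left.
  case: (Z.eq_dec m (- Z.of_nat (S K))%Z) => [->|n2]; first by right; left.
  by right; right; apply: IH; lia.
have inK (L : list Z) : exists K, incl L (zl K).
  have [K hK] : exists K, forall m, In m L -> (Z.abs m <= Z.of_nat K)%Z.
    elim: L => [|a L [K IH]]; first by exists O.
    exists (K + Z.to_nat (Z.abs a))%nat => m [<-|/IH]; lia.
  by exists K => m /hK; exact: inz.
exists 3 => L nd; have [K hK] := inK L.
apply: Rle_trans (rsum_incl (fun i => Rlt_le _ _ (f0 i)) nd hK) _.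
(* A telescoping bound, with equality at K = 0: each of the two terms added at K + 1 is 1/(K+2)^2 <=
   1/(K+1) - 1/(K+2). *)
apply: Rle_trans (_ : 3 - 2 * / (INR K + 1) <= _); last first.
  have : 0 < / (INR K + 1) by apply: Rinv_0_lt_compat; have := pos_INR K; lra.
  lra.
elim: K {hK} => [|K IH].
  by rewrite /= Rabs_R0 Rplus_0_r !Rmult_1_r Rplus_0_l !Rinv_1; lra.
pose f (m : Z) := / (1 + Rabs (IZR m)) ^ 2.
change (f (Z.of_nat (S K)) + (f (- Z.of_nat (S K))%Z + rsum f (zl K)) <= 3 - 2 * / (INR (S K) + 1)).
have K0 := pos_INR K.
have E : Rabs (IZR (Z.of_nat (S K))) = INR K + 1.
  by rewrite -INR_IZR_INZ Rabs_pos_eq ?S_INR //; lra.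
rewrite /f opp_IZR Rabs_Ropp E S_INR -/f.
change (rsum f (zl K) <= 3 - 2 * / (INR K + 1)) in IH.
have : / (1 + (INR K + 1)) ^ 2 <= / (INR K + 1) - / (INR K + 1 + 1).
  have -> : / (INR K + 1) - / (INR K + 1 + 1) = / ((INR K + 1) * (INR K + 2)) by field; lra.
  rewrite /=; apply: Rinv_le_contravar; nra.
lra.
Qed.

Lemma summable_wt : summable (fun d : Z * Z => / wt d ^ 2).
Proof.
have f0 (m : Z) : 0 <= / (1 + Rabs (IZR m)) ^ 2.
  by apply: Rlt_le; apply: Rinv_0_lt_compat; apply: pow_lt; have := Rabs_pos (IZR m); lra.
apply: summable_le (summable_prod f0 f0 summable_inv_sq summable_inv_sq) _ => d.
by right; rewrite /wt Rpow_mult_distr Rinv_mult.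
Qed.

Lemma pow_1p_le x N : 0 <= x -> (1 + x) ^ N <= 2 ^ N * (1 + x ^ N).
Proof.
move=> x0; case: (Rle_lt_dec x 1) => h.
  apply: Rle_trans (_ : 2 ^ N <= _); first by apply: pow_incr; lra.
  by have := pow_le x N x0; have := pow_lt 2 N ltac:(lra); nra.
apply: Rle_trans (_ : (2 * x) ^ N <= _); first by apply: pow_incr; lra.
rewrite Rpow_mult_distr; have := pow_lt 2 N ltac:(lra); nra.
Qed.

Lemma is_lim_0_eps (f : R -> R) : is_lim f 0 0 <->
  forall eps, 0 < eps -> exists delta, 0 < delta /\ forall h, h <> 0 -> Rabs h < delta -> Rabs (f h) < eps.
Proof.
split.
  move=> /is_lim_spec h eps e0; have [d hd] := h (mkposreal eps e0).
  exists d; split; first exact: cond_pos.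
  move=> x x0 hx; have B : Rabs (x - 0) < d by rewrite Rminus_0_r.
  have C : Rabs (f x - 0) < eps := hd x B x0.
  by rewrite Rminus_0_r in C.
move=> h; apply/is_lim_spec => eps; have [d [d0 hd]] := h eps (cond_pos eps).
exists (mkposreal d d0) => x hx x0.
change (Rabs (f x - 0) < eps); change (Rabs (x - 0) < d) in hx.
by rewrite Rminus_0_r; rewrite Rminus_0_r in hx; exact: hd.
Qed.

(** * Rapidly decreasing homogeneous families *)

Definition freq (m : Z) : C := Cmult Ci (RtoC (2 * PI * IZR m)).

(** The eigenvalue, on elements of degree d, of the derivative of order (i,j) of the torus
    action. *)
Definition der (i j : nat) (d : Z * Z) : C := Cmult (Cpow (freq (fst d)) i) (Cpow (freq (snd d)) j).

Lemma Cmod_freq m : Cmod (freq m) = 2 * PI * Rabs (IZR m).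
Proof.
rewrite /freq Cmod_mult Cmod_R (_ : Cmod Ci = 1).
  by rewrite Rmult_1_l Rabs_mult Rabs_pos_eq //; have := PI_RGT_0; lra.
by rewrite /Cmod /= -[RHS]sqrt_1; f_equal; ring.
Qed.

Lemma freq_le m w : Rabs (IZR m) <= w -> Cmod (freq m) <= 8 * w.
Proof.
rewrite Cmod_freq => h; have := PI_4; have := PI_RGT_0; have := Rabs_pos (IZR m); nra.
Qed.

Lemma der_le i j d : Cmod (der i j d) <= 8 ^ (i + j) * wt d ^ (i + j).
Proof.
rewrite /der Cmod_mult !Cmod_pow -Rpow_mult_distr pow_add.
have a := Cmod_ge_0 (freq (fst d)); have b := Cmod_ge_0 (freq (snd d)).
have c := freq_le (wt_fst d); have e := freq_le (wt_snd d).
apply: Rmult_le_compat; try exact: pow_le; by apply: pow_incr; split.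
Qed.

Lemma der_S1 i j d : der (S i) j d = Cmult (freq (fst d)) (der i j d).
Proof. by rewrite /der Cpow_S Cmult_assoc. Qed.

Lemma der_S2 i j d : der i (S j) d = Cmult (freq (snd d)) (der i j d).
Proof. rewrite /der Cpow_S; ring. Qed.

Lemma der_00 d : der 0 0 d = RtoC 1.
Proof. by rewrite /der /= Cmult_1_l. Qed.

(** [cis_taylor] at 2 PI m h, divided by h; the constant 8 PI^2 is at most 128 because PI <= 4. *)
Lemma diff_quot m h : h <> 0 ->
  Cmod (Cminus (Cmult (RtoC (/ h)) (Cminus (pchar m h) (RtoC 1))) (freq m)) <= Rabs h * (128 * Rabs (IZR m) ^ 2).
Proof.
move=> h0; have := cis_taylor (2 * PI * (IZR m * h)); rewrite -/(pchar m h).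
set u := Cminus (Cminus _ _) _.
have -> : Cminus (Cmult (RtoC (/ h)) (Cminus (pchar m h) (RtoC 1))) (freq m) = Cmult (RtoC (/ h)) u.
  rewrite /u /freq; apply: injective_projections => /=; field => //.
rewrite Cmod_mult Cmod_R => hu.
have ah := Rabs_pos_lt _ h0.
have ih : Rabs (/ h) * Rabs h = 1 by rewrite -Rabs_mult Rinv_l // Rabs_R1.
have ip := Rabs_pos (/ h).
have hh : h * h = Rabs h * Rabs h by rewrite -Rabs_mult Rabs_pos_eq //; nra.
have mm : IZR m * IZR m = Rabs (IZR m) * Rabs (IZR m) by rewrite -Rabs_mult Rabs_pos_eq //; nra.
have P := PI_4; have P0 := PI_RGT_0.
have hu' : Cmod u <= 128 * (Rabs (IZR m) * Rabs (IZR m)) * (Rabs h * Rabs h).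
  apply: Rle_trans hu _.
  have -> : 2 * (2 * PI * (IZR m * h) * (2 * PI * (IZR m * h))) = 8 * (PI * PI) * ((IZR m * IZR m) * (h * h)) by ring.
  rewrite hh mm.
  have : PI * PI <= 16 by nra.
  have q : 0 <= Rabs (IZR m) * Rabs (IZR m) * (Rabs h * Rabs h).
    by apply: Rmult_le_pos; apply: Rmult_le_pos; exact: Rabs_pos.
  nra.
apply: Rle_trans (Rmult_le_compat_l _ _ _ ip hu') _; right.
have -> : Rabs (/ h) * (128 * (Rabs (IZR m) * Rabs (IZR m)) * (Rabs h * Rabs h)) =
  (Rabs (/ h) * Rabs h) * (128 * (Rabs (IZR m) * Rabs (IZR m)) * Rabs h) by ring.
rewrite ih; ring.
Qed.

Section Families.
Context {H : Hilbert}.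
Variable U : R -> R -> op H.
Hypothesis HU : torus_unitary_rep U.
Variables D P : pop H.
Hypotheses (saD : selfadjoint D) (saP : selfadjoint P).
Hypotheses (UD : forall s t, commutes (U s t) D) (UP : forall s t, commutes (U s t) P).
Notation X := (delta_dom D P).
Notation p := (delta_seminorm D P).
Notation bigsum := (bigsum D P).
Implicit Types (T S : op H).

Let Xp T S (hT : X T) (hS : X S) : X (op_plus T S) := proj1 (delta_dom_plus saD saP hT hS).
Let Xs z T (hT : X T) : X (op_scal z T) := proj1 (delta_dom_scal saD saP z hT).
Let Xm T S (hT : X T) (hS : X S) : X (op_minus T S) := proj1 (delta_dom_minus saD saP hT hS).
Let XA s t T (hT : X T) : X (Ad U s t T) := proj1 (delta_dom_Ad HU saD saP UD UP s t hT).

Section OneFamily.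
Variable I : Type.
Implicit Types (d : I -> Z * Z) (c : I -> op H) (z : I -> C).

(** Decay is stated as summability of the weighted seminorms, not as boundedness: when infinitely
    many indices share a degree, as can happen in products, bounds by powers of the weight would not
    give convergence. *)
Definition fam d c : Prop := (forall i, X (c i)) /\ (forall i, homog U (d i) (c i)) /\
  forall j k N, summable (fun i => wt (d i) ^ N * p j k (c i)).

Definition polyb d z : Prop := exists K N, 0 <= K /\ forall i, Cmod (z i) <= K * wt (d i) ^ N.

Lemma fam_psummable d c : fam d c -> psummable D P c.
Proof.
move=> [hX [_ hs]]; split=> // j k; apply: summable_le (hs j k O) _ => i /=; lra.
Qed.

Lemma fam_scal d c z : fam d c -> polyb d z -> fam d (fun i => op_scal (z i) (c i)).
Proof.
move=> [hX [hh hs]] [K [M [K0 hz]]]; split; first by move=> i; exact: Xs.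
split; first by move=> i; exact: homog_scal.
move=> j k N; apply: summable_le (summable_scal K0 (hs j k (N + M)%nat)) _ => i.
have w0 : 0 <= wt (d i) ^ N by have := wt_pow_ge1 (d i) N; lra.
apply: Rle_trans (Rmult_le_compat_l _ _ _ w0 (seminorm_scal saD saP j k (z i) (hX i))) _.
apply: Rle_trans (_ : wt (d i) ^ N * (K * wt (d i) ^ M * p j k (c i)) <= _).
  by apply: Rmult_le_compat_l => //; apply: Rmult_le_compat_r; [exact: seminorm_pos | exact: hz].
by right; rewrite pow_add; ring.
Qed.

Lemma fam_plus d c c' : fam d c -> fam d c' -> fam d (fun i => op_plus (c i) (c' i)).
Proof.
move=> [hX [hh hs]] [hX' [hh' hs']]; split; first by move=> i; exact: Xp.
split; first by move=> i; exact: homog_plus.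
move=> j k N; apply: summable_le (summable_plus (hs j k N) (hs' j k N)) _ => i.
have w0 : 0 <= wt (d i) ^ N by have := wt_pow_ge1 (d i) N; lra.
rewrite -Rmult_plus_distr_l; apply: Rmult_le_compat_l => //; exact: seminorm_plus.
Qed.

Lemma fam_leftU d c (s t : Z * Z -> R) : fam d c -> fam d (fun i => op_comp (U (s (d i)) (t (d i))) (c i)).
Proof.
move=> [hX [hh hs]].
have hL i := delta_dom_leftU HU saD saP UD UP (s (d i)) (t (d i)) (hX i).
split; first by move=> i; case: (hL i).
split; first by move=> i; exact: homog_left_U.
move=> j k N; apply: summable_le (hs j k N) _ => i.
apply: Rmult_le_compat_l; first by have := wt_pow_ge1 (d i) N; lra.
by case: (hL i) => _; apply.
Qed.

Lemma polyb_unit d z : (forall i, Cmod (z i) = 1) -> polyb d z.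
Proof. by move=> h; exists 1, O; split; [lra | move=> i; rewrite h /=; lra]. Qed.

Lemma polyb_mult d z z' : polyb d z -> polyb d z' -> polyb d (fun i => Cmult (z i) (z' i)).
Proof.
move=> [K [N [K0 h]]] [K' [N' [K0' h']]]; exists (K * K'), (N + N')%nat; split; first nra.
move=> i; rewrite Cmod_mult pow_add.
have -> : K * K' * (wt (d i) ^ N * wt (d i) ^ N') = (K * wt (d i) ^ N) * (K' * wt (d i) ^ N') by ring.
by apply: Rmult_le_compat => //; exact: Cmod_ge_0.
Qed.

Lemma polyb_der d i j : polyb d (fun k => der i j (d k)).
Proof. by exists (8 ^ (i + j)), (i + j)%nat; split; [apply: pow_le; lra | move=> k; exact: der_le]. Qed.

Lemma op_scal_scal (a b : C) T : op_scal a (op_scal b T) = op_scal (Cmult a b) T.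
Proof. by apply: op_ext => x; rewrite /op_scal cscal_assoc. Qed.

(** One constant M serves all multipliers z of the given growth. This uniformity turns termwise
    estimates of differences and difference quotients into estimates of the sums. *)
Lemma fam_bound d c : fam d c -> forall j k N, exists M, 0 <= M /\ forall z K, 0 <= K ->
  (forall i, Cmod (z i) <= K * wt (d i) ^ N) -> p j k (bigsum (fun i => op_scal (z i) (c i))) <= K * M.
Proof.
move=> hf j k N; case: (hf) => hX [_ hs]; have [M hM] := hs j k N.
exists M; split; first exact: (hM nil (NoDup_nil _)).
move=> z K K0 hz.
have hz' : polyb d z by exists K, N.
apply: (bigsum_le saD saP); first exact: (fam_psummable (fam_scal hf hz')).
move=> L nd; apply: Rle_trans (_ : K * rsum (fun i => wt (d i) ^ N * p j k (c i)) L <= _); last first.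
  by apply: Rmult_le_compat_l => //; exact: hM.
rewrite -rsum_scal; apply: rsum_le => i.
apply: Rle_trans (seminorm_scal saD saP j k (z i) (hX i)) _.
rewrite -Rmult_assoc; apply: Rmult_le_compat_r; [exact: seminorm_pos | exact: hz].
Qed.

Lemma bigsum_sub d c z z' : fam d c -> polyb d z -> polyb d z' ->
  op_minus (bigsum (fun i => op_scal (z i) (c i))) (bigsum (fun i => op_scal (z' i) (c i))) =
  bigsum (fun i => op_scal (Cminus (z i) (z' i)) (c i)).
Proof.
move=> hf hz hz'; have h := fam_psummable (fam_scal hf hz); have h' := fam_psummable (fam_scal hf hz').
rewrite op_minus_plus -(bigsum_scal saD saP _ h') -(bigsum_plus saD saP h); last first.
  by apply: (psummable_scal saD saP (K := 1)) => // i; rewrite Cmod_R Rabs_Ropp Rabs_R1; lra.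
apply: bigsum_ext => i; apply: op_ext => x; rewrite /op_plus /op_scal; cvec.
Qed.

Lemma bigsum_scal_fam d c z a : fam d c -> polyb d z ->
  op_scal a (bigsum (fun i => op_scal (z i) (c i))) = bigsum (fun i => op_scal (Cmult a (z i)) (c i)).
Proof.
move=> hf hz; rewrite -(bigsum_scal saD saP _ (fam_psummable (fam_scal hf hz))).
by apply: bigsum_ext => i; rewrite op_scal_scal.
Qed.

Lemma Ad_bigsum s t c : psummable D P c -> Ad U s t (bigsum c) = bigsum (fun i => Ad U s t (c i)).
Proof.
move=> h; apply: eq_sym; apply: (bigsum_map saD saP (phi := Ad U s t)) => //.
- by move=> T; exact: XA.
- by move=> T S _ _; exact: Ad_op_plus.
- by move=> T S _ _; exact: Ad_op_minus.
- by apply: op_ext => x; rewrite /Ad /op_zero (bo_zero (U_bo HU s t)).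
- by move=> j k; exists 1; split; [lra | move=> T hT; rewrite Rmult_1_l; exact: (seminorm_Ad HU saD saP UD UP)].
Qed.

Lemma hcomp_bigsum e c : psummable D P c -> hcomp U e (bigsum c) = bigsum (fun i => hcomp U e (c i)).
Proof.
move=> h; apply: eq_sym; apply: (bigsum_map saD saP (phi := hcomp U e)) => //.
- by move=> T hT; case: (delta_dom_comp2 HU saD saP UD UP e hT).
- by move=> T S hT hS; apply: hcomp_op_plus => //; [exact: (delta_dom_bo hT) | exact: (delta_dom_bo hS)].
- by move=> T S hT hS; apply: hcomp_op_minus => //; [exact: (delta_dom_bo hT) | exact: (delta_dom_bo hS)].
- by rewrite /hcomp (avg_zero _ (ugroup_V2 HU)) (avg_zero _ (ugroup_V1 HU)).
- by move=> j k; exists 1; split; [lra | move=> T hT; rewrite Rmult_1_l; exact: (seminorm_comp2 HU saD saP UD UP)].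
Qed.

Lemma fam_Ad d c s t : fam d c -> Ad U s t (bigsum c) = bigsum (fun i => op_scal (pairchar (d i) s t) (c i)).
Proof.
move=> hf; rewrite Ad_bigsum; last exact: (fam_psummable hf).
by apply: bigsum_ext => i; case: hf => _ [hh _]; exact: hh.
Qed.

(** The orbit of the sum under the torus, differentiated i and j times term by term, at (s,t). *)
Definition dsum d c i j s t : op H :=
  bigsum (fun k => op_scal (Cmult (der i j (d k)) (pairchar (d k) s t)) (c k)).

Let zb d i j s t : polyb d (fun k => Cmult (der i j (d k)) (pairchar (d k) s t)).
Proof. by apply: polyb_mult; [exact: polyb_der | apply: polyb_unit => k; exact: Cmod_pairchar]. Qed.

Lemma dsum_00 d c s t : fam d c -> dsum d c 0 0 s t = Ad U s t (bigsum c).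
Proof.
by move=> hf; rewrite (fam_Ad s t hf); apply: bigsum_ext => k; rewrite der_00 Cmult_1_l.
Qed.

Lemma dsum_continuous d c i j : fam d c -> delta_continuous D P (dsum d c i j).
Proof.
move=> hf b k s t.
(* Order (i,j) costs i + j powers of the weight, and the Lipschitz bound of the character one more;
   its constant 16 exceeds 4 PI. *)
have [M [M0 hM]] := fam_bound hf b k (i + j + 1)%nat.
have est s' t' : p b k (op_minus (dsum d c i j s' t') (dsum d c i j s t)) <=
    (Rabs (s' - s) + Rabs (t' - t)) * 16 * 8 ^ (i + j) * M.
  rewrite (bigsum_sub hf (zb d i j s' t') (zb d i j s t)); apply: hM.
    apply: Rmult_le_pos; last by apply: pow_le; lra.
    by have := Rabs_pos (s' - s); have := Rabs_pos (t' - t); lra.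
  move=> x; have -> : Cminus (Cmult (der i j (d x)) (pairchar (d x) s' t')) (Cmult (der i j (d x)) (pairchar (d x) s t))
     = Cmult (Cmult (der i j (d x)) (pairchar (d x) s t)) (Cminus (pairchar (d x) (s' - s) (t' - t)) (RtoC 1)).
    have -> : pairchar (d x) s' t' = Cmult (pairchar (d x) s t) (pairchar (d x) (s' - s) (t' - t)).
      by rewrite -pairchar_add; f_equal; ring.
    ring.
  rewrite 2!Cmod_mult Cmod_pairchar Rmult_1_r.
  have e1 := der_le i j (d x).
  have e2 : Cmod (Cminus (pairchar (d x) (s' - s) (t' - t)) (RtoC 1)) <= (Rabs (s' - s) + Rabs (t' - t)) * 16 * wt (d x).
    apply: Rle_trans (cis_lip _) _.
    rewrite Rabs_mult (Rabs_pos_eq (2 * PI)); last by have := PI_RGT_0; lra.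
    have a := Rabs_triang (IZR (fst (d x)) * (s' - s)) (IZR (snd (d x)) * (t' - t)).
    rewrite !Rabs_mult in a.
    have := PI_4; have := PI_RGT_0; have w1 := wt_fst (d x); have w2 := wt_snd (d x).
    have := Rabs_pos (s' - s); have := Rabs_pos (t' - t).
    have := Rabs_pos (IZR (fst (d x)) * (s' - s) + IZR (snd (d x)) * (t' - t)).
    set A := Rabs (_ + _) in a *; set B := Rabs (s' - s) in a *; set C := Rabs (t' - t) in a *.
    set E := Rabs (IZR (fst _)) in a w1 *; set F := Rabs (IZR (snd _)) in a w2 *.
    move=> A0 C0 B0 P0 P4.
    have a' : A <= wt (d x) * (B + C) by nra.
    apply: Rle_trans (_ : 2 * (8 * A) <= _); first by nra.
    lra.
  apply: Rle_trans (Rmult_le_compat _ _ _ _ (Cmod_ge_0 _) (Cmod_ge_0 _) e1 e2) _.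
  by right; rewrite (pow_add (wt (d x)) (i + j) 1); ring.
apply/filterlim_locally => eps.
set K := 16 * 8 ^ (i + j) * M.
have K0 : 0 <= K by apply: Rmult_le_pos => //; apply: Rmult_le_pos; [lra | apply: pow_le; lra].
have e1 : 0 < eps / (2 * (K + 1)) by apply: Rdiv_lt_0_compat; [exact: cond_pos | lra].
exists (mkposreal _ e1) => q [h1 h2].
change (Rabs (p b k (op_minus (dsum d c i j (fst q) (snd q)) (dsum d c i j s t)) - 0) < eps).
have {}h1 : Rabs (fst q - s) < eps / (2 * (K + 1)) := h1.
have {}h2 : Rabs (snd q - t) < eps / (2 * (K + 1)) := h2.
rewrite Rminus_0_r Rabs_pos_eq; last first.
  by apply: seminorm_pos; apply: Xm; apply: (bigsum_X saD saP); apply: (fam_psummable (fam_scal hf (zb _ _ _ _ _))).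
apply: Rle_lt_trans (est _ _) _.
have -> : (Rabs (fst q - s) + Rabs (snd q - t)) * 16 * 8 ^ (i + j) * M =
  (Rabs (fst q - s) + Rabs (snd q - t)) * K by rewrite /K; ring.
apply: Rle_lt_trans (_ : (Rabs (fst q - s) + Rabs (snd q - t)) * (K + 1) < _).
  by apply: Rmult_le_compat_l; [have := Rabs_pos (fst q - s); have := Rabs_pos (snd q - t); lra | lra].
apply: Rlt_le_trans (_ : (eps / (2 * (K + 1)) + eps / (2 * (K + 1))) * (K + 1) <= _); last by right; field; lra.
by apply: Rmult_lt_compat_r; lra.
Qed.

(** Covers both partial derivatives: (hs h, ht h) is the increment along one axis, and [fr] selects
    the coordinate of the degree dual to that axis. *)
Lemma dsum_diff d c (fr : Z * Z -> Z) i j i' j' s t (hs ht : R -> R) : fam d c ->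
  (forall e, Rabs (IZR (fr e)) <= wt e) ->
  (forall h e, pairchar e (hs h) (ht h) = pchar (fr e) h) ->
  (forall e, der i' j' e = Cmult (freq (fr e)) (der i j e)) ->
  forall b k, is_lim (fun h => p b k (op_minus (op_scal (RtoC (/ h))
     (op_minus (dsum d c i j (s + hs h) (t + ht h)) (dsum d c i j s t))) (dsum d c i' j' s t))) 0 0.
Proof.
move=> hf hfr hch hder b k.
(* The second-order remainder in [diff_quot] costs two further powers of the weight. *)
have [M [M0 hM]] := fam_bound hf b k (i + j + 2)%nat.
have zd h : polyb d (fun x => Cminus (Cmult (der i j (d x)) (pairchar (d x) (s + hs h) (t + ht h)))
      (Cmult (der i j (d x)) (pairchar (d x) s t))).
  have [K [N [K0 hK]]] := zb d i j (s + hs h) (t + ht h); have [K' [N' [K0' hK']]] := zb d i j s t.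
  exists (K + K'), (N + N')%nat; split; first lra.
  move=> x; apply: Rle_trans (Cmod_triangle _ _) _; rewrite Cmod_opp Rmult_plus_distr_r pow_add.
  have w1 := wt_pow_ge1 (d x) N; have w2 := wt_pow_ge1 (d x) N'.
  apply: Rplus_le_compat; [apply: Rle_trans (hK x) _ | apply: Rle_trans (hK' x) _];
    apply: Rmult_le_compat_l => //; nra.
have est h : h <> 0 -> p b k (op_minus (op_scal (RtoC (/ h))
     (op_minus (dsum d c i j (s + hs h) (t + ht h)) (dsum d c i j s t))) (dsum d c i' j' s t)) <=
     Rabs h * (128 * 8 ^ (i + j)) * M.
  move=> h0.
  pose Z x := Cminus (Cmult (der i j (d x)) (pairchar (d x) (s + hs h) (t + ht h)))
      (Cmult (der i j (d x)) (pairchar (d x) s t)).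
  have -> : op_scal (RtoC (/ h)) (op_minus (dsum d c i j (s + hs h) (t + ht h)) (dsum d c i j s t)) =
      bigsum (fun x => op_scal (Cmult (RtoC (/ h)) (Z x)) (c x)).
    rewrite (bigsum_sub hf (zb d i j (s + hs h) (t + ht h)) (zb d i j s t)).
    exact: (bigsum_scal_fam (RtoC (/ h)%R) hf (zd h)).
  have zh : polyb d (fun x => Cmult (RtoC (/ h)) (Z x)).
    apply: (polyb_mult (z := fun _ => RtoC (/ h)) _ (zd h)); exists (Rabs (/ h)), O.
    by split; [exact: Rabs_pos | move=> x; rewrite Cmod_R /=; lra].
  rewrite (bigsum_sub hf zh (zb d i' j' s t)).
  apply: hM.
    apply: Rmult_le_pos; first exact: Rabs_pos.
    by apply: Rmult_le_pos; [lra | apply: pow_le; lra].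
  move=> x; rewrite /Z pairchar_add hch hder.
  set a := der i j (d x); set q := pairchar (d x) s t; set u := pchar _ h.
  have -> : Cminus (Cmult (RtoC (/ h)) (Cminus (Cmult a (Cmult q u)) (Cmult a q))) (Cmult (Cmult (freq (fr (d x))) a) q) =
     Cmult (Cmult a q) (Cminus (Cmult (RtoC (/ h)) (Cminus u (RtoC 1))) (freq (fr (d x)))) by ring.
  rewrite 2!Cmod_mult Cmod_pairchar Rmult_1_r.
  have e1 := der_le i j (d x); have e2 := diff_quot (fr (d x)) h0.
  have e3 : Rabs (IZR (fr (d x))) ^ 2 <= wt (d x) ^ 2.
    by apply: pow_incr; split; [exact: Rabs_pos | exact: hfr].
  apply: Rle_trans (Rmult_le_compat _ _ _ _ (Cmod_ge_0 _) (Cmod_ge_0 _) e1 e2) _.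
  apply: Rle_trans (_ : 8 ^ (i + j) * wt (d x) ^ (i + j) * (Rabs h * (128 * wt (d x) ^ 2)) <= _).
    apply: Rmult_le_compat_l.
      by apply: Rmult_le_pos; apply: pow_le; [lra | have := wt_ge1 (d x); lra].
    by apply: Rmult_le_compat_l; [exact: Rabs_pos | lra].
  by right; rewrite (pow_add (wt (d x)) (i + j) 2); ring.
apply/is_lim_0_eps => eps e0.
set K := 128 * 8 ^ (i + j) * M.
have K0 : 0 <= K by apply: Rmult_le_pos => //; apply: Rmult_le_pos; [lra | apply: pow_le; lra].
exists (eps / (K + 1)); split; first by apply: Rdiv_lt_0_compat; lra.
move=> h h0 hh; rewrite Rabs_pos_eq; last first.
  have XF a b' s' t' : X (dsum d c a b' s' t').
    by apply: (bigsum_X saD saP); apply: (fam_psummable (fam_scal hf (zb _ _ _ _ _))).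
  by apply: seminorm_pos; apply: Xm => //; apply: Xs; exact: Xm.
apply: Rle_lt_trans (est h h0) _; rewrite Rmult_assoc -/K.
apply: Rle_lt_trans (_ : Rabs h * (K + 1) < _).
  by apply: Rmult_le_compat_l; [exact: Rabs_pos | lra].
apply: Rlt_le_trans (_ : eps / (K + 1) * (K + 1) <= _); last by right; field; lra.
by apply: Rmult_lt_compat_r; lra.
Qed.

(** The derivatives are sums of the same family with polynomially bounded multipliers, so [Y] only
    has to contain such sums. It is left open to serve for the completion, the domain of the
    derivations and the deformed algebra. *)
Lemma fam_smooth d c (Y : op H -> Prop) : fam d c ->
  (forall z, polyb d z -> Y (bigsum (fun i => op_scal (z i) (c i)))) ->
  delta_smooth Y D P (fun s t => Ad U s t (bigsum c)).
Proof.
move=> hf hY; exists (dsum d c); split; first by move=> s t; exact: dsum_00.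
move=> i j; split; first by move=> s t; apply: hY; exact: zb.
split; first exact: dsum_continuous.
split=> b k s t.
  have := @dsum_diff d c fst i j (S i) j s t (fun h => h) (fun _ => 0) hf wt_fst _ (der_S1 i j) b k.
  rewrite Rplus_0_r; apply.
  by move=> h e; rewrite pairchar_split {2}/pchar !Rmult_0_r cis_0 Cmult_1_r.
have := @dsum_diff d c snd i j i (S j) s t (fun _ => 0) (fun h => h) hf wt_snd _ (der_S2 i j) b k.
rewrite Rplus_0_r; apply.
by move=> h e; rewrite pairchar_split {1}/pchar !Rmult_0_r cis_0 Cmult_1_l.
Qed.

End OneFamily.
End Families.

(** * Smooth elements and their Fourier series *)

(** One index serves the finitely many seminorms of bounded order. The order is abstract because the
    index is a rank for sequences and a finite set under inclusion for unordered sums. *)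
Lemma finite_uniform (B : Type) (le : B -> B -> Prop) (Q : bool -> nat -> B -> Prop) :
  (forall a b, exists c, le a c /\ le b c) -> (forall j k a b, Q j k a -> le a b -> Q j k b) ->
  (forall j k, exists a, Q j k a) -> forall K, exists a, forall j k, (k <= K)%nat -> Q j k a.
Proof.
move=> dir mon h; elim=> [|K [a IH]].
  have [a ha] := h false O; have [b hb] := h true O; have [c [ac bc]] := dir a b.
  exists c => j k k0; have -> : k = O by lia.
  by case: j; [exact (mon _ _ _ _ hb bc) | exact (mon _ _ _ _ ha ac)].
have [b hb] := h false (S K); have [c hc] := h true (S K).
have [e [be ce]] := dir b c; have [f [af ef]] := dir a e.
exists f => j k hk; case: (Nat.eq_dec k (S K)) => [->|ne].
  by apply: (mon _ _ _ _ _ ef); case: j; [exact (mon _ _ _ _ hc ce) | exact (mon _ _ _ _ hb be)].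
by apply: (mon _ _ _ _ _ af); apply: IH; lia.
Qed.

Section Smooth.
Context {H : Hilbert}.
Variable U : R -> R -> op H.
Hypothesis HU : torus_unitary_rep U.
Variables D P : pop H.
Hypotheses (saD : selfadjoint D) (saP : selfadjoint P).
Hypotheses (UD : forall s t, commutes (U s t) D) (UP : forall s t, commutes (U s t) P).
Notation X := (delta_dom D P).
Notation p := (delta_seminorm D P).
Notation bigsum := (bigsum D P).
Notation fam := (fam U D P).
Implicit Types (T S : op H).

Let Xs z T (hT : X T) : X (op_scal z T) := proj1 (delta_dom_scal saD saP z hT).
Let Xm T S (hT : X T) (hS : X S) : X (op_minus T S) := proj1 (delta_dom_minus saD saP hT hS).
Let XA s t T (hT : X T) : X (Ad U s t T) := proj1 (delta_dom_Ad HU saD saP UD UP s t hT).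
Let Xh d T (hT : X T) : X (hcomp U d T) := proj1 (delta_dom_comp2 HU saD saP UD UP d hT).

Section Derivative.
Variables (f g : R -> R -> op H) (hs ht : R -> R).
Hypotheses (Xf : forall s t, X (f s t)) (Xg : forall s t, X (g s t)).
Hypothesis fAd : forall s t, f s t = Ad U s t (f 0 0).
Hypothesis lim : forall s t, is_lim (fun h => p false 0 (op_minus (op_scal (RtoC (/ h))
     (op_minus (f (s + hs h) (t + ht h)) (f s t))) (g s t))) 0 0.

Let q s t h := op_scal (RtoC (/ h)) (op_minus (f (s + hs h) (t + ht h)) (f s t)).

Let Xq s t h : X (q s t h). Proof. by apply: Xs; exact: Xm. Qed.

Let qAd s t h : q s t h = Ad U s t (q 0 0 h).
Proof.
by rewrite /q (Ad_op_scal HU) (Ad_op_minus HU) !(fAd (_ + _)) (fAd s t) (Ad_add HU s t (hs h) (ht h)) !Rplus_0_l.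
Qed.

Let limq s t eps : 0 < eps -> exists delta, 0 < delta /\ forall h, h <> 0 -> Rabs h < delta ->
  p false 0 (op_minus (q s t h) (g s t)) < eps.
Proof.
move=> e0; have [d [d0 hd]] := proj1 (is_lim_0_eps _) (lim s t) eps e0; exists d; split=> // h h0 hh.
by have := hd h h0 hh; rewrite Rabs_pos_eq //; apply: seminorm_pos; exact: (Xm (Xq s t h) (Xg s t)).
Qed.

(** The difference quotient at (s,t) is the conjugate of the one at (0,0), and conjugation does not
    increase the norm, so both sides are limits of the same quotients. *)
Lemma derivative_Ad s t : g s t = Ad U s t (g 0 0).
Proof.
apply: (seminorm_small_eq (Xg s t) (XA s t (Xg 0 0))) => eps e0.
have [d1 [d10 h1]] := @limq s t (eps / 2) ltac:(lra).
have [d2 [d20 h2]] := @limq 0 0 (eps / 2) ltac:(lra).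
pose h := Rmin d1 d2 / 2.
have m0 : 0 < Rmin d1 d2 by exact: Rmin_pos.
have h0 : h <> 0 by rewrite /h; lra.
have ha : Rabs h < Rmin d1 d2 by rewrite /h Rabs_pos_eq; lra.
have {}h1 := h1 h h0 (Rlt_le_trans _ _ _ ha (Rmin_l _ _)).
have {}h2 := h2 h h0 (Rlt_le_trans _ _ _ ha (Rmin_r _ _)).
apply: Rle_trans (seminorm_minus_trans saD saP false 0 (Xg s t) (Xq s t h) (XA s t (Xg 0 0))) _.
rewrite (seminorm_minus_sym saD saP false 0 (Xg s t) (Xq s t h)) {2}qAd -(Ad_op_minus HU).
have := seminorm_Ad HU saD saP UD UP false 0 s t (Xm (Xq 0 0 h) (Xg 0 0)); lra.
Qed.

(** Takes the place of integration by parts: the component of a difference quotient of an orbit is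
    an explicit scalar times the component of the base point, and the scalar tends to [freq]. *)
Lemma derivative_hcomp (fr : Z * Z -> Z) e : (forall h, pairchar e (hs h) (ht h) = pchar (fr e) h) ->
  hcomp U e (g 0 0) = op_scal (freq (fr e)) (hcomp U e (f 0 0)).
Proof.
move=> hch.
have XC := Xh e (Xf 0 0); set C := hcomp U e (f 0 0) in XC *.
apply: (seminorm_small_eq (Xh e (Xg 0 0)) (Xs (freq (fr e)) XC)) => eps e0.
have [d1 [d10 h1]] := @limq 0 0 (eps / 2) ltac:(lra).
have C0 := seminorm_pos false 0 XC.
pose K := 128 * Rabs (IZR (fr e)) ^ 2 * p false 0 C.
have K0 : 0 <= K.
  by apply: Rmult_le_pos => //; apply: Rmult_le_pos; [lra | apply: pow_le; exact: Rabs_pos].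
pose d2 := eps / (2 * (K + 1)).
have d20 : 0 < d2 by apply: Rdiv_lt_0_compat; lra.
pose h := Rmin d1 d2 / 2.
have m0 : 0 < Rmin d1 d2 by exact: Rmin_pos.
have h0 : h <> 0 by rewrite /h; lra.
have ha : Rabs h < Rmin d1 d2 by rewrite /h Rabs_pos_eq; lra.
have {}h1 := h1 h h0 (Rlt_le_trans _ _ _ ha (Rmin_l _ _)).
have h2 := Rlt_le_trans _ _ _ ha (Rmin_r _ _).
have bf : bounded_op (f 0 0) := delta_dom_bo (Xf 0 0).
have E : hcomp U e (q 0 0 h) = op_scal (Cmult (RtoC (/ h)) (Cminus (pchar (fr e) h) (RtoC 1))) C.
  have bA := Ad_bo HU (hs h) (ht h) bf.
  rewrite /q !Rplus_0_l (fAd (hs h)) (hcomp_op_scal HU); last exact: bo_op_minus.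
  rewrite (hcomp_op_minus HU) // (hcomp_Ad HU) // hch -/C.
  by apply: op_ext => x; rewrite /op_scal /op_minus; cvec.
apply: Rle_trans (seminorm_minus_trans saD saP false 0 (Xh e (Xg 0 0)) (Xh e (Xq 0 0 h)) (Xs (freq (fr e)) XC)) _.
have t1 : p false 0 (op_minus (hcomp U e (g 0 0)) (hcomp U e (q 0 0 h))) <= eps / 2.
  rewrite (seminorm_minus_sym saD saP false 0 (Xh e (Xg 0 0)) (Xh e (Xq 0 0 h))).
  rewrite -(hcomp_op_minus HU); [| exact: (delta_dom_bo (Xq 0 0 h)) | exact: (delta_dom_bo (Xg 0 0))].
  by apply: Rle_trans (seminorm_comp2 HU saD saP UD UP false 0 e (Xm (Xq 0 0 h) (Xg 0 0))) _; lra.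
have t2 : p false 0 (op_minus (hcomp U e (q 0 0 h)) (op_scal (freq (fr e)) C)) <= eps / 2.
  have -> : op_minus (hcomp U e (q 0 0 h)) (op_scal (freq (fr e)) C) =
     op_scal (Cminus (Cmult (RtoC (/ h)) (Cminus (pchar (fr e) h) (RtoC 1))) (freq (fr e))) C.
    by rewrite E; apply: op_ext => x; rewrite /op_scal /op_minus; cvec.
  apply: Rle_trans (seminorm_scal saD saP false 0 _ XC) _.
  apply: Rle_trans (Rmult_le_compat_r _ _ _ C0 (diff_quot (fr e) h0)) _.
  rewrite Rmult_assoc -/K.
  apply: Rle_trans (_ : d2 * (K + 1) <= _); last by right; rewrite /d2; field; lra.
  by apply: Rmult_le_compat; [exact: Rabs_pos | | lra | lra].
lra.
Qed.

End Derivative.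

(** The given partial derivatives are first shown to be orbits, by induction in the second and then
    in the first variable; only for orbits does a differentiation multiply the components by a
    frequency. *)
Lemma smooth_derivatives T (Y : op H -> Prop) : (forall S, Y S -> X S) ->
  delta_smooth Y D P (fun s t => Ad U s t T) ->
  exists G : nat -> nat -> op H, forall i j, X (G i j) /\
    forall e, hcomp U e (G i j) = op_scal (der i j e) (hcomp U e T).
Proof.
move=> YX [F [F0 hF]].
have XF i j s t : X (F i j s t) by apply: YX; case: (hF i j).
have d1 i j s t : is_lim (fun h => p false 0 (op_minus (op_scal (RtoC (/ h))
     (op_minus (F i j (s + h) (t + 0)) (F i j s t))) (F (S i) j s t))) 0 0.
  by rewrite Rplus_0_r; case: (hF i j) => _ [_ [h _]]; exact: h.
have d2 i j s t : is_lim (fun h => p false 0 (op_minus (op_scal (RtoC (/ h))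
     (op_minus (F i j (s + 0) (t + h)) (F i j s t))) (F i (S j) s t))) 0 0.
  by rewrite Rplus_0_r; case: (hF i j) => _ [_ [_ h]]; exact: h.
have FAd i j : forall s t, F i j s t = Ad U s t (F i j 0 0).
  elim: i j => [|i IHi] j; last first.
    exact: (derivative_Ad (hs := fun h => h) (ht := fun _ => 0) (XF i j) (XF (S i) j) (IHi j) (d1 i j)).
  elim: j => [|j IHj].
    by move=> s t; rewrite !F0 (Ad_0 HU).
  exact: (derivative_Ad (hs := fun _ => 0) (ht := fun h => h) (XF 0%nat j) (XF 0%nat (S j)) IHj (d2 0%nat j)).
exists (fun i j => F i j 0 0) => i j; split=> // e.
elim: i => [|i IHi].
  elim: j => [|j IHj].
    rewrite F0 (Ad_0 HU) der_00; apply: op_ext => x; by rewrite /op_scal cscal_real scal_one.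
  rewrite (derivative_hcomp (hs := fun _ => 0) (ht := fun h => h) (XF 0%nat j) (XF 0%nat (S j)) (FAd 0%nat j) (d2 0%nat j) (fr := snd)).
    by rewrite IHj der_S2 op_scal_scal.
  by move=> h; rewrite pairchar_split {1}/pchar !Rmult_0_r cis_0 Cmult_1_l.
rewrite (derivative_hcomp (hs := fun h => h) (ht := fun _ => 0) (XF i j) (XF (S i) j) (FAd i j) (d1 i j) (fr := fst)).
  by rewrite IHi der_S1 op_scal_scal.
by move=> h; rewrite pairchar_split {2}/pchar !Rmult_0_r cis_0 Cmult_1_r.
Qed.

(** In each coordinate (1 + |m|)^N <= 2^N (1 + |m|^N), and |m| is at most the modulus of [freq m];
    multiplying the two coordinates out gives the four derivatives. *)
Lemma wt_der_le d N : wt d ^ N <= 4 ^ N * (Cmod (der 0 0 d) + Cmod (der N 0 d) + Cmod (der 0 N d) + Cmod (der N N d)).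
Proof.
rewrite /der !Cmod_mult !Cmod_pow /= /wt Rpow_mult_distr.
have a := pow_1p_le N (Rabs_pos (IZR (fst d))); have b := pow_1p_le N (Rabs_pos (IZR (snd d))).
have fr m : Rabs (IZR m) ^ N <= Cmod (freq m) ^ N.
  apply: pow_incr; split; first exact: Rabs_pos.
  by rewrite Cmod_freq; have := Rabs_pos (IZR m); have := PI2_1; have := PI_RGT_0; nra.
have c := fr (fst d); have e := fr (snd d).
have p1 : 0 <= (1 + Rabs (IZR (fst d))) ^ N by apply: pow_le; have := Rabs_pos (IZR (fst d)); lra.
have p2 : 0 <= (1 + Rabs (IZR (snd d))) ^ N by apply: pow_le; have := Rabs_pos (IZR (snd d)); lra.
have q : 0 < 2 ^ N by apply: pow_lt; lra.
have -> : 4 ^ N = 2 ^ N * 2 ^ N by rewrite -Rpow_mult_distr; f_equal; ring.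
apply: Rle_trans (Rmult_le_compat _ _ _ _ p1 p2 a b) _.
set u := Cmod (freq (fst d)) ^ N in c *; set v := Cmod (freq (snd d)) ^ N in e *.
have x0 : 0 <= Rabs (IZR (fst d)) ^ N by apply: pow_le; exact: Rabs_pos.
have y0 : 0 <= Rabs (IZR (snd d)) ^ N by apply: pow_le; exact: Rabs_pos.
have -> : 2 ^ N * (1 + Rabs (IZR (fst d)) ^ N) * (2 ^ N * (1 + Rabs (IZR (snd d)) ^ N)) =
  2 ^ N * 2 ^ N * ((1 + Rabs (IZR (fst d)) ^ N) * (1 + Rabs (IZR (snd d)) ^ N)) by ring.
apply: Rmult_le_compat_l; nra.
Qed.

(** Bounds with N + 2 in place of N leave a factor [/ wt d ^ 2], which is summable over Z^2. *)
Lemma decay_fam (c : Z * Z -> op H) : (forall d, X (c d)) -> (forall d, homog U d (c d)) ->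
  (forall j k a b, exists M, forall d, Cmod (der a b d) * p j k (c d) <= M) ->
  fam (fun d => d) c.
Proof.
move=> hX hh hM; split=> //; split=> // j k N.
have [M1 h1] := hM j k 0%nat 0%nat; have [M2 h2] := hM j k (N + 2)%nat 0%nat.
have [M3 h3] := hM j k 0%nat (N + 2)%nat; have [M4 h4] := hM j k (N + 2)%nat (N + 2)%nat.
pose M := 4 ^ (N + 2) * (M1 + M2 + M3 + M4).
have q : 0 < 4 ^ (N + 2) by apply: pow_lt; lra.
have key d : wt d ^ (N + 2) * p j k (c d) <= M.
  apply: Rle_trans (Rmult_le_compat_r _ _ _ (seminorm_pos j k (hX d)) (wt_der_le d (N + 2))) _.
  rewrite /M Rmult_assoc; apply: Rmult_le_compat_l; first lra.
  have := h1 d; have := h2 d; have := h3 d; have := h4 d; lra.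
have M0 : 0 <= M.
  apply: Rle_trans (key (0, 0)%Z); apply: Rmult_le_pos; last exact: seminorm_pos.
  by have := wt_pow_ge1 (0, 0)%Z (N + 2); lra.
apply: summable_le (summable_scal M0 summable_wt) _ => d.
have w0 : 0 < wt d ^ 2 by have := wt_pow_ge1 d 2; lra.
apply: (Rmult_le_reg_r (wt d ^ 2)) => //.
rewrite (Rmult_assoc M) Rinv_l ?Rmult_1_r; last lra.
by apply: Rle_trans (key d); rewrite pow_add; right; ring.
Qed.

Lemma hcomp_bigsum_id (c : Z * Z -> op H) e : fam (fun d => d) c -> hcomp U e (bigsum c) = c e.
Proof.
move=> hf; rewrite (hcomp_bigsum HU saD saP UD UP _ (fam_psummable hf)).
case: hf => hX [hh _].
have E : hcomp U e (c e) = c e by apply: (hcomp_of_homog HU); [exact: (delta_dom_bo (hX e)) | exact: hh].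
rewrite -[RHS]E; apply: (bigsum_single saD saP (c := fun i => hcomp U e (c i))); first exact: Xh.
by move=> i ne; apply: (hcomp_of_homog_ne HU (e := i)); [by move=> E'; apply: ne | exact: (delta_dom_bo (hX i)) | exact: hh].
Qed.

(** Components of the derivatives are components of T times [der], and taking components is
    contractive, whence the decay. The resulting sum has the components of T, so it is T by
    uniqueness; convergence of the Fourier series to T is not proved directly. *)
Lemma smooth_fam T (Y : op H -> Prop) : X T -> (forall S, Y S -> X S) ->
  delta_smooth Y D P (fun s t => Ad U s t T) ->
  fam (fun d => d) (fun d => hcomp U d T) /\ bigsum (fun d => hcomp U d T) = T.
Proof.
move=> hT YX hs; have [G hG] := smooth_derivatives YX hs.
have hf : fam (fun d => d) (fun d => hcomp U d T).
  apply: decay_fam.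
  - by move=> d; exact: Xh.
  - by move=> d; apply: (hcomp_homog HU); exact: (delta_dom_bo hT).
  move=> j k a b; exists (p j k (G a b)) => d; have [XG E] := hG a b.
  have XhT := Xh d hT.
  apply: Rle_trans (seminorm_comp2 HU saD saP UD UP j k d XG); rewrite E.
  exact: seminorm_scal_ge.
split=> //.
apply: (hcomp_unique HU).
- by apply: (delta_dom_bo (D := D) (P := P)); apply: (bigsum_X saD saP); exact: (fam_psummable hf).
- exact: (delta_dom_bo hT).
- by move=> d; rewrite hcomp_bigsum_id.
Qed.

End Smooth.

(** * The deformed algebra *)

Section Deformation.
Context {H : Hilbert}.
Variable U : R -> R -> op H.
Hypothesis HU : torus_unitary_rep U.
Variables D P : pop H.
Hypotheses (saD : selfadjoint D) (saP : selfadjoint P).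
Hypotheses (UD : forall s t, commutes (U s t) D) (UP : forall s t, commutes (U s t) P).
Variable A : op H -> Prop.
Hypothesis starA : star_algebra A.
Hypothesis Hsigma : forall s t a, A a -> A (Ad U s t a).
Hypothesis Hcont : forall a, A a -> delta_continuous D P (fun s t => Ad U s t a).
Hypothesis HA : forall a, A a <-> A_infty A D P U a.
Variable theta : R.
Notation X := (delta_dom D P).
Notation p := (delta_seminorm D P).
Notation bigsum := (bigsum D P).
Notation fam := (fam U D P).
Notation Cl := (delta_completion A D P).
Notation W := (twistU U theta).
Implicit Types (T S : op H).

Let Xp T S (hT : X T) (hS : X S) : X (op_plus T S) := proj1 (delta_dom_plus saD saP hT hS).
Let Xs z T (hT : X T) : X (op_scal z T) := proj1 (delta_dom_scal saD saP z hT).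
Let Xm T S (hT : X T) (hS : X S) : X (op_minus T S) := proj1 (delta_dom_minus saD saP hT hS).
Let XA s t T (hT : X T) : X (Ad U s t T) := proj1 (delta_dom_Ad HU saD saP UD UP s t hT).
Let Xh d T (hT : X T) : X (hcomp U d T) := proj1 (delta_dom_comp2 HU saD saP UD UP d hT).

Lemma A_X a : A a -> X a.
Proof. by move=> /HA [[h _] _]. Qed.

Lemma A_zero : A (@op_zero H).
Proof. by case: starA. Qed.
Lemma A_plus T S : A T -> A S -> A (op_plus T S).
Proof. by case: starA => _ [_ [h _]]; exact: h. Qed.
Lemma A_scal z T : A T -> A (op_scal z T).
Proof. by case: starA => _ [_ [_ [h _]]]; exact: h. Qed.
Lemma A_comp T S : A T -> A S -> A (op_comp T S).
Proof. by case: starA => _ [_ [_ [_ [h _]]]]; exact: h. Qed.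

Lemma completion_X T : Cl T -> X T.
Proof. by case. Qed.

(** Replaces the sequence by approximation in finitely many seminorms at a time; conversely, the
    n-th term is taken for the orders up to n and the precision 1/(n+1). *)
Lemma completion_approx T : Cl T <-> X T /\ forall K eps, 0 < eps -> exists a, A a /\
  forall j k, (k <= K)%nat -> p j k (op_minus a T) <= eps.
Proof.
split=> [[hT [a [ha lim]]]|[hT h]]; split=> //.
  move=> K eps e0.
  have [N hN] : exists N : nat, forall j k, (k <= K)%nat -> forall n, (N <= n)%nat -> p j k (op_minus (a n) T) <= eps.
    apply: (finite_uniform (le := le) (Q := fun j k N => forall n, (N <= n)%nat -> p j k (op_minus (a n) T) <= eps)).
    - by move=> x y; exists (x + y)%nat; lia.
    - by move=> j k x y q xy n yn; apply: q; lia.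
    - move=> j k; have /is_lim_seq_spec h := lim j k; have [N hN] := h (mkposreal eps e0).
      exists N => n hn; have := hN n hn; rewrite /= Rminus_0_r => /Rabs_def2 [q _]; lra.
  by exists (a N); split=> // j k hk; exact: hN.
have en n : 0 < / INR (S n) by apply: Rinv_0_lt_compat; apply: lt_0_INR; lia.
pose a n := proj1_sig (constructive_indefinite_description _ (h n _ (en n))).
have ha n : A (a n) /\ forall j k, (k <= n)%nat -> p j k (op_minus (a n) T) <= / INR (S n).
  exact: proj2_sig (constructive_indefinite_description _ (h n _ (en n))).
exists a; split; first by move=> n; case: (ha n).
move=> j k; apply/is_lim_seq_spec => eps.
have [N [hN N0]] := archimed_cor1 eps (cond_pos eps).
exists (N + k)%nat => n hn; rewrite Rminus_0_r Rabs_pos_eq; last first.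
  by apply: seminorm_pos; apply: Xm => //; apply: A_X; case: (ha n).
apply: Rle_lt_trans hN; case: (ha n) => _ q; apply: Rle_trans (q j k ltac:(lia)) _.
by apply: Rinv_le_contravar; [exact: lt_0_INR | apply: le_INR; lia].
Qed.

Lemma A_Cl a : A a -> Cl a.
Proof.
move=> ha; apply/completion_approx; split; first exact: A_X.
move=> K eps e0; exists a; split=> // j k _.
have -> : op_minus a a = @op_zero H by apply: op_ext => x; rewrite /op_minus /op_zero; cvec.
by rewrite (seminorm_zero saD saP); lra.
Qed.

Lemma completion_plus T S : Cl T -> Cl S -> Cl (op_plus T S).
Proof.
move=> /completion_approx [hT h] /completion_approx [hS h']; apply/completion_approx; split; first exact: Xp.
move=> K eps e0; have [a [ha qa]] := h K (eps / 2) ltac:(lra); have [b [hb qb]] := h' K (eps / 2) ltac:(lra).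
exists (op_plus a b); split; first exact: A_plus.
move=> j k hk.
have -> : op_minus (op_plus a b) (op_plus T S) = op_plus (op_minus a T) (op_minus b S).
  by apply: op_ext => x; rewrite /op_minus /op_plus; cvec.
apply: Rle_trans (seminorm_plus saD saP j k (Xm (A_X ha) hT) (Xm (A_X hb) hS)) _.
have := qa j k hk; have := qb j k hk; lra.
Qed.

Lemma completion_map T (phi : op H -> op H) C : 0 <= C -> (forall S, X S -> X (phi S)) ->
  (forall a, A a -> A (phi a)) -> (forall S S', X S -> X S' -> phi (op_minus S S') = op_minus (phi S) (phi S')) ->
  (forall j k S, X S -> p j k (phi S) <= C * p j k S) -> Cl T -> Cl (phi T).
Proof.
move=> C0 hX hA hm hb /completion_approx [hT h]; apply/completion_approx; split; first exact: hX.
move=> K eps e0; have [a [ha qa]] := h K (eps / (C + 1)) ltac:(apply: Rdiv_lt_0_compat; lra).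
exists (phi a); split; first exact: hA.
move=> j k hk; rewrite -hm //; last exact: A_X.
apply: Rle_trans (hb j k _ (Xm (A_X ha) hT)) _.
apply: Rle_trans (_ : (C + 1) * (eps / (C + 1)) <= _); last by right; field; lra.
by apply: Rmult_le_compat => //; [apply: seminorm_pos; apply: Xm => //; exact: A_X | lra | exact: qa].
Qed.

Lemma completion_scal z T : Cl T -> Cl (op_scal z T).
Proof.
apply: (completion_map (phi := op_scal z) (Cmod_ge_0 z)).
- by move=> S; exact: Xs.
- by move=> a; exact: A_scal.
- by move=> S S' _ _; apply: op_ext => x; rewrite /op_scal /op_minus; cvec.
- by move=> j k S hS; exact: seminorm_scal.
Qed.

Lemma completion_Ad s t T : Cl T -> Cl (Ad U s t T).
Proof.
apply: (completion_map (phi := Ad U s t) (Rle_0_1)).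
- by move=> S; exact: XA.
- by move=> a; exact: Hsigma.
- by move=> S S' _ _; exact: Ad_op_minus.
- by move=> j k S hS; rewrite Rmult_1_l; exact: (seminorm_Ad HU saD saP UD UP).
Qed.

Lemma completion_limit T : X T -> (forall K eps, 0 < eps -> exists S, Cl S /\
  forall j k, (k <= K)%nat -> p j k (op_minus S T) <= eps) -> Cl T.
Proof.
move=> hT h; apply/completion_approx; split=> // K eps e0.
have [S [/completion_approx [hS hS'] q]] := h K (eps / 2) ltac:(lra).
have [a [ha q']] := hS' K (eps / 2) ltac:(lra).
exists a; split=> // j k hk; apply: Rle_trans (seminorm_minus_trans saD saP j k (A_X ha) hS hT) _.
have := q j k hk; have := q' j k hk; lra.
Qed.

Lemma completion_bigsum (I : Type) (c : I -> op H) : psummable D P c -> (forall i, A (c i)) -> Cl (bigsum c).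
Proof.
move=> hs hA; have [hX h] := bigsum_spec saD saP hs; case: (hs) => hc _.
apply/completion_approx; split=> // K eps e0.
have [L0 hL] : exists L0 : list I, forall j k, (k <= K)%nat -> forall L, NoDup L -> incl L0 L ->
    p j k (op_minus (bigsum c) (fsum c L)) <= eps.
  apply: (finite_uniform (le := @incl I) (Q := fun j k L0 => forall L, NoDup L -> incl L0 L ->
    p j k (op_minus (bigsum c) (fsum c L)) <= eps)).
  - by move=> a b; exists (a ++ b); split=> x hx; apply: in_or_app; [left | right].
  - by move=> j k a b q ab L nd bL; apply: q => //; exact: (incl_tran ab bL).
  - by move=> j k; exact: h.
have [L [nd [hi _]]] := list_union L0 nil.
exists (fsum c L); split.
  by apply: fsum_ind => //; [exact: A_zero | exact: A_plus].
move=> j k hk; rewrite (seminorm_minus_sym saD saP j k (delta_dom_fsum saD saP L hc) hX); exact: hL.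
Qed.

Lemma fam_A (I : Type) (d : I -> Z * Z) c : fam d c -> (forall i, A (c i)) -> A (bigsum c).
Proof.
move=> hf hA; apply/HA; split; first exact: (completion_bigsum (fam_psummable hf)).
apply: (fam_smooth HU saD saP UD UP hf) => z hz; apply: completion_bigsum.
  exact: (fam_psummable (fam_scal HU saD saP hf hz)).
by move=> i; exact: A_scal.
Qed.

(** A homogeneous element is smooth, its orbit being a character times itself. It is written as a
    family over [unit], so that the general statement on families applies. *)
Lemma completion_homog_A d T : homog U d T -> Cl T -> A T.
Proof.
move=> hd hT; apply/HA; split=> //.
pose c (_ : unit) := T; pose dd (_ : unit) := d.
have hX := completion_X hT.
have hf : fam dd c.
  split=> //; split=> // j k N; exists (wt d ^ N * p j k T) => L nd.
  have n0 : 0 <= wt d ^ N * p j k T.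
    by apply: Rmult_le_pos; [have := wt_pow_ge1 d N; lra | exact: seminorm_pos].
  case: L nd => [|[] [|[] L]] nd /=; [done | by rewrite /c /dd; lra |].
  by inversion nd as [|? ? h]; case: h; left.
have single z : bigsum (fun i => op_scal (z i) (c i)) = op_scal (z tt) T.
  by apply: (bigsum_single saD saP (c := fun i => op_scal (z i) (c i)) (i0 := tt)); [exact: Xs | case].
have E : T = bigsum c.
  by apply: eq_sym; apply: (bigsum_single saD saP (c := c) (i0 := tt)) => //; case.
rewrite E; apply: (fam_smooth HU saD saP UD UP hf) => z hz.
by rewrite single; exact: completion_scal.
Qed.

Section AverageClosure.
Variable V : R -> op H.
Hypotheses (hV : ugroup V) (VD : forall t, commutes (V t) D) (VP : forall t, commutes (V t) P).

Lemma delta_dom_riemann m N n T : X T -> X (riemann V m N n T) /\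
  forall j k, Lam D P j k (riemann V m N n T) = riemann V m N n (Lam D P j k T).
Proof.
move=> hT; elim: n => [|n [IH E]] /=; first exact: delta_dom_zero.
have [a ea] := delta_dom_conj saD saP (INR n * / INR N) hV VD VP hT.
have [b eb] := delta_dom_scal saD saP (Cmult (RtoC (/ INR N)) (fchar m (INR n * / INR N))) a.
have [c ec] := delta_dom_plus saD saP IH b.
by split=> // j k; rewrite ec E eb ea.
Qed.

(** The Riemann sums lie in the completion, and [Lam] commutes both with them and with the average;
    so the norm estimate of [riemann_avg] applies to each [Lam j k T] and gives convergence in every
    seminorm. *)
Lemma completion_avg m T : Cl T -> (forall t S, Cl S -> Cl (conj V t S)) ->
  (forall j k eps, 0 < eps -> exists delta, 0 < delta /\ forall h, Rabs h < delta ->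
     p j k (op_minus (conj V h T) T) <= eps) -> Cl (avg V m T).
Proof.
move=> hT hc hcont; have XT := completion_X hT.
have [Xa Ea] := delta_dom_avg saD saP m hV VD VP XT.
apply: completion_limit => // K eps e0.
have Clr N n : Cl (riemann V m N n T).
  elim: n => [|n IH] /=; first by apply: A_Cl; exact: A_zero.
  by apply: completion_plus => //; apply: completion_scal; exact: hc.
have [N hN] : exists N : nat, forall j k, (k <= K)%nat -> forall n, (N <= n)%nat -> (0 < n)%nat ->
    p j k (op_minus (riemann V m n n T) (avg V m T)) <= eps.
  apply: (finite_uniform (le := le) (Q := fun j k N => forall n, (N <= n)%nat -> (0 < n)%nat ->
    p j k (op_minus (riemann V m n n T) (avg V m T)) <= eps)).
  - by move=> x y; exists (x + y)%nat; lia.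
  - by move=> j k x y q xy n yn n0; apply: q => //; lia.
  move=> j k; have [d1 [d10 h1]] := hcont j k (eps / 2) ltac:(lra).
  set B := Lam D P j k T; have bB : bounded_op B by exact: Lam_bo.
  have B0 := opnorm_pos bB.
  (* By [cis_lip], M |t| bounds |fchar m t - 1| times the norm of B, and d2 keeps it below eps /
     2. *)
  pose M := 2 * (2 * PI * Rabs (IZR m)) * opnorm B.
  have M0 : 0 <= M.
    by apply: Rmult_le_pos => //; have := PI_RGT_0; have := Rabs_pos (IZR m); nra.
  pose d2 := eps / (2 * (M + 1)).
  have d20 : 0 < d2 by apply: Rdiv_lt_0_compat; lra.
  have [N [hN N0]] := archimed_cor1 (Rmin d1 d2) (Rmin_pos _ _ d10 d20).
  exists N => n hn n0.
  have [Xr Er] := delta_dom_riemann m n n XT.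
  have [_ Em] := delta_dom_minus saD saP Xr Xa.
  rewrite seminorm_Lam Em Er Ea; apply: riemann_avg => //; first lra.
  move=> t ht.
  have tlt : Rabs t < Rmin d1 d2.
    apply: Rle_lt_trans ht _; apply: Rle_lt_trans hN.
    by apply: Rinv_le_contravar; [exact: lt_0_INR | apply: le_INR].
  have t1 := Rlt_le_trans _ _ _ tlt (Rmin_l _ _); have t2 := Rlt_le_trans _ _ _ tlt (Rmin_r _ _).
  have bc : bounded_op (conj V t B) by exact: conj_bo.
  have -> : op_minus (op_scal (fchar m t) (conj V t B)) B =
     op_plus (op_scal (fchar m t) (op_minus (conj V t B) B)) (op_scal (Cminus (fchar m t) (RtoC 1)) B).
    by apply: op_ext => x; rewrite /op_minus /op_plus /op_scal; cvec.
  have bm := bo_op_minus bc bB.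
  apply: Rle_trans (opnorm_plus (bo_op_scal _ bm) (bo_op_scal _ bB)) _.
  have a1 := opnorm_scal (fchar m t) bm; rewrite Cmod_fchar Rmult_1_l in a1.
  have a2 := opnorm_scal (Cminus (fchar m t) (RtoC 1)) bB.
  have a3 := h1 t t1.
  have [Xc Ec] := delta_dom_conj saD saP t hV VD VP XT.
  have [_ Em'] := delta_dom_minus saD saP Xc XT; rewrite seminorm_Lam Em' Ec -/B in a3.
  have a4 : Cmod (Cminus (fchar m t) (RtoC 1)) * opnorm B <= eps / 2.
    have q := cis_lip (- (2 * PI * (IZR m * t))); rewrite -/(fchar m t) in q.
    apply: Rle_trans (Rmult_le_compat_r _ _ _ B0 q) _.
    have -> : Rabs (- (2 * PI * (IZR m * t))) = 2 * PI * (Rabs (IZR m) * Rabs t).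
      by rewrite Rabs_Ropp Rabs_mult (Rabs_pos_eq (2 * PI)) ?Rabs_mult //; have := PI_RGT_0; lra.
    apply: Rle_trans (_ : (M + 1) * d2 <= _); last by right; rewrite /d2; field; lra.
    have -> : 2 * (2 * PI * (Rabs (IZR m) * Rabs t)) * opnorm B = M * Rabs t by rewrite /M; ring.
    by apply: Rmult_le_compat => //; [exact: Rabs_pos | lra | lra].
  lra.
exists (riemann V m (S N) (S N) T); split; first exact: Clr.
by move=> j k hk; apply: hN => //; lia.
Qed.

End AverageClosure.

Let V1D t : commutes (V1 U t) D := @UD t 0.
Let V1P t : commutes (V1 U t) P := @UP t 0.
Let V2D t : commutes (V2 U t) D := @UD 0 t.
Let V2P t : commutes (V2 U t) P := @UP 0 t.

Let conj1_Ad t S : conj (V1 U) t S = Ad U t 0 S.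
Proof. by rewrite (Ad_conj HU) (conj_0 (ugroup_V2 HU)). Qed.

Let conj2_Ad t S : conj (V2 U) t S = Ad U 0 t S.
Proof. by rewrite (Ad_conj HU) (conj_0 (ugroup_V1 HU)). Qed.

Lemma A_cont0 a j k eps : A a -> 0 < eps -> exists delta, 0 < delta /\ forall s t,
  Rabs s < delta -> Rabs t < delta -> p j k (op_minus (Ad U s t a) a) <= eps.
Proof.
move=> ha e0; have := Hcont ha j k 0 0.
move=> /(proj1 (filterlim_locally _ _)) /(_ (mkposreal eps e0)) [d hd].
exists d; split; first exact: cond_pos.
move=> s t hs ht.
have B : ball ((0, 0) : R * R) d (s, t).
  by split; [change (Rabs (s - 0) < d) | change (Rabs (t - 0) < d)]; rewrite Rminus_0_r.
have Q : Rabs (p j k (op_minus (Ad U s t a) (Ad U 0 0 a)) - 0) < eps := hd (s, t) B.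
move: Q; rewrite (Ad_0 HU) Rminus_0_r => /Rabs_def2 [q _]; lra.
Qed.

(** The average along the second circle inherits continuity for the first one: conjugation along one
    circle commutes with averaging along the other, which does not increase the seminorms. *)
Lemma completion_hcomp a d : A a -> Cl (hcomp U d a).
Proof.
move=> ha; have Xa := A_X ha.
have [Xb _] := delta_dom_avg saD saP (snd d) (ugroup_V2 HU) V2D V2P Xa.
apply: (completion_avg (ugroup_V1 HU) V1D V1P).
- apply: (completion_avg (ugroup_V2 HU) V2D V2P).
  + exact: A_Cl.
  + by move=> t S hS; rewrite conj2_Ad; exact: completion_Ad.
  + move=> j k eps e0; have [dl [dl0 h]] := A_cont0 j k ha e0; exists dl; split=> // x hx.
    by rewrite conj2_Ad; apply: h => //; rewrite Rabs_R0.
- by move=> t S hS; rewrite conj1_Ad; exact: completion_Ad.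
- move=> j k eps e0; have [dl [dl0 h]] := A_cont0 j k ha e0; exists dl; split=> // x hx.
  have Xd : X (op_minus (Ad U x 0 a) a) by apply: Xm => //; exact: XA.
  have [Xe Ee] := delta_dom_avg saD saP (snd d) (ugroup_V2 HU) V2D V2P Xd.
  apply: Rle_trans (_ : p j k (avg (V2 U) (snd d) (op_minus (Ad U x 0 a) a)) <= _); last first.
    apply: Rle_trans (_ : p j k (op_minus (Ad U x 0 a) a) <= _); last by apply: h => //; rewrite Rabs_R0.
    by rewrite !seminorm_Lam Ee; apply: (avg_le (ugroup_V2 HU)); exact: Lam_bo.
  right; congr (p j k _); rewrite -conj1_Ad !op_minus_plus.
  have ba := delta_dom_bo Xa.
  have b1 : bounded_op (conj (V1 U) x a) by apply: conj_bo => //; exact: ugroup_V1.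
  rewrite (avg_op_plus (ugroup_V2 HU)) //; last exact: bo_op_scal.
  by rewrite (avg_op_scal (ugroup_V2 HU)) // conj1_avg2.
Qed.

Lemma A_hcomp a d : A a -> A (hcomp U d a).
Proof.
move=> ha; apply: (@completion_homog_A d); last exact: completion_hcomp.
by apply: (hcomp_homog HU); exact: (delta_dom_bo (A_X ha)).
Qed.

Lemma A_fam a : A a -> fam (fun d => d) (fun d => hcomp U d a) /\ bigsum (fun d => hcomp U d a) = a.
Proof.
move=> ha; apply: (smooth_fam HU saD saP UD UP (A_X ha) completion_X).
by case: (proj1 (HA a) ha).
Qed.

Lemma fam_W (I : Type) (d : I -> Z * Z) c : fam d c -> fam d (fun i => op_comp (W (d i)) (c i)).
Proof.
move=> hf; exact: (fam_leftU HU saD saP UD UP (fun d => - (theta * IZR (snd d) / 2)) (fun d => theta * IZR (fst d) / 2) hf).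
Qed.

(** The seminorm with j = false and k = 0 is the operator norm, so the sum satisfies [is_deform];
    two norm limits along finite subsets coincide, which fixes the chosen value. *)
Lemma deform_bigsum_Z2 T : X T -> fam (fun d => d) (fun d => hcomp U d T) ->
  deform U theta T = bigsum (fun d => op_comp (W d) (hcomp U d T)).
Proof.
move=> hT hf; have bT := delta_dom_bo hT.
have hps := fam_psummable (fam_W hf); have [XS hS] := bigsum_spec saD saP hps.
set S := bigsum _ in XS hS *.
have E L : deform_partial_sum U theta T L = fsum (fun d => op_comp (W d) (hcomp U d T)) L.
  elim: L => //= d L ->; congr op_plus.
  rewrite (spectral_component_hcomp HU) // -surjective_pairing.
  rewrite (@twist_homog H U HU theta (fst d) (snd d) (hcomp U d T)) -?surjective_pairing //.
    exact: hcomp_bo.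
  exact: hcomp_homog.
have ok : is_deform U theta T S.
  split; first exact: (delta_dom_bo XS).
  move=> eps e0; have [L0 h] := hS false O (eps / 2) ltac:(lra).
  by exists L0 => L nd hi; rewrite E; apply: Rle_lt_trans (h L nd hi) _; lra.
have [bS' hS'] : is_deform U theta T (deform U theta T).
  by apply: epsilon_spec; exists S.
case: ok => bS hok.
apply: opnorm_small_eq => // eps e0.
have [L0 h0] := hS' (eps / 2) ltac:(lra); have [L1 h1] := hok (eps / 2) ltac:(lra).
have [L [nd [i0 i1]]] := list_union L0 L1.
have bF : bounded_op (deform_partial_sum U theta T L).
  by rewrite E; apply: fsum_bo => d; apply: bo_op_comp; [exact: U_bo | exact: hcomp_bo].
apply: Rle_trans (opnorm_minus_trans bS' bF bS) _.
rewrite (opnorm_minus_sym bF bS); have := h0 L nd i0; have := h1 L nd i1; lra.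
Qed.

(** Degrees may repeat in the family, so the two sides are compared by components: in degree e both
    are [W e] applied to the component of the undeformed sum. *)
Lemma deform_bigsum (I : Type) (d : I -> Z * Z) c : fam d c ->
  deform U theta (bigsum c) = bigsum (fun i => op_comp (W (d i)) (c i)).
Proof.
move=> hf; set T := bigsum c.
have hps := fam_psummable hf; have hW := fam_W hf.
have XT : X T := bigsum_X saD saP hps.
have [hfT _] : fam (fun d => d) (fun d => hcomp U d T) /\ bigsum (fun d => hcomp U d T) = T.
  apply: (smooth_fam HU saD saP UD UP XT (Y := X)) => //.
  apply: (fam_smooth HU saD saP UD UP hf) => z hz.
  exact: (bigsum_X saD saP (fam_psummable (fam_scal HU saD saP hf hz))).
rewrite (deform_bigsum_Z2 XT hfT).
have hWT := fam_W hfT.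
apply: (hcomp_unique HU).
- exact: (delta_dom_bo (bigsum_X saD saP (fam_psummable hWT))).
- exact: (delta_dom_bo (bigsum_X saD saP (fam_psummable hW))).
move=> e; rewrite (hcomp_bigsum_id HU saD saP UD UP e hWT).
rewrite (hcomp_bigsum HU saD saP UD UP e (fam_psummable hW)) /T (hcomp_bigsum HU saD saP UD UP e hps).
case: (hf) => hX [hh hs].
have hps' : psummable D P (fun i => hcomp U e (c i)).
  split; first by move=> i; exact: Xh.
  move=> j k; case: hps => _ hs'; apply: summable_le (hs' j k) _ => i.
  exact: (seminorm_comp2 HU saD saP UD UP).
have XW d' T' : X T' -> X (op_comp (W d') T').
  by move=> hT'; case: (delta_dom_leftU HU saD saP UD UP (- (theta * IZR (snd d') / 2)) (theta * IZR (fst d') / 2) hT').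
have lin : forall T' S', op_comp (W e) (op_plus T' S') = op_plus (op_comp (W e) T') (op_comp (W e) S').
  by move=> T' S'; apply: op_ext => x; rewrite /op_comp /op_plus /twistU (bo_plus (U_bo HU _ _)).
rewrite -(bigsum_map saD saP (phi := op_comp (W e)) hps').
- apply: bigsum_ext => i.
  have bc := delta_dom_bo (hX i); have bWc := delta_dom_bo (XW (d i) _ (hX i)).
  have hWh : homog U (d i) (op_comp (W (d i)) (c i)) by apply: (homog_left_U HU); exact: hh.
  case: (eq_dec_classic (d i) e) => [E|ne].
    by rewrite -E (hcomp_of_homog HU bc (hh i)) (hcomp_of_homog HU bWc hWh).
  rewrite (hcomp_of_homog_ne HU (e := d i) _ bc (hh i)); last by move=> E; apply: ne.
  rewrite (hcomp_of_homog_ne HU (e := d i) _ bWc hWh); last by move=> E; apply: ne.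
  by apply: op_ext => x; rewrite /op_comp /op_zero /twistU (bo_zero (U_bo HU _ _)).
- by move=> T'; exact: XW.
- by move=> T' S' _ _; exact: lin.
- by move=> T' S' _ _; apply: op_ext => x; rewrite /op_comp /op_minus /twistU (bo_minus (U_bo HU _ _)).
- by apply: op_ext => x; rewrite /op_comp /op_zero /twistU (bo_zero (U_bo HU _ _)).
- move=> j k; exists 1; split; first lra.
  move=> T' hT'; rewrite Rmult_1_l.
  by case: (delta_dom_leftU HU saD saP UD UP (- (theta * IZR (snd e) / 2)) (theta * IZR (fst e) / 2) hT') => _; apply.
Qed.

Notation At := (A_theta A U theta).

Lemma A_theta_intro (I : Type) (d : I -> Z * Z) c : fam d c -> (forall i, A (c i)) ->
  At (bigsum (fun i => op_comp (W (d i)) (c i))).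
Proof. by move=> hf hA; exists (bigsum c); split; [exact: (fam_A hf) | rewrite (deform_bigsum hf)]. Qed.

Lemma A_theta_elim T : At T -> exists c : Z * Z -> op H, fam (fun d => d) c /\ (forall d, A (c d)) /\
  T = bigsum (fun d => op_comp (W d) (c d)).
Proof.
move=> [a [ha ->]]; have [hf E] := A_fam ha.
exists (fun d => hcomp U d a); split=> //; split; first by move=> d; exact: A_hcomp.
by rewrite -{1}E (deform_bigsum hf).
Qed.

Lemma A_theta_X T : At T -> X T.
Proof. by move=> /A_theta_elim [c [hf [_ ->]]]; exact: (bigsum_X saD saP (fam_psummable (fam_W hf))). Qed.

End Deformation.

(** * Compact operators *)

Section Compact.
Context {H : Hilbert}.
Implicit Types (T S K : op H).

Definition increasing (phi : nat -> nat) := forall n, (phi n < phi (S n))%nat.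

Lemma increasing_lt phi : increasing phi -> forall n m, (n < m)%nat -> (phi n < phi m)%nat.
Proof.
move=> h n m; elim: m => [|m IH] nm; first lia.
case: (Nat.eq_dec n m) => [->|ne]; first exact: h.
by have := IH ltac:(lia); have := h m; lia.
Qed.

Lemma increasing_ge phi : increasing phi -> forall n, (n <= phi n)%nat.
Proof. by move=> h; elim=> [|n IH]; [lia | have := h n; lia]. Qed.

Lemma filterlim_seq_eps (v : nat -> H) l : filterlim v eventually (locally l) <->
  forall eps, 0 < eps -> exists N, forall n, (N <= n)%nat -> norm (minus (v n) l) <= eps.
Proof.
have f0 := @norm_factor_gt_0 _ H.
split=> h.
  move=> eps e0.
  have e1 : 0 < eps / norm_factor (V := H) by apply: Rdiv_lt_0_compat.
  have [N hN] := proj1 (filterlim_locally v l) h (mkposreal _ e1).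
  exists N => n /hN /norm_compat2 /=.
  have -> : norm_factor (V := H) * (eps / norm_factor (V := H)) = eps by field; lra.
  exact: Rlt_le.
apply/filterlim_locally => eps.
have [N hN] := h (eps / 2) ltac:(have := cond_pos eps; lra).
exists N => n hn; apply: norm_compat1.
by apply: Rle_lt_trans (hN n hn) _; have := cond_pos eps; lra.
Qed.

Lemma compact_osc K (u : nat -> H) M eps : compact_op K -> (forall n, norm (u n) <= M) -> 0 < eps ->
  exists phi, increasing phi /\ forall n m, norm (minus (K (u (phi n))) (K (u (phi m)))) <= eps.
Proof.
move=> hK hu e0; have [phi [l [inc lim]]] := hK u (ex_intro _ M hu).
have [N hN] := proj1 (filterlim_seq_eps _ _) lim (eps / 2) ltac:(lra).
exists (fun n => phi (N + n)%nat); split.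
  by move=> n; rewrite Nat.add_succ_r; exact: inc.
move=> n m; apply: Rle_trans (norm_minus_trans _ l _) _.
rewrite (norm_minus_sym l); have := hN (N + n)%nat ltac:(lia); have := hN (N + m)%nat ltac:(lia); lra.
Qed.

(** Diagonal argument: the n-th refinement makes the images oscillate by at most 1/(n+1), and the
    diagonal sequence is eventually a subsequence of each refinement. *)
Lemma compact_limit K : (forall eps, 0 < eps -> exists K', compact_op K' /\
  forall x, norm (minus (K x) (K' x)) <= eps * norm x) -> compact_op K.
Proof.
move=> h u [M hu].
(* The bound on v is put inside the existential, so that the choice of [phi] is defined for every
   sequence and can be iterated in [psi]. *)
have osc (v : nat -> H) (n : nat) : exists phi, (forall i, norm (v i) <= M) -> increasing phi /\
    forall i j, norm (minus (K (v (phi i))) (K (v (phi j)))) <= / INR (S n).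
  case: (excluded_middle_informative (forall i, norm (v i) <= M)) => hv; last by exists (fun i => i).
  have e0 : 0 < / INR (S n) by apply: Rinv_0_lt_compat; apply: lt_0_INR; lia.
  have M0 : 0 <= M by apply: Rle_trans (norm_pos _) (hv O).
  have e1 : 0 < / INR (S n) / (3 * (M + 1)) by apply: Rdiv_lt_0_compat; lra.
  have [K' [cK hK]] := h _ e1.
  have [phi [inc ho]] := compact_osc cK hv (eps := / INR (S n) / 3) ltac:(lra).
  exists phi => _; split=> // i j.
  have b x : norm x <= M -> norm (minus (K x) (K' x)) <= / INR (S n) / 3.
    move=> hx; apply: Rle_trans (hK x) _.
    apply: Rle_trans (_ : / INR (S n) / (3 * (M + 1)) * (M + 1) <= _).
      by apply: Rmult_le_compat_l; lra.
    by right; set r := / INR (S n); field; lra.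
  apply: Rle_trans (norm_minus_trans _ (K' (v (phi i))) _) _.
  have a1 := b _ (hv (phi i)); have a2 := b _ (hv (phi j)); have a3 := ho i j.
  have := norm_minus_trans (K' (v (phi i))) (K' (v (phi j))) (K (v (phi j))).
  rewrite (norm_minus_sym (K' (v (phi j))) (K (v (phi j)))); lra.
pose ch v n := proj1_sig (constructive_indefinite_description _ (osc v n)).
have hch v n : (forall i, norm (v i) <= M) -> increasing (ch v n) /\
    forall i j, norm (minus (K (v (ch v n i))) (K (v (ch v n j)))) <= / INR (S n).
  exact: proj2_sig (constructive_indefinite_description _ (osc v n)).
pose psi := fix psi (n : nat) : nat -> nat := match n with
  | O => fun i => i
  | S n => fun i => psi n (ch (fun i => u (psi n i)) n i) end.
have pS n i : psi (S n) i = psi n (ch (fun i => u (psi n i)) n i) by [].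
have hpsi n := hch (fun i => u (psi n i)) n (fun i => hu (psi n i)).
have inc n : increasing (psi n).
  elim: n => [|n IH] i; first by rewrite /=; lia.
  rewrite !pS; apply: (increasing_lt IH); case: (hpsi n) => q _; exact: q.
have diag k n : exists i, psi (k + n)%nat (k + n)%nat = psi k i.
  have gen j : exists i, psi (k + n)%nat j = psi k i.
    elim: n j => [|n IH] j; first by exists j; rewrite Nat.add_0_r.
    by rewrite Nat.add_succ_r pS; exact: IH.
  exact: gen.
have small eps : 0 < eps -> exists N, / INR (S N) <= eps.
  move=> e0; have [N [hN N0]] := archimed_cor1 eps e0; exists N.
  by apply: Rle_trans (Rlt_le _ _ hN); apply: Rinv_le_contravar; [exact: lt_0_INR | apply: le_INR; lia].
have [l hl] : exists l, forall eps, 0 < eps -> exists N, forall n, (N <= n)%nat ->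
    norm (minus (K (u (psi n n))) l) <= eps.
  apply: (cauchy_complete (u := fun n => K (u (psi n n)))) => eps e0.
  (* [psi 0] is the identity, so the oscillation bound 1/(N+1) first holds along [psi (S N)]. *)
  have [N hN] := small eps e0; exists (S N) => n m hn hm.
  have [i Ei] := diag (S N) (n - S N)%nat; have [j Ej] := diag (S N) (m - S N)%nat.
  have En : (S N + (n - S N) = n)%nat by lia.
  have Em : (S N + (m - S N) = m)%nat by lia.
  rewrite En in Ei; rewrite Em in Ej; rewrite Ei Ej !pS.
  by apply: Rle_trans hN; case: (hpsi N) => _; apply.
exists (fun n => psi n n), l; split; last exact/filterlim_seq_eps.
move=> n; rewrite pS; apply: (increasing_lt (inc n)).
by case: (hpsi n) => q _; have := increasing_ge q (S n); lia.
Qed.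

Lemma compact_zero : compact_op (fun _ : H => zero).
Proof.
move=> u _; exists (fun n => n), zero; split; first by move=> n; lia.
exact: filterlim_const.
Qed.

Lemma compact_plus K K' : compact_op K -> compact_op K' -> compact_op (op_plus K K').
Proof.
move=> hK hK' u [M hu].
have [phi [l [inc lim]]] := hK u (ex_intro _ M hu).
have [psi [l' [inc' lim']]] := hK' (fun n => u (phi n)) (ex_intro _ M (fun n => hu (phi n))).
exists (fun n => phi (psi n)), (plus l l'); split.
  by move=> n; apply: (increasing_lt inc); exact: inc'.
apply/filterlim_seq_eps => eps e0.
have [N hN] := proj1 (filterlim_seq_eps _ _) lim (eps / 2) ltac:(lra).
have [N' hN'] := proj1 (filterlim_seq_eps _ _) lim' (eps / 2) ltac:(lra).
exists (N + N')%nat => n hn; rewrite /op_plus.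
have -> : minus (plus (K (u (phi (psi n)))) (K' (u (phi (psi n))))) (plus l l') =
   plus (minus (K (u (phi (psi n)))) l) (minus (K' (u (phi (psi n)))) l') by cvec.
apply: Rle_trans (norm_le_plus _ _) _.
have a := increasing_ge inc' n.
have := hN (psi n) ltac:(lia); have := hN' n ltac:(lia); lra.
Qed.

Lemma compact_left T K : bounded_op T -> compact_op K -> compact_op (fun x => T (K x)).
Proof.
move=> bT hK u hu; have [phi [l [inc lim]]] := hK u hu.
exists phi, (T l); split=> //; exact: (filterlim_comp _ _ _ _ _ _ _ _ lim (bo_continuous bT (x := l))).
Qed.

End Compact.

(** * Products of families *)

Section Products.
Context {H : Hilbert}.
Variable U : R -> R -> op H.
Hypothesis HU : torus_unitary_rep U.
Variables D P : pop H.
Hypotheses (saD : selfadjoint D) (saP : selfadjoint P).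
Hypotheses (UD : forall s t, commutes (U s t) D) (UP : forall s t, commutes (U s t) P).
Notation X := (delta_dom D P).
Notation p := (delta_seminorm D P).
Notation bigsum := (bigsum D P).
Notation fam := (fam U D P).
Variables I J : Type.
Variables (d : I -> Z * Z) (c : I -> op H) (d' : J -> Z * Z) (c' : J -> op H).
Hypotheses (hf : fam d c) (hf' : fam d' c').

Let summable_psum (I0 : Type) (e : I0 -> Z * Z) (b : I0 -> op H) k N : fam e b ->
  summable (fun i => wt (e i) ^ N * psum D P k (b i)).
Proof.
move=> [_ [_ hs]].
have S1 j : summable (fun i => wt (e i) ^ N * nsum k (fun l => Lam D P j l (b i))).
  elim: k => [|k IH]; first exact: (hs j O N).
  apply: summable_le (summable_plus IH (hs j (S k) N)) _ => i.
  by rewrite -Rmult_plus_distr_l; right.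
apply: summable_le (summable_plus (S1 false) (S1 true)) _ => i.
by rewrite -Rmult_plus_distr_l; right.
Qed.

Let cc (ij : I * J) := op_comp (c (fst ij)) (c' (snd ij)).

(** The weight is submultiplicative and the Leibniz bound factors, so the double family is dominated
    by a product of two summable families. *)
Lemma fam_prod : fam (fun ij => dadd (d (fst ij)) (d' (snd ij))) (fun ij => op_comp (c (fst ij)) (c' (snd ij))).
Proof.
case: (hf) => hX [hh hs]; case: (hf') => hX' [hh' hs'].
split; first by move=> [i j]; exact: delta_dom_comp.
split; first by move=> [i j]; apply: (homog_op_comp HU) => //; exact: (delta_dom_bo (hX i)).
move=> j k N.
have w0 e : 0 <= wt e ^ N by have := wt_pow_ge1 e N; lra.
have q : 0 <= 2 ^ k by apply: pow_le; lra.
have n1 i : 0 <= wt (d i) ^ N * psum D P k (c i) by apply: Rmult_le_pos => //; exact: psum_pos.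
have n2 i : 0 <= wt (d' i) ^ N * psum D P k (c' i) by apply: Rmult_le_pos => //; exact: psum_pos.
apply: summable_le (summable_scal q (summable_prod n1 n2 (summable_psum k N hf) (summable_psum k N hf'))) _.
move=> [a b] /=.
have e1 := seminorm_comp saD saP j k (hX a) (hX' b).
have e2 : wt (dadd (d a) (d' b)) ^ N <= wt (d a) ^ N * wt (d' b) ^ N.
  rewrite -Rpow_mult_distr; apply: pow_incr; split; last exact: wt_dadd.
  by have := wt_ge1 (dadd (d a) (d' b)); lra.
apply: Rle_trans (Rmult_le_compat _ _ _ _ (w0 _) (seminorm_pos j k (delta_dom_comp saD saP (hX a) (hX' b))) e2 e1) _.
by right; ring.
Qed.

Lemma fsum_list_prod L L' : fsum cc (list_prod L L') = op_comp (fsum c L) (fsum c' L').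
Proof.
case: (hf) => hX _.
elim: L => [|a L IH] //=.
have mapE : fsum cc (map (fun y => (a, y)) L') = op_comp (c a) (fsum c' L').
  have ba := delta_dom_bo (hX a).
  elim: L' {IH} => [|b L' IH'] /=.
    by apply: op_ext => x; rewrite /op_comp /op_zero (bo_zero ba).
  by rewrite IH'; apply: op_ext => x; rewrite /op_plus /op_comp (bo_plus ba).
by rewrite fsum_app IH mapE.
Qed.

(** A product of partial sums is a partial sum of the double family over a rectangle; the rectangle
    is enlarged to contain any prescribed finite set of pairs. *)
Lemma bigsum_prod : op_comp (bigsum c) (bigsum c') =
  bigsum (fun ij => op_comp (c (fst ij)) (c' (snd ij))).
Proof.
have [XS hS] := bigsum_spec saD saP (fam_psummable hf).
have [XS' hS'] := bigsum_spec saD saP (fam_psummable hf').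
have [XR hR] := bigsum_spec saD saP (fam_psummable fam_prod).
set S := bigsum c in XS hS *; set S' := bigsum c' in XS' hS' *; set R0 := bigsum _ in XR hR *.
have bS := delta_dom_bo XS; have bS' := delta_dom_bo XS'; have bR := delta_dom_bo XR.
have s0 := opnorm_pos bS; have s0' := opnorm_pos bS'.
have bSS := bo_op_comp bS bS'.
apply: (opnorm_small_eq bSS bR) => eps e0.
(* The error |S - F1| |S'| + |F1| |S' - F2| is at most eta times |S'| + |S| + 1; capping eta at 1 is
   what bounds |F1| by |S| + 1. *)
pose q := opnorm S + opnorm S' + 2.
pose eta := Rmin 1 (eps / (2 * q)).
have q0 : 0 < q by rewrite /q; lra.
have eta0 : 0 < eta by apply: Rmin_pos; [lra | apply: Rdiv_lt_0_compat; lra].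
have eta1 : eta <= 1 := Rmin_l _ _.
have eta2 : eta * q <= eps / 2.
  apply: Rle_trans (Rmult_le_compat_r _ _ _ (Rlt_le _ _ q0) (Rmin_r _ _)) _.
  by right; field; lra.
have [L0 hL0] := hR false O (eps / 2) ltac:(lra).
have [A1 hA1] := hS false O eta eta0; have [A2 hA2] := hS' false O eta eta0.
have [L1 [n1 [i1 j1]]] := list_union A1 (map fst L0).
have [L2 [n2 [i2 j2]]] := list_union A2 (map snd L0).
have a1 : opnorm (op_minus S (fsum c L1)) <= eta := hA1 L1 n1 i1.
have a2 : opnorm (op_minus S' (fsum c' L2)) <= eta := hA2 L2 n2 i2.
have nd : NoDup (list_prod L1 L2).
  elim: L1 n1 {i1 j1 a1} => [|a L1 IH] n1 /=; first exact: NoDup_nil.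
  inversion_clear n1 as [|? ? na n1'].
  apply: NoDup_app; [| exact: IH |].
    by apply: FinFun.Injective_map_NoDup => // x y [].
  by move=> [x y] /in_map_iff [z [[E _] _]] /in_prod_iff [hx _]; apply: na; rewrite E.
have hi : incl L0 (list_prod L1 L2).
  move=> [x y] hxy; apply: in_prod; [apply: j1; exact: (in_map fst _ _ hxy) | apply: j2; exact: (in_map snd _ _ hxy)].
have a3 : opnorm (op_minus R0 (fsum cc (list_prod L1 L2))) <= eps / 2 := hL0 _ nd hi.
rewrite fsum_list_prod in a3.
case: (hf) => hX _; case: (hf') => hX' _.
have bF1 : bounded_op (fsum c L1) by apply: fsum_bo => i; exact: (delta_dom_bo (hX i)).
have bF2 : bounded_op (fsum c' L2) by apply: fsum_bo => i; exact: (delta_dom_bo (hX' i)).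
have bFF := bo_op_comp bF1 bF2.
apply: Rle_trans (opnorm_minus_trans bSS bFF bR) _.
rewrite (opnorm_minus_sym bFF bR).
have bm1 := bo_op_minus bS bF1; have bm2 := bo_op_minus bS' bF2.
have : opnorm (op_minus (op_comp S S') (op_comp (fsum c L1) (fsum c' L2))) <= eta * q.
  have -> : op_minus (op_comp S S') (op_comp (fsum c L1) (fsum c' L2)) =
    op_plus (op_comp (op_minus S (fsum c L1)) S') (op_comp (fsum c L1) (op_minus S' (fsum c' L2))).
    by apply: op_ext => x; rewrite /op_minus /op_plus /op_comp (bo_minus bF1); cvec.
  apply: Rle_trans (opnorm_plus (bo_op_comp bm1 bS') (bo_op_comp bF1 bm2)) _.
  have e1 := opnorm_comp bm1 bS'; have e2 := opnorm_comp bF1 bm2.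
  have e3 : opnorm (fsum c L1) <= opnorm S + eta.
    have -> : fsum c L1 = op_minus S (op_minus S (fsum c L1)) by apply: op_ext => x; rewrite /op_minus; cvec.
    rewrite op_minus_plus; apply: Rle_trans (opnorm_plus bS (bo_op_scal _ bm1)) _.
    apply: Rplus_le_compat_l; apply: Rle_trans (opnorm_scal _ bm1) _.
    by rewrite Cmod_R Rabs_left; lra.
  have p1 := opnorm_pos bm1; have p2 := opnorm_pos bm2; have p3 := opnorm_pos bF1.
  have m1 : opnorm (op_minus S (fsum c L1)) * opnorm S' <= eta * opnorm S' by nra.
  have m2 : opnorm (fsum c L1) * opnorm (op_minus S' (fsum c' L2)) <= (opnorm S + 1) * eta.
    by apply: Rmult_le_compat => //; lra.
  rewrite /q; nra.
lra.
Qed.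

End Products.

(** * The deformed spectral triple *)

Section DeformedTriple.
Context {H : Hilbert}.
Variable U : R -> R -> op H.
Hypothesis HU : torus_unitary_rep U.
Variables D P : pop H.
Hypotheses (saD : selfadjoint D) (saP : selfadjoint P).
Hypotheses (UD : forall s t, commutes (U s t) D) (UP : forall s t, commutes (U s t) P).
Variable A : op H -> Prop.
Hypothesis starA : star_algebra A.
Hypothesis Hsigma : forall s t a, A a -> A (Ad U s t a).
Hypothesis Hcont : forall a, A a -> delta_continuous D P (fun s t => Ad U s t a).
Hypothesis HA : forall a, A a <-> A_infty A D P U a.
Variable theta : R.
Notation X := (delta_dom D P).
Notation p := (delta_seminorm D P).
Notation bigsum := (bigsum D P).
Notation fam := (fam U D P).
Notation W := (twistU U theta).
Notation At := (A_theta A U theta).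
Implicit Types (T S : op H).

Let intro I d c h1 h2 := @A_theta_intro H U HU D P saD saP UD UP A starA HA theta I d c h1 h2.
Let elim T h := @A_theta_elim H U HU D P saD saP UD UP A starA Hsigma Hcont HA theta T h.
Let famW I d c h := @fam_W H U HU D P saD saP UD UP theta I d c h.
Let AtX T h := @A_theta_X H U HU D P saD saP UD UP A starA Hsigma Hcont HA theta T h.
Let AX a h := @A_X H U D P A HA a h.

Lemma W_bo d : bounded_op (W d).
Proof. exact: (U_bo HU). Qed.

Lemma W_add d e x : W (dadd d e) x = W d (W e x).
Proof. by rewrite /twistU -(U_add HU) /= !plus_IZR; f_equal; field. Qed.

Lemma W_opp_l d x : W (dopp d) (W d x) = x.
Proof.
rewrite /twistU -(U_add HU) /= !opp_IZR -[RHS](U_0 HU x); f_equal; field.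
Qed.

Lemma W_opp_r d x : W d (W (dopp d) x) = x.
Proof.
rewrite /twistU -(U_add HU) /= !opp_IZR -[RHS](U_0 HU x); f_equal; field.
Qed.

Lemma W_homog_comm d T x : homog U d T -> W d (T x) = T (W d x).
Proof.
move=> hT; rewrite /twistU (homog_U HU _ _ hT) /pairchar.
have -> : 2 * PI * (IZR (fst d) * - (theta * IZR (snd d) / 2) + IZR (snd d) * (theta * IZR (fst d) / 2)) = 0 by field.
by rewrite cis_0 cscal_real scal_one.
Qed.

Lemma A_theta_bigsum_scal (I : Type) (d : I -> Z * Z) c z : fam d c -> (forall i, A (c i)) -> polyb d z ->
  At (bigsum (fun i => op_scal (z i) (op_comp (W (d i)) (c i)))).
Proof.
move=> hf hA hz.
have -> : bigsum (fun i => op_scal (z i) (op_comp (W (d i)) (c i))) =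
   bigsum (fun i => op_comp (W (d i)) (op_scal (z i) (c i))).
  by apply: bigsum_ext => i; apply: op_ext => x; rewrite /op_comp /op_scal (bo_cscal (W_bo _)).
by apply: intro; [exact: (fam_scal HU saD saP hf hz) | move=> i; exact: A_scal].
Qed.

Lemma A_theta_zero : At (@op_zero H).
Proof.
have hX0 := proj1 (delta_dom_zero saD saP).
pose c (_ : Z * Z) := @op_zero H.
have hf : fam (fun d => d) c.
  split=> //; split; first by move=> d; exact: homog_zero.
  move=> j k N; exists 0 => L _; right.
  by elim: L => //= a L ->; rewrite (seminorm_zero saD saP); ring.
have := intro hf (fun _ => A_zero starA).
have -> // : bigsum (fun i => op_comp (W i) (c i)) = @op_zero H.
have E i : op_comp (W i) (c i) = @op_zero H.
  by apply: op_ext => x; rewrite /op_comp /c /op_zero (bo_zero (W_bo _)).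
rewrite -(E (0, 0)%Z); apply: (bigsum_single saD saP (c := fun i => op_comp (W i) (c i))).
  by rewrite E.
by move=> i _.
Qed.

Lemma A_theta_plus T S : At T -> At S -> At (op_plus T S).
Proof.
move=> /elim [c [hf [hA ->]]] /elim [c' [hf' [hA' ->]]].
rewrite -(bigsum_plus saD saP (fam_psummable (famW hf)) (fam_psummable (famW hf'))).
have -> : bigsum (fun i => op_plus (op_comp (W i) (c i)) (op_comp (W i) (c' i))) =
   bigsum (fun i => op_comp (W i) (op_plus (c i) (c' i))).
  by apply: bigsum_ext => i; apply: op_ext => x; rewrite /op_comp /op_plus (bo_plus (W_bo _)).
by apply: intro; [exact: (fam_plus HU saD saP hf hf') | move=> i; exact: A_plus].
Qed.

Lemma A_theta_scal z T : At T -> At (op_scal z T).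
Proof.
move=> /elim [c [hf [hA ->]]].
rewrite -(bigsum_scal saD saP _ (fam_psummable (famW hf))).
apply: (A_theta_bigsum_scal (z := fun _ => z) hf hA).
by exists (Cmod z), O; split; [exact: Cmod_ge_0 | move=> i /=; lra].
Qed.

(** Moving [W] of degree e to the left past an element of degree d costs the character d at the
    parameter of e. Its conjugate z is the phase in the product, and [W_add] merges the two
    unitaries. *)
Lemma A_theta_comp T S : At T -> At S -> At (op_comp T S).
Proof.
move=> /elim [c [hf [hA ->]]] /elim [c' [hf' [hA' ->]]].
rewrite (bigsum_prod HU saD saP (famW hf) (famW hf')).
have hp := fam_prod HU saD saP hf hf'.
pose z (ij : (Z * Z) * (Z * Z)) := Cconj (pairchar (fst ij) (- (theta * IZR (snd (snd ij)) / 2)) (theta * IZR (fst (snd ij)) / 2)).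
have hz : polyb (fun ij => dadd (fst ij) (snd ij)) z.
  by apply: polyb_unit => ij; rewrite /z Cmod_conj Cmod_pairchar.
have := A_theta_bigsum_scal hp (fun ij => A_comp starA (hA (fst ij)) (hA' (snd ij))) hz.
have -> // : bigsum (fun ij => op_scal (z ij) (op_comp (W (dadd (fst ij) (snd ij))) (op_comp (c (fst ij)) (c' (snd ij))))) =
  bigsum (fun ij => op_comp (op_comp (W (fst ij)) (c (fst ij))) (op_comp (W (snd ij)) (c' (snd ij)))).
apply: bigsum_ext => [[i j]]; apply: op_ext => x; rewrite /op_comp /op_scal /= W_add.
case: hf => _ [hh _].
rewrite -(bo_cscal (W_bo i)); f_equal.
rewrite /twistU (homog_U HU _ _ (hh i)) cscal_assoc /z /=.
rewrite /pairchar cis_conj -cis_plus Rplus_opp_l cis_0 cscal_real scal_one //.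
Qed.

Lemma is_adjoint_radj T S : is_adjoint T S -> radj T S.
Proof. by move=> h x y; rewrite /rin h. Qed.

Lemma radj_is_adjoint T S : bounded_op T -> radj T S -> is_adjoint T S.
Proof. by move=> bT h x y; rewrite !inner_rin h -(bo_cscal bT) h. Qed.

Lemma radj_unique T S S' : radj T S -> radj T S' -> S = S'.
Proof.
by move=> h h'; apply: op_ext => y; apply: rin_ext => z; rewrite !(rin_sym _ z) -h -h'.
Qed.

Lemma radj_Ad s t T S : radj T S -> radj (Ad U s t T) (Ad U s t S).
Proof.
have u a b x y : rin (U a b x) y = rin x (U (- a) (- b) y).
  by rewrite -[y in LHS](U_inv_r HU a b) (U_rin HU).
move=> h x y; rewrite /Ad u h -[in RHS](U_inv_l HU s t (S _)) -(U_rin HU s t).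
by rewrite (U_inv_r HU) (U_inv_l HU).
Qed.

Lemma homog_radj d T S : bounded_op S -> radj T S -> homog U d T -> homog U (dopp d) S.
Proof.
move=> bS h hT s t; apply: (radj_unique (T := Ad U s t T)); first exact: radj_Ad.
rewrite hT => x y; rewrite /op_scal.
have cs z a b : rin (cscal z a) b = rin a (cscal (Cconj z) b).
  rewrite /rin inner_cscal_l inner_cscal_r; f_equal.
  by rewrite (_ : Cconj (Cconj z) = z) //; apply: injective_projections => /=; ring.
rewrite cs /pairchar cis_conj h (bo_cscal bS); do 3 f_equal.
by rewrite /= !opp_IZR; ring.
Qed.

Lemma radj_fsum (I : Type) (c c' : I -> op H) L : (forall i, radj (c i) (c' i)) -> radj (fsum c L) (fsum c' L).
Proof.
move=> h; elim: L => [|a L IH] x y /=; first by rewrite /op_zero; rvec.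
by rewrite /op_plus; rvec; rewrite h IH.
Qed.

Lemma radj_bigsum (I : Type) (c c' : I -> op H) : psummable D P c -> psummable D P c' ->
  (forall i, radj (c i) (c' i)) -> radj (bigsum c) (bigsum c').
Proof.
move=> hs hs' h x y.
have [XT hT] := bigsum_spec saD saP hs; have [XS hS] := bigsum_spec saD saP hs'.
set T := bigsum c in XT hT *; set S := bigsum c' in XS hS *.
apply: Rminus_diag_uniq; apply: Rabs_eq_0; apply: Rle_antisym; last exact: Rabs_pos.
apply: le_epsilon => eps e0; rewrite Rplus_0_l.
have nx := norm_pos x; have ny := norm_pos y.
pose q := 2 * (norm x * norm y + 1).
have q0 : 0 < q by rewrite /q; nra.
have e1 : 0 < eps / q by apply: Rdiv_lt_0_compat.
have [L0 h0] := hT false O _ e1; have [L1 h1] := hS false O _ e1.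
have [L [nd [i0 i1]]] := list_union L0 L1.
have a0 : opnorm (op_minus T (fsum c L)) <= eps / q := h0 L nd i0.
have a1 : opnorm (op_minus S (fsum c' L)) <= eps / q := h1 L nd i1.
case: hs => hX _; case: hs' => hX' _.
have b0 := bo_op_minus (delta_dom_bo XT) (delta_dom_bo (delta_dom_fsum saD saP L hX)).
have b1 := bo_op_minus (delta_dom_bo XS) (delta_dom_bo (delta_dom_fsum saD saP L hX')).
have -> : rin (T x) y - rin x (S y) = rin (op_minus T (fsum c L) x) y - rin x (op_minus S (fsum c' L) y).
  by rewrite /op_minus; rvec; rewrite (radj_fsum L h); ring.
apply: Rle_trans (Rabs_triang _ _) _; rewrite Rabs_Ropp.
have c0 := cauchy_schwarz (op_minus T (fsum c L) x) y; have c1 := cauchy_schwarz x (op_minus S (fsum c' L) y).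
have d0 := opnorm_bnd b0 x; have d1 := opnorm_bnd b1 y.
have f0 : norm (op_minus T (fsum c L) x) <= eps / q * norm x.
  by apply: Rle_trans d0 _; apply: Rmult_le_compat_r.
have f1 : norm (op_minus S (fsum c' L) y) <= eps / q * norm y.
  by apply: Rle_trans d1 _; apply: Rmult_le_compat_r.
have g0 : norm (op_minus T (fsum c L) x) * norm y <= eps / q * norm x * norm y by apply: Rmult_le_compat_r.
have g1 : norm x * norm (op_minus S (fsum c' L) y) <= norm x * (eps / q * norm y) by apply: Rmult_le_compat_l.
have E : eps / q * q = eps by field; lra.
apply: Rle_trans (Rplus_le_compat _ _ _ _ (Rle_trans _ _ _ c0 g0) (Rle_trans _ _ _ c1 g1)) _.
have -> : eps / q * norm x * norm y + norm x * (eps / q * norm y) = eps / q * (2 * (norm x * norm y)) by ring.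
by rewrite -[X in _ <= X]E; apply: Rmult_le_compat_l; [lra | rewrite /q; lra].
Qed.

(** The adjoint of [W d] composed with [c d] is the adjoint of [c d] followed on the right by
    [W (dopp d)]. That adjoint has degree [dopp d], so the unitary moves to the left without a
    phase. *)
Lemma A_theta_adjoint T : At T -> exists S, At S /\ is_adjoint T S.
Proof.
move=> /elim [c [hf [hA ->]]].
have adj d : exists S, A S /\ is_adjoint (c d) S.
  by case: starA => _ [_ [_ [_ [_ h]]]]; exact: h.
pose c' d := proj1_sig (constructive_indefinite_description _ (adj d)).
have hc' d : A (c' d) /\ is_adjoint (c d) (c' d) := proj2_sig (constructive_indefinite_description _ (adj d)).
case: (hf) => hX [hh hs].
have hr d : radj (c d) (c' d) by apply: is_adjoint_radj; case: (hc' d).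
have hX' d : X (c' d) by apply: AX; case: (hc' d).
have hh' d : homog U (dopp d) (c' d) by apply: homog_radj (hr d) (hh d); exact: (delta_dom_bo (hX' d)).
have hf' : fam dopp c'.
  split=> //; split=> // j k N; apply: summable_le (hs j k N) _ => d; rewrite wt_dopp.
  apply: Rmult_le_compat_l; first by have := wt_pow_ge1 d N; lra.
  exact: (radj_X saD saP (hX d) (hX' d) (hr d)).
exists (bigsum (fun d => op_comp (W (dopp d)) (c' d))); split.
  by apply: intro => // d; case: (hc' d).
apply: radj_is_adjoint; first exact: (delta_dom_bo (bigsum_X saD saP (fam_psummable (famW hf)))).
apply: radj_bigsum; [exact: (fam_psummable (famW hf)) | exact: (fam_psummable (famW hf')) |].
move=> d x y; rewrite /op_comp -[y in LHS](W_opp_r d) {1 2}/twistU (U_rin HU) (hr d).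
by rewrite (W_homog_comm _ (hh' d)).
Qed.

Lemma A_theta_star : star_algebra At.
Proof.
split; first exact: A_theta_zero.
split; first by move=> T /AtX; exact: delta_dom_bo.
split; first by move=> T S; exact: A_theta_plus.
split; first by move=> z T; exact: A_theta_scal.
split; first by move=> T S; exact: A_theta_comp.
exact: A_theta_adjoint.
Qed.

(** Evenness and compactness pass to norm limits and hold for these finite sums, since each term is
    a unitary times an element of A. *)
Lemma A_theta_approx T eps : At T -> 0 < eps -> exists L : list (Z * Z), exists c : Z * Z -> op H,
  (forall d, A (c d)) /\ (forall d, homog U d (c d)) /\
  opnorm (op_minus T (fsum (fun d => op_comp (W d) (c d)) L)) <= eps /\
  bounded_op (fsum (fun d => op_comp (W d) (c d)) L).
Proof.
move=> /elim [c [hf [hA ->]]] e0.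
have hps := fam_psummable (famW hf).
have [XS hS] := bigsum_spec saD saP hps; have [L0 h] := hS false O eps e0.
have [L [nd [hi _]]] := list_union L0 nil.
exists L, c; split=> //; split; first by case: hf => _ [].
split; first exact: h.
by apply: fsum_bo => d; apply: bo_op_comp; [exact: W_bo | case: hf => hX _; exact: (delta_dom_bo (hX d))].
Qed.

Lemma A_theta_even (G : bool -> H -> Prop) : is_grading G -> (forall a, A a -> even_op G a) ->
  (forall s t, even_op G (U s t)) -> forall T, At T -> even_op G T.
Proof.
move=> [hG _] evA evU T hT i x hx.
have [g0 [gp [gs gc]]] := hG i.
apply: gc => /= [[eps heps]].
have bT := delta_dom_bo (AtX hT).
have nx := norm_pos x.
have e0 := cond_pos eps.
have e1 : 0 < eps / (2 * (norm x + 1)) by apply: Rdiv_lt_0_compat; lra.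
have [L [c [hA [_ [ha bF]]]]] := A_theta_approx hT e1.
set F := fsum _ L in ha bF.
have FG : G i (F x).
  have ev : even_op G F.
    apply: fsum_ind.
    - by move=> j y _; case: (hG j).
    - by move=> S S' hS hS' j y hy; case: (hG j) => _ [hp _]; apply: hp; [exact: hS | exact: hS'].
    - by move=> d j y hy; apply: evU; exact: (evA _ (hA d)).
  exact: ev.
apply: (heps (F x)) FG; apply: norm_compat1.
rewrite norm_minus_sym; apply: Rle_lt_trans (opnorm_bnd (bo_op_minus bT bF) x) _.
apply: Rle_lt_trans (_ : eps / (2 * (norm x + 1)) * (norm x + 1) < _).
  by apply: Rmult_le_compat => //; [apply: opnorm_pos; exact: bo_op_minus | lra].
have -> : eps / (2 * (norm x + 1)) * (norm x + 1) = eps / 2 by field; lra.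
lra.
Qed.

Lemma A_theta_compact (J : op H) : bounded_op J -> (forall a, A a -> compact_op (op_comp a J)) ->
  forall T, At T -> compact_op (op_comp T J).
Proof.
move=> bJ cA T hT; apply: compact_limit => eps e0.
have bT := delta_dom_bo (AtX hT).
have j0 := opnorm_pos bJ.
have e1 : 0 < eps / (opnorm J + 1) by apply: Rdiv_lt_0_compat; lra.
have [L [c [hA [_ [ha bF]]]]] := A_theta_approx hT e1.
set F := fsum _ L in ha bF.
exists (op_comp F J); split.
  rewrite /F; elim: L {F ha bF} => [|d L IH] /=; first exact: compact_zero.
  have h1 : compact_op (fun x => W d (op_comp (c d) J x)) by apply: compact_left; [exact: W_bo | exact: cA].
  exact: (compact_plus h1 IH).
move=> x; apply: Rle_trans (opnorm_bnd (bo_op_minus bT bF) (J x)) _.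
have nJ := opnorm_bnd bJ x; have nx := norm_pos x.
apply: Rle_trans (_ : eps / (opnorm J + 1) * (opnorm J * norm x) <= _).
  by apply: Rmult_le_compat => //; [apply: opnorm_pos; exact: bo_op_minus | exact: norm_pos].
have {2}-> : eps = eps / (opnorm J + 1) * (opnorm J + 1) by field; lra.
rewrite Rmult_assoc; apply: Rmult_le_compat_l; first lra.
by apply: Rmult_le_compat_r; lra.
Qed.

Lemma A_theta_regular : regular At D P.
Proof.
move=> a b /AtX ha /AtX hb k.
have [t1 [t2 [t3 t4]]] := delta_dom_tower ha; have [s1 [s2 [s3 s4]]] := delta_dom_tower hb.
apply: (dom_iter_comm_of (sa_determining saP) (f := fun k => op_plus (Lam D P false k a) (Lam D P true k b))).
  by apply: bo_op_plus => //; exact: (Lam_bo true 0 hb).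
by move=> i; apply: is_comm_plus.
Qed.

Lemma A_theta_smooth : smooth_action At D P U.
Proof.
split.
  move=> s t a /elim [c [hf [hA ->]]].
  rewrite (fam_Ad HU saD saP UD UP s t (famW hf)).
  by apply: A_theta_bigsum_scal => //; apply: polyb_unit => d; exact: Cmod_pairchar.
move=> a /elim [c [hf [hA ->]]].
apply: (fam_smooth HU saD saP UD UP (famW hf)) => z hz.
exact: A_theta_bigsum_scal.
Qed.

End DeformedTriple.

(** * The generators and the seminorms nu *)

Section Generators.
Context {H : Hilbert}.
Implicit Types (T S B : op H) (x y z : H).

Lemma generator_value_eps (V : R -> op H) x y : is_generator_value V x y <->
  forall eps, 0 < eps -> exists delta, 0 < delta /\ forall t, t <> 0 -> Rabs t < delta ->
    norm (minus (scal (/ t) (minus (V t x) x)) y) <= eps.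
Proof.
have f0 := @norm_factor_gt_0 _ H.
split=> h.
  move=> eps e0.
  have e1 : 0 < eps / norm_factor (V := H) by apply: Rdiv_lt_0_compat.
  have [d hd] := proj1 (filterlim_locally (fun t : R => scal (/ t) (minus (V t x) x)) y) h (mkposreal _ e1).
  exists d; split; first exact: cond_pos.
  move=> t t0 ht.
  have B : ball (0 : R) d t by change (Rabs (t - 0) < d); rewrite Rminus_0_r.
  have := norm_compat2 _ _ _ (hd t B t0) => /=.
  have -> : norm_factor (V := H) * (eps / norm_factor (V := H)) = eps by field; lra.
  exact: Rlt_le.
apply/(filterlim_locally (fun t : R => scal (/ t) (minus (V t x) x)) y) => eps.
have [d [d0 hd]] := h (eps / 2) ltac:(have := cond_pos eps; lra).
exists (mkposreal d d0) => t B t0; apply: norm_compat1.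
have ht : Rabs t < d by move: B; change (ball (0 : R) (mkposreal d d0) t) with (Rabs (t - 0) < d); rewrite Rminus_0_r.
by apply: Rle_lt_trans (hd t t0 ht) _; have := cond_pos eps; lra.
Qed.

Lemma generator_value_unique (V : R -> op H) x y y' :
  is_generator_value V x y -> is_generator_value V x y' -> y = y'.
Proof.
move=> /generator_value_eps h /generator_value_eps h'; apply: norm_small_eq => eps e0.
have [d [d0 hd]] := h (eps / 2) ltac:(lra); have [d' [d0' hd']] := h' (eps / 2) ltac:(lra).
have m0 : 0 < Rmin d d' by exact: Rmin_pos.
pose t := Rmin d d' / 2.
have t0 : t <> 0 by rewrite /t; lra.
have ta : Rabs t < Rmin d d' by rewrite /t Rabs_pos_eq; lra.
have a := hd t t0 (Rlt_le_trans _ _ _ ta (Rmin_l _ _)).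
have b := hd' t t0 (Rlt_le_trans _ _ _ ta (Rmin_r _ _)).
rewrite norm_minus_sym in a.
apply: Rle_trans (norm_minus_trans _ _ _) _.
apply: Rle_trans (Rplus_le_compat _ _ _ _ a b) _; lra.
Qed.

Lemma generator_eq (V : R -> op H) x y : is_generator_value V x y ->
  dom (generator V) x /\ generator V x = y.
Proof.
move=> h; split; first by exists y.
apply: (@generator_value_unique V x) => //=.
by apply: epsilon_spec; exists y.
Qed.

(** With V_t T x = (V_t T V_-t) V_t x, the quotient of V at T x splits by the product rule: the
    quotient at x is taken through the conjugate of T, and the rest is the norm derivative of that
    conjugate. *)
Lemma generator_is_comm (V : R -> op H) T B : ugroup V -> bounded_op T -> bounded_op B ->
  (forall eps, 0 < eps -> exists delta, 0 < delta /\ forall h, h <> 0 -> Rabs h < delta ->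
    opnorm (op_minus (op_scal (RtoC (/ h)) (op_minus (conj V h T) T)) B) <= eps) ->
  is_comm (generator V) T B.
Proof.
move=> hV bT bB hd; split=> // x [y hy].
have [_ Px] := generator_eq hy.
have [a b] : dom (generator V) (T x) /\ generator V (T x) = plus (T y) (B x).
  apply: generator_eq; apply/generator_value_eps => eps e0.
  have nx := norm_pos x; have T0 := opnorm_pos bT.
  have e1 : 0 < eps / (3 * (opnorm T + 1)) by apply: Rdiv_lt_0_compat; lra.
  have e2 : 0 < eps / (3 * (norm x + 1)) by apply: Rdiv_lt_0_compat; lra.
  have [d1 [d10 h1]] := proj1 (generator_value_eps V x y) hy _ e1.
  have [d2 [d20 h2]] := hd _ e2.
  have [d3 [d30 h3]] := proj1 (continuous_eps _ _) (@ct_conj H V hV T y bT 0) (eps / 3) ltac:(lra).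
  exists (Rmin d1 (Rmin d2 d3)); split; first by apply: Rmin_pos => //; exact: Rmin_pos.
  move=> t t0 ht.
  have m1 := Rlt_le_trans _ _ _ ht (Rmin_l _ _); have m := Rlt_le_trans _ _ _ ht (Rmin_r _ _).
  have m2 := Rlt_le_trans _ _ _ m (Rmin_l _ _); have m3 := Rlt_le_trans _ _ _ m (Rmin_r _ _).
  have {}h1 := h1 t t0 m1; have {}h2 := h2 t t0 m2.
  have {}h3 : norm (minus (conj V t T y) (T y)) <= eps / 3.
    by have := h3 t; rewrite Rminus_0_r (conj_0 hV) => q; exact: q.
  have bc := conj_bo hV t bT.
  set w := scal (/ t) (minus (V t x) x) in h1.
  set Q := op_minus (op_scal _ _) B in h2.
  have -> : minus (scal (/ t) (minus (V t (T x)) (T x))) (plus (T y) (B x)) =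
     plus (conj V t T (minus w y)) (plus (minus (conj V t T y) (T y)) (Q x)).
    rewrite /w /Q (bo_minus bc) (bo_scal bc) (bo_minus bc) /op_minus /op_scal cscal_real.
    have -> : conj V t T (V t x) = V t (T x) by rewrite /conj (ug_inv_l hV).
    cvec.
  have bQ : bounded_op Q by apply: bo_op_minus => //; apply: bo_op_scal; exact: bo_op_minus.
  have a1 : norm (conj V t T (minus w y)) <= eps / 3.
    apply: Rle_trans (opnorm_bnd bc _) _.
    apply: Rle_trans (_ : (opnorm T + 1) * (eps / (3 * (opnorm T + 1))) <= _); last by right; field; lra.
    apply: Rmult_le_compat => //; [exact: opnorm_pos | exact: norm_pos |].
    by have := conj_le hV t bT; lra.
  have a2 : norm (Q x) <= eps / 3.
    apply: Rle_trans (opnorm_bnd bQ _) _.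
    apply: Rle_trans (_ : (eps / (3 * (norm x + 1))) * (norm x + 1) <= _); last by right; field; lra.
    by apply: Rmult_le_compat => //; [exact: opnorm_pos | lra].
  apply: Rle_trans (norm_le_plus _ _) _.
  apply: Rle_trans (Rplus_le_compat_l _ _ _ (norm_le_plus _ _)) _; lra.
by split=> //; rewrite b Px; cvec.
Qed.

Lemma generator_eigen (V : R -> op H) m x : (forall t, V t x = cscal (pchar m t) x) -> dom (generator V) x.
Proof.
move=> hx; exists (cscal (freq m) x); apply/generator_value_eps => eps e0.
have nx := norm_pos x.
pose K := 128 * Rabs (IZR m) ^ 2 * norm x.
have K0 : 0 <= K by apply: Rmult_le_pos => //; apply: Rmult_le_pos; [lra | apply: pow_le; exact: Rabs_pos].
exists (eps / (K + 1)); split; first by apply: Rdiv_lt_0_compat; lra.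
move=> t t0 ht.
have -> : minus (scal (/ t) (minus (V t x) x)) (cscal (freq m) x) =
  cscal (Cminus (Cmult (RtoC (/ t)) (Cminus (pchar m t) (RtoC 1))) (freq m)) x.
  by rewrite hx; cvec.
rewrite norm_cscal; apply: Rle_trans (Rmult_le_compat_r _ _ _ nx (diff_quot m t0)) _.
rewrite Rmult_assoc -/K.
apply: Rle_trans (_ : eps / (K + 1) * (K + 1) <= _); last by right; field; lra.
by apply: Rmult_le_compat => //; [exact: Rabs_pos | lra | lra].
Qed.

End Generators.

(** * Iterated commutators with the generators, and completeness *)

Section Nu.
Context {H : Hilbert}.
Variable U : R -> R -> op H.
Hypothesis HU : torus_unitary_rep U.
Variables D P : pop H.
Hypotheses (saD : selfadjoint D) (saP : selfadjoint P).
Hypotheses (UD : forall s t, commutes (U s t) D) (UP : forall s t, commutes (U s t) P).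
Notation X := (delta_dom D P).
Notation p := (delta_seminorm D P).
Notation bigsum := (bigsum D P).
Notation fam := (fam U D P).
Implicit Types (T S : op H).

(** Joint eigenvectors lie in the domain of the generator, and the spectral subspaces are total. *)
Lemma h1_determining : determining (h1 U).
Proof.
move=> B bB h; apply: (spectral_subspaces_total HU bB) => m n x hx; apply: h.
apply: (generator_eigen (m := m)) => t; rewrite hx /pchar; do 2 f_equal; ring.
Qed.

Lemma h2_determining : determining (h2 U).
Proof.
move=> B bB h; apply: (spectral_subspaces_total HU bB) => m n x hx; apply: h.
apply: (generator_eigen (m := n)) => t; rewrite hx /pchar; do 2 f_equal; ring.
Qed.

Section OneFamily.
Variables (I : Type) (d : I -> Z * Z) (c : I -> op H).
Hypothesis hf : fam d c.

(** The derivative of order (i,j) of the orbit at the identity; [E1] and [E2] show that the next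
    derivative is a commutator with [h1] or [h2]. *)
Let E i j := dsum D P d c i j 0 0.

Let zb i j s t : polyb d (fun k => Cmult (der i j (d k)) (pairchar (d k) s t)).
Proof. by apply: polyb_mult; [exact: polyb_der | apply: polyb_unit => k; exact: Cmod_pairchar]. Qed.

Let XE i j : X (E i j).
Proof. exact: (bigsum_X saD saP (fam_psummable (fam_scal HU saD saP hf (zb i j 0 0)))). Qed.

Let dsum_Ad i j s t : dsum D P d c i j s t = Ad U s t (E i j).
Proof.
rewrite /E /dsum (fam_Ad HU saD saP UD UP s t (fam_scal HU saD saP hf (zb i j 0 0))).
apply: bigsum_ext => k; rewrite op_scal_scal; f_equal.
have -> : pairchar (d k) 0 0 = RtoC 1 by rewrite /pairchar !Rmult_0_r Rplus_0_r Rmult_0_r cis_0.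
by rewrite Cmult_1_r Cmult_comm.
Qed.

(** [dsum_diff] in the seminorm of order 0 is a derivative in operator norm, the form that
    [generator_is_comm] takes. *)
Let E1 i j : is_comm (h1 U) (E i j) (E (S i) j).
Proof.
apply: (generator_is_comm (ugroup_V1 HU)); [exact: (delta_dom_bo (XE i j)) | exact: (delta_dom_bo (XE (S i) j)) |].
have hch h e : pairchar e h 0 = pchar (fst e) h.
  by rewrite pairchar_split {2}/pchar !Rmult_0_r cis_0 Cmult_1_r.
have := @dsum_diff H U HU D P saD saP I d c fst i j (S i) j 0 0 (fun h => h) (fun _ => 0) hf wt_fst hch (der_S1 i j) false O.
move=> /is_lim_0_eps lim eps e0; have [dl [dl0 hd]] := lim eps e0.
exists dl; split=> // h h0 hh; have := hd h h0 hh.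
rewrite /= !dsum_Ad !Rplus_0_l ?Rplus_0_r !(Ad_0 HU) (Ad_conj HU) (conj_0 (ugroup_V2 HU)).
by move=> /Rabs_def2 [q _]; apply: Rlt_le.
Qed.

Let E2 i j : is_comm (h2 U) (E i j) (E i (S j)).
Proof.
apply: (generator_is_comm (ugroup_V2 HU)); [exact: (delta_dom_bo (XE i j)) | exact: (delta_dom_bo (XE i (S j))) |].
have hch h e : pairchar e 0 h = pchar (snd e) h.
  by rewrite pairchar_split {1}/pchar !Rmult_0_r cis_0 Cmult_1_l.
have := @dsum_diff H U HU D P saD saP I d c snd i j i (S j) 0 0 (fun _ => 0) (fun h => h) hf wt_snd hch (der_S2 i j) false O.
move=> /is_lim_0_eps lim eps e0; have [dl [dl0 hd]] := lim eps e0.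
exists dl; split=> // h h0 hh; have := hd h h0 hh.
rewrite /= !dsum_Ad !Rplus_0_l ?Rplus_0_r !(Ad_0 HU) (Ad_conj HU) (conj_0 (ugroup_V1 HU)).
by move=> /Rabs_def2 [q _]; apply: Rlt_le.
Qed.

Let E00 : E 0 0 = bigsum c.
Proof. by rewrite /E (dsum_00 HU saD saP UD UP _ _ hf) (Ad_0 HU). Qed.

Let it2 j : iter_comm (h2 U) j (bigsum c) = E 0 j.
Proof. by rewrite -E00; apply: (iter_comm_eq h2_determining (f := E 0%nat)). Qed.

Let it1 i j : iter_comm (h1 U) i (E 0 j) = E i j.
Proof. by apply: (iter_comm_eq h1_determining (f := fun i => E i j)). Qed.

Lemma hcomm_bigsum al : hcomm U al (bigsum c) = dsum D P d c (fst al) (snd al) 0 0.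
Proof. by rewrite /hcomm it2 it1. Qed.

Lemma nu_dom_bigsum k al : nu_dom D P U k al (bigsum c).
Proof.
split.
  rewrite -E00; apply: (dom_iter_comm_of h2_determining (f := E 0%nat)) => //.
  exact: (delta_dom_bo (XE 0 0)).
split.
  rewrite it2; apply: (dom_iter_comm_of h1_determining (f := fun i => E i (snd al))) => //.
  exact: (delta_dom_bo (XE 0 (snd al))).
rewrite hcomm_bigsum; have [a [b e]] := XE (fst al) (snd al); split; first exact: a.
by split; [exact: b | exact: e].
Qed.

Lemma hcomm_X al : X (hcomm U al (bigsum c)).
Proof. by rewrite hcomm_bigsum; exact: XE. Qed.

(** Only the members of degree e contribute, and on them the multiplier is the constant [der] at
    e. *)
Lemma hcomp_hcomm al e : hcomp U e (hcomm U al (bigsum c)) =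
  op_scal (der (fst al) (snd al) e) (hcomp U e (bigsum c)).
Proof.
have hz := zb (fst al) (snd al) 0 0.
rewrite hcomm_bigsum /dsum (hcomp_bigsum HU saD saP UD UP _ (fam_psummable (fam_scal HU saD saP hf hz))).
rewrite (hcomp_bigsum HU saD saP UD UP _ (fam_psummable hf)).
case: (hf) => hX [hh hs].
have hps : psummable D P (fun i => hcomp U e (c i)).
  split; first by move=> i; case: (delta_dom_comp2 HU saD saP UD UP e (hX i)).
  move=> j k; case: (fam_psummable hf) => _ hs'; apply: summable_le (hs' j k) _ => i.
  exact: (seminorm_comp2 HU saD saP UD UP).
rewrite -(bigsum_scal saD saP _ hps); apply: bigsum_ext => i.
have bc := delta_dom_bo (hX i); rewrite (hcomp_op_scal HU) //.
have -> : pairchar (d i) 0 0 = RtoC 1 by rewrite /pairchar !Rmult_0_r Rplus_0_r Rmult_0_r cis_0.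
rewrite Cmult_1_r; case: (eq_dec_classic (d i) e) => [->//|ne].
rewrite (hcomp_of_homog_ne HU (e := d i) _ bc (hh i)); last by move=> E'; apply: ne.
by apply: op_ext => x; rewrite /op_scal /op_zero; cvec.
Qed.

End OneFamily.

Variable A : op H -> Prop.
Hypothesis starA : star_algebra A.
Hypothesis Hsigma : forall s t a, A a -> A (Ad U s t a).
Hypothesis Hcont : forall a, A a -> delta_continuous D P (fun s t => Ad U s t a).
Hypothesis HA : forall a, A a <-> A_infty A D P U a.
Variable theta : R.
Notation W := (twistU U theta).
Notation At := (A_theta A U theta).

Let elim T h := @A_theta_elim H U HU D P saD saP UD UP A starA Hsigma Hcont HA theta T h.
Let famW I d c h := @fam_W H U HU D P saD saP UD UP theta I d c h.
Let AtX T h := @A_theta_X H U HU D P saD saP UD UP A starA Hsigma Hcont HA theta T h.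
Let Xm T S (hT : X T) (hS : X S) : X (op_minus T S) := proj1 (delta_dom_minus saD saP hT hS).
Let Xh d T (hT : X T) : X (hcomp U d T) := proj1 (delta_dom_comp2 HU saD saP UD UP d hT).

Let A_theta_hcomm T al : At T -> X (hcomm U al T) /\
  forall e, hcomp U e (hcomm U al T) = op_scal (der (fst al) (snd al) e) (hcomp U e T).
Proof.
move=> /elim [c [hf [hA ->]]]; split; first exact: (hcomm_X (famW hf)).
by move=> e; exact: (hcomp_hcomm (famW hf)).
Qed.

Let A_theta_minus T S : At T -> At S -> At (op_minus T S).
Proof.
move=> hT hS; rewrite op_minus_plus.
apply: (A_theta_plus HU saD saP UD UP starA Hsigma Hcont HA) => //.
exact: (A_theta_scal HU saD saP UD UP starA Hsigma Hcont HA).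
Qed.

(** Iterated commutators are chosen, so additivity is read off from the components, on which [hcomm]
    acts by a scalar. *)
Let hcomm_minus T S al : At T -> At S -> hcomm U al (op_minus T S) = op_minus (hcomm U al T) (hcomm U al S).
Proof.
move=> hT hS; have [a ea] := A_theta_hcomm al hT; have [b eb] := A_theta_hcomm al hS.
have [c ec] := A_theta_hcomm al (A_theta_minus hT hS).
have bT := delta_dom_bo (AtX hT); have bS := delta_dom_bo (AtX hS).
apply: (hcomp_unique HU); [exact: (delta_dom_bo c) | exact: (delta_dom_bo (Xm a b)) |].
move=> e; rewrite ec (hcomp_op_minus HU e bT bS) (hcomp_op_minus HU e (delta_dom_bo a) (delta_dom_bo b)) ea eb.
by apply: op_ext => x; rewrite /op_scal /op_minus; cvec.
Qed.

Let W_left d T : X T -> X (op_comp (W d) T) /\ forall j k, p j k (op_comp (W d) T) <= p j k T.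
Proof. exact: (delta_dom_leftU HU saD saP UD UP). Qed.

Lemma A_theta_hcomp_mem T d : At T -> A (op_comp (W (dopp d)) (hcomp U d T)).
Proof.
move=> /elim [c [hf [hA ->]]]; rewrite (hcomp_bigsum_id HU saD saP UD UP d (famW hf)).
have -> // : op_comp (W (dopp d)) (op_comp (W d) (c d)) = c d.
by apply: op_ext => x; rewrite /op_comp (W_opp_l HU).
Qed.

(** The Cauchy condition for all [nu] makes every [hcomm U al (a n)] Cauchy in the domain of the
    derivations. The limits [E al] play the role of derivatives of the limit b and supply the decay
    of its components. *)
Lemma A_theta_nu_complete : nu_complete At D P U.
Proof.
split.
  by move=> a /elim [c [hf [hA ->]]] k al; exact: (nu_dom_bigsum (famW hf)).
move=> a ha hc.
have XE al n : X (hcomm U al (a n)) by case: (A_theta_hcomm al (ha n)).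
have lim al : exists S, X S /\ forall j k eps, 0 < eps -> exists N, forall n, (N <= n)%nat ->
     p j k (op_minus (hcomm U al (a n)) S) <= eps.
  apply: (delta_dom_complete saD saP (T := fun n => hcomm U al (a n))) => // j k eps e0.
  have [N hN] := hc k al eps e0; exists N => n m hn hm.
  have := hN n m hn hm; rewrite /nu hcomm_minus //.
  have Xd := Xm (XE al n) (XE al m).
  have q1 := seminorm_pos false k Xd; have q2 := seminorm_pos true k Xd.
  move: q1 q2; rewrite !seminorm_Lam /Lam.
  by case: j; lra.
pose E al := proj1_sig (constructive_indefinite_description _ (lim al)).
have hE al : X (E al) /\ forall j k eps, 0 < eps -> exists N, forall n, (N <= n)%nat ->
     p j k (op_minus (hcomm U al (a n)) (E al)) <= eps.
  exact: proj2_sig (constructive_indefinite_description _ (lim al)).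
pose b := E (0, 0)%nat.
have Xb : X b := proj1 (hE (0, 0)%nat).
have hb j k eps : 0 < eps -> exists N, forall n, (N <= n)%nat -> p j k (op_minus (a n) b) <= eps.
  by move=> e0; have [_ h] := hE (0, 0)%nat; exact: h.
(* Both sides are limits of the same components, so the frequency factors pass to the limit. *)
have comps al e : hcomp U e (E al) = op_scal (der (fst al) (snd al) e) (hcomp U e b).
  have [XEa hEa] := hE al; set z := der _ _ e.
  have Xzb : X (op_scal z (hcomp U e b)) := proj1 (delta_dom_scal saD saP z (Xh e Xb)).
  apply: (seminorm_small_eq (Xh e XEa) Xzb) => eps e0.
  have z0 := Cmod_ge_0 z.
  have [N1 h1] := hEa false O (eps / 2) ltac:(lra).
  have [N2 h2] := hb false O (eps / (2 * (Cmod z + 1))) ltac:(apply: Rdiv_lt_0_compat; lra).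
  have {}h1 := h1 (N1 + N2)%nat ltac:(lia); have {}h2 := h2 (N1 + N2)%nat ltac:(lia).
  set n := (N1 + N2)%nat in h1 h2.
  have [_ en] := A_theta_hcomm al (ha n).
  have Xan := AtX (ha n).
  apply: Rle_trans (seminorm_minus_trans saD saP false O (Xh e XEa) (Xh e (XE al n)) Xzb) _.
  have t1 : p false 0 (op_minus (hcomp U e (E al)) (hcomp U e (hcomm U al (a n)))) <= eps / 2.
    rewrite (seminorm_minus_sym saD saP false O (Xh e XEa) (Xh e (XE al n))).
    rewrite -(hcomp_op_minus HU); [| exact: (delta_dom_bo (XE al n)) | exact: (delta_dom_bo XEa)].
    by apply: Rle_trans (seminorm_comp2 HU saD saP UD UP false O e (Xm (XE al n) XEa)) _.
  have t2 : p false 0 (op_minus (hcomp U e (hcomm U al (a n))) (op_scal z (hcomp U e b))) <= eps / 2.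
    have -> : op_minus (hcomp U e (hcomm U al (a n))) (op_scal z (hcomp U e b)) =
       op_scal z (hcomp U e (op_minus (a n) b)).
      rewrite en (hcomp_op_minus HU); [| exact: (delta_dom_bo Xan) | exact: (delta_dom_bo Xb)].
      by apply: op_ext => x; rewrite /op_scal /op_minus -/z; cvec.
    have Xd := Xm Xan Xb.
    apply: Rle_trans (seminorm_scal saD saP false O z (Xh e Xd)) _.
    apply: Rle_trans (_ : (Cmod z + 1) * (eps / (2 * (Cmod z + 1))) <= _); last by right; field; lra.
    apply: Rmult_le_compat => //; [apply: seminorm_pos; exact: Xh | lra |].
    exact: (Rle_trans _ _ _ (seminorm_comp2 HU saD saP UD UP false O e Xd) h2).
  lra.
(* Each derivative factor times a component of b is a component of some [E (i, l)], hence bounded by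
   a seminorm of it. *)
have hfc : fam (fun d => d) (fun d => hcomp U d b).
  apply: decay_fam.
  - by move=> d; exact: Xh.
  - by move=> d; apply: (hcomp_homog HU); exact: (delta_dom_bo Xb).
  move=> j k i l; exists (p j k (E (i, l))) => d.
  have [XEa _] := hE (i, l).
  apply: Rle_trans (seminorm_comp2 HU saD saP UD UP j k d XEa); rewrite comps.
  exact: (seminorm_scal_ge saD saP j k _ (Xh d Xb)).
have bE : bigsum (fun d => hcomp U d b) = b.
  apply: (hcomp_unique HU); [exact: (delta_dom_bo (bigsum_X saD saP (fam_psummable hfc))) | exact: (delta_dom_bo Xb) |].
  by move=> d; rewrite (hcomp_bigsum_id HU saD saP UD UP d hfc).
(* The opposite degree undoes the twist; [c] is the candidate family for the undeformed element. *)
pose c d := op_comp (W (dopp d)) (hcomp U d b).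
have Xc d : X (c d) by case: (W_left (dopp d) (Xh d Xb)).
have hfe : fam (fun d => d) c.
  exact: (fam_leftU HU saD saP UD UP (fun d => - (theta * IZR (snd (dopp d)) / 2)) (fun d => theta * IZR (fst (dopp d)) / 2) hfc).
(* [c d] is a limit of untwisted components of the [a n], which lie in A; being homogeneous, it only
   has to lie in the completion. *)
have hAc d : A (c d).
  apply: (completion_homog_A HU saD saP UD UP starA HA (d := d)); first by case: hfe => _ [h _]; exact: h.
  apply/(completion_approx saD saP HA); split=> // K eps e0.
  have [N hN] : exists N : nat, forall j k, (k <= K)%nat -> forall n, (N <= n)%nat -> p j k (op_minus (a n) b) <= eps.
    apply: (finite_uniform (le := le) (Q := fun j k N => forall n, (N <= n)%nat -> p j k (op_minus (a n) b) <= eps)).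
    - by move=> x y; exists (x + y)%nat; lia.
    - by move=> j k x y q xy n yn; apply: q; lia.
    - by move=> j k; exact: hb.
  exists (op_comp (W (dopp d)) (hcomp U d (a N))); split; first exact: A_theta_hcomp_mem.
  move=> j k hk; have Xan := AtX (ha N); have Xd := Xm Xan Xb.
  have -> : op_minus (op_comp (W (dopp d)) (hcomp U d (a N))) (c d) = op_comp (W (dopp d)) (hcomp U d (op_minus (a N) b)).
    rewrite (hcomp_op_minus HU); [| exact: (delta_dom_bo Xan) | exact: (delta_dom_bo Xb)].
    by apply: op_ext => x; rewrite /op_minus /c /op_comp (bo_minus (W_bo HU theta _)).
  have [_ q] := W_left (dopp d) (Xh d Xd).
  apply: Rle_trans (q j k) _; apply: Rle_trans (seminorm_comp2 HU saD saP UD UP j k d Xd) _.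
  exact: hN.
have hAb : At b.
  have := A_theta_intro HU saD saP UD UP starA HA theta hfe hAc.
  have -> // : bigsum (fun d => op_comp (W d) (c d)) = b.
  rewrite -[RHS]bE; apply: bigsum_ext => d; apply: op_ext => x.
  by rewrite /c /op_comp (W_opp_r HU).
exists b; split=> // k al.
have [XEa hEa] := hE al; have [Xhb eb] := A_theta_hcomm al hAb.
(* Now that b is known to be in the deformed algebra, its commutators exist and have the components
   found for [E al]. *)
have Eb : hcomm U al b = E al.
  apply: (hcomp_unique HU); [exact: (delta_dom_bo Xhb) | exact: (delta_dom_bo XEa) |].
  by move=> e; rewrite eb comps.
apply/is_lim_seq_spec => eps; have e0 := cond_pos eps.
have [N1 h1] := hEa false k (eps / 3) ltac:(lra); have [N2 h2] := hEa true k (eps / 3) ltac:(lra).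
exists (N1 + N2)%nat => n hn; rewrite Rminus_0_r /nu hcomm_minus // Eb.
have {}h1 := h1 n ltac:(lia); have {}h2 := h2 n ltac:(lia).
have Xd := Xm (XE al n) XEa.
have q1 := seminorm_pos false k Xd; have q2 := seminorm_pos true k Xd.
move: q1 q2 h1 h2; rewrite !seminorm_Lam /Lam => q1 q2 r1 r2.
by rewrite Rabs_pos_eq; lra.
Qed.

End Nu.

Unset Implicit Arguments.
Set Strict Implicit.

Theorem proposition5 :
  forall (H : Hilbert) (G : bool -> hcar H -> Prop) (A : op H -> Prop)
    (D absD : pop H) (J : op H) (U : R -> R -> op H) (theta : R)
    (HabsD : is_abs D absD) (HJ : is_inv_sqrt D J)
    (Htriple : even_spectral_triple G A D J)
    (Hregular : regular A D absD)
    (HU : torus_unitary_rep U)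
    (HUeven : forall s t, even_op G (U s t))
    (HUD : forall s t, pop_eq (Ad_pop U s t D) D)
    (Hsigma : forall s t a, A a -> A (Ad U s t a))
    (Hsigma_cont : forall a, A a ->
       delta_continuous D absD (fun s t => Ad U s t a))
    (HAinfty : forall a, A a <-> A_infty A D absD U a),
    even_spectral_triple G (A_theta A U theta) D J /\
    regular (A_theta A U theta) D absD /\
    smooth_action (A_theta A U theta) D absD U /\
    nu_complete (A_theta A U theta) D absD U.
Proof.
move=> H G A D absD J U theta HabsD HJ [hG [starA [evA [saD [oddD [commA compA]]]]]] _ HU evU HUD Hs Hc HA.
have saP : selfadjoint absD by case: HabsD.
(* At U x the conjugated operator evaluates D at x, so the identity of partial operators there gives
   both the domain and the value. *)
have UD s t : commutes (U s t) D.
  move=> x dx; case: (HUD s t) => hd he.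
  have dU : dom (Ad_pop U s t D) (U s t x) by rewrite /= (U_inv_l HU).
  split; first by apply/hd.
  by rewrite -he //= (U_inv_l HU).
have UP s t : commutes (U s t) absD.
  apply: (abs_commutes HabsD HJ (u := U s t) (v := U (- s) (- t))) => //.
  - exact: (U_bo HU).
  - exact: (U_bo HU).
  - exact: (U_rin HU).
  - exact: (U_inv_r HU).
  - exact: (U_inv_l HU).
split.
  split=> //; split; first exact: (A_theta_star HU saD saP UD UP starA Hs Hc HA).
  split; first by move=> a; exact: (A_theta_even HU saD saP UD UP starA Hs Hc HA hG evA evU).
  split=> //; split=> //; split.
    by move=> a /(A_theta_X HU saD saP UD UP starA Hs Hc HA) [_ []].
  move=> a; apply: (A_theta_compact HU saD saP UD UP starA Hs Hc HA) => //.
  by case: HJ.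
split; first exact: (A_theta_regular HU saD saP UD UP starA Hs Hc HA).
split; first exact: (A_theta_smooth HU saD saP UD UP starA Hs Hc HA).
exact: (A_theta_nu_complete HU saD saP UD UP starA Hs Hc HA).
Qed.
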